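(* Let $\Bbbk$ be an algebraically closed field and let $A$ be a finite-dimensional basic $\Bbbk$-algebra with a fixed set of orthogonal primitive idempotents $\{e_\lambda\}_{\lambda\in\Lambda}$ such that $\sum_{\lambda\in\Lambda}e_\lambda=1$, whose associated category $\mathcal{A}$ is directed. Then $A$ is standardly (resp., properly) stratified for all linear orders on $\Lambda$ if and only if the graded category $\check{\mathcal{A}}$ is (isomorphic to) a left regular (resp., regular) free directed category.
   Context: All modules are finitely generated left modules unless otherwise stated; the zero module is regarded as projective. $P_\lambda=Ae_\lambda$, $S_\lambda=P_\lambda/\mathrm{rad}\,P_\lambda$. Associated category. $\mathcal{A}$ is the $\Bbbk$-linear category with objects $e_\lambda$, $\lambda\in\Lambda$, and morphism spaces $\mathcal{A}(e_\lambda,e_\mu)=e_\mu Ae_\lambda$. It is directed if there is a partial order $\leqslant$ on $\Lambda$ such that $e_\mu Ae_\lambda\neq0$ implies $\lambda\leqslant\mu$. In that case $J=\bigoplus_{\lambda\neq\mu\in\Lambda}e_\mu Ae_\lambda$ is a two-sided ideal of $A$ with $A/J\cong A_0=\bigoplus_\lambda e_\lambda Ae_\lambda$. Graded category. $\check{A}=\bigoplus_{i\geqslant0}J^i/J^{i+1}$ (with $J^0=A$) is the associated graded algebra, containing the idempotents $e_\lambda\in A_0\cong\check{A}_0$; $\check{\mathcal{A}}$ is the associated category of $\check{A}$, i.e. it has objects $e_\lambda$ and morphism spaces $e_\mu\check{A}e_\lambda$. Free directed categories. Let $Q=(Q_0,Q_1)$ be a finite acyclic quiver. A quiver of bimodules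 $\tilde{Q}=(Q_0,Q_1,f,g)$ assigns to each vertex $v\in Q_0$ a finite-dimensional local algebra $f(v)=A_v$ and to each arrow $\alpha:v\to w$ a finite-dimensional $(A_w,A_v)$-bimodule $g(\alpha)$. It determines a category $\mathcal{C}$ with object set $Q_0$: for an oriented path $\gamma:v=v_0\xrightarrow{\alpha_1}v_1\xrightarrow{\alpha_2}\cdots\xrightarrow{\alpha_n}v_n=w$ put $M_\gamma=g(\alpha_n)\otimes_{f(v_{n-1})}g(\alpha_{n-1})\otimes_{f(v_{n-2})}\cdots\otimes_{f(v_1)}g(\alpha_1)$, an $(f(w),f(v))$-bimodule (for the trivial path at $v$, $M_\gamma=f(v)$), and set $\mathcal{C}(v,w)=\bigoplus_\gamma M_\gamma$, the sum over all oriented paths $\gamma$ from $v$ to $w$; composition is given by the tensor product. A category defined in this way is called a free directed category. It is left regular if for every arrow $\alpha:v\to w$ the bimodule $g(\alpha)$ is projective as a left $f(w)$-module; right regular if for every arrow $\alpha:v\to w$ the bimodule $g(\alpha)$ is projective as a right $f(v)$-module; regular if it is both left and right regular. Stratification. For a linear order $\preccurlyeq$ on $\Lambda$, the standard module $\Delta_\lambda$ is the largest quotient of $P_\lambda$ all of whose composition factors $S_\mu$ satisfy $\mu\preccurlyeq\lambda$. The proper standard module $\overline{\Delta}_\lambda$ is the largest quotient of $P_\lambda$ all of whose composition factors $S_\mu$ satisfy $\mu\prec\lambda$, except for one copy of $S_\lambda$. $\mathcal{F}(\Delta)$ (resp. $\mathcal{F}(\overline{\Delta})$) is the category of modules having a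 finite filtration with factors isomorphic to standard (resp. proper standard) modules. $A$ is standardly stratified for $\preccurlyeq$ if ${}_AA\in\mathcal{F}(\Delta)$, and properly stratified for $\preccurlyeq$ if ${}_AA\in\mathcal{F}(\Delta)\cap\mathcal{F}(\overline{\Delta})$. *)

(* Defs.v *)
From HB Require Import structures.
From mathcomp Require Import all_boot all_order all_algebra all_field.
From mathcomp Require Import boolp classical_sets functions cardinality fsbigop.

Set Implicit Arguments.
Unset Strict Implicit.
Unset Printing Implicit Defensive.

Import GRing.Theory.
Local Open Scope ring_scope.

Section SubspaceOfPredicate.
Variables (k : fieldType) (V : vectType k).

Lemma vspace_of_predP (P : V -> Prop) :
  P 0 -> (forall a u v, P u -> P v -> P (a *: u + v)) ->
  exists U : {vspace V}, forall x, x \in U <-> P x.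
Proof.
move=> P0 Plin.
pose good (n : nat) := `[< exists U : {vspace V}, \dim U = n /\ forall x, x \in U -> P x >].
have ex0 : exists n, good n.
  exists 0%N; apply/asboolP; exists 0%VS; split; first by rewrite dimv0.
  by move=> x; rewrite memv0 => /eqP->.
have bound n : good n -> (n <= \dim {: V})%N.
  by move=> /asboolP[U [<- _]]; apply/dimvS/subvf.
case: (ex_maxnP ex0 bound) => n /asboolP[U [dimU UP]] maxn.
exists U => x; split=> [/UP//|Px].
have /maxn : good (\dim (U + <[x]>)).
  apply/asboolP; exists (U + <[x]>)%VS; split=> // y /memv_addP[u Uu [v /vlineP[a ->] ->]].
  by rewrite addrC; apply: Plin => //; apply: UP.
rewrite -dimU => le.
have /eqP-> : U == (U + <[x]>)%VS by rewrite eqEdim addvSl.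
by rewrite (subvP (addvSr _ _)) // memv_line.
Qed.

End SubspaceOfPredicate.

(* The quotient X / (X :&: Y) of two subspaces of V.  It is carried by the
   chosen complement X :\: Y of X :&: Y in X, [qpi] being the projection of X;
   [qpi_repr] and [qpi_eq0] say that it is onto with kernel X :&: Y. *)
Section Subquotient.
Variables (k : fieldType) (V : vectType k).
Implicit Types X Y : {vspace V}.

Definition subquot X Y : vectType k := subvs_of (X :\: Y)%VS.

Definition qpi X Y (v : V) : subquot X Y := vsproj (X :\: Y) (addv_pi1 X Y v).

Definition qrepr X Y (u : subquot X Y) : V := vsval u.

Fact qpi_linear X Y : linear (@qpi X Y).
Proof. by move=> a u v; rewrite /qpi !linearP. Qed.
HB.instance Definition _ X Y :=
  GRing.isLinear.Build k V (subquot X Y) _ (@qpi X Y) (@qpi_linear X Y).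

Fact qrepr_linear X Y : linear (@qrepr X Y).
Proof. by move=> a u v; rewrite /qrepr linearP. Qed.
HB.instance Definition _ X Y :=
  GRing.isLinear.Build k (subquot X Y) V _ (@qrepr X Y) (@qrepr_linear X Y).

Lemma qrepr_in X Y (u : subquot X Y) : qrepr u \in X.
Proof. exact: subvP (diffvSl X Y) _ (subvsP u). Qed.

Lemma qpi_repr X Y (u : subquot X Y) : qpi X Y (qrepr u) = u.
Proof.
by rewrite /qpi /addv_pi1 daddv_pi_id ?capv_diff ?subvsP // /qrepr vsvalK.
Qed.

Lemma repr_qpi X Y v : v \in X -> v - qrepr (qpi X Y v) \in (X :&: Y)%VS.
Proof.
move=> Xv; rewrite memv_cap rpredB ?qrepr_in //=.
have Av : v \in (X + Y)%VS by rewrite (subvP (addvSl _ _)).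
rewrite /qrepr /qpi vsprojK ?memv_pi //.
rewrite -{1}(addv_pi1_pi2 Av) addrC addKr; exact: memv_pi.
Qed.

Lemma qpi_eq0 X Y v : v \in X -> (qpi X Y v == 0) = (v \in Y).
Proof.
move=> Xv; apply/eqP/idP=> [v0|Yv].
  by have := repr_qpi Y Xv; rewrite v0 [qrepr 0]linear0 subr0 memv_cap => /andP[].
have : qrepr (qpi X Y v) \in ((X :\: Y) :&: Y)%VS.
  rewrite memv_cap subvsP /=.
  have := repr_qpi Y Xv; rewrite memv_cap => /andP[_ Yw].
  by rewrite -[qrepr _](subKr v) rpredB.
by rewrite capv_diff memv0 => /eqP r0; rewrite -[LHS]qpi_repr r0 [LHS]linear0.
Qed.

Lemma qpi_eq X Y v w :
  v \in X -> w \in X -> v - w \in Y -> qpi X Y v = qpi X Y w.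
Proof.
move=> Xv Xw Yvw; apply/eqP; rewrite -subr_eq0 -linearB qpi_eq0 //.
by rewrite rpredB.
Qed.

End Subquotient.

(* The opposite algebra R^c, so that right modules are modules over R^c. *)
Section Opposite.
Variables (k : fieldType) (R : falgType k).

HB.instance Definition _ := GRing.Lmodule.on R^c.

Fact conv_scalerAl (a : k) (u v : R^c) : a *: (@GRing.mul R^c u v) = @GRing.mul R^c (a *: u) v.
Proof. exact: (scalerAr a (v : R) (u : R)). Qed.
HB.instance Definition _ :=
  GRing.LSemiModule_isLSemiAlgebra.Build k R^c conv_scalerAl.

Fact conv_scalerAr (a : k) (u v : R^c) : a *: (@GRing.mul R^c u v) = @GRing.mul R^c u (a *: v).
Proof. exact: (scalerAl a (v : R) (u : R)). Qed.
HB.instance Definition _ :=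
  GRing.LSemiAlgebra_isSemiAlgebra.Build k R^c conv_scalerAr.

HB.instance Definition _ := Vector.on R^c.

End Opposite.

(* Finitely generated left modules over a finite-dimensional k-algebra R, that
   is, R-modules which are finite-dimensional over k. *)
Record fmodule (k : fieldType) (R : falgType k) := FModule {
  mod_space :> vectType k;
  act : R -> mod_space -> mod_space;
  act_linl : forall x, linear (act^~ x);
  act_linr : forall a, linear (act a);
  act1 : forall x, act 1 x = x;
  actM : forall a b x, act (a * b) x = act a (act b x) }.

Section Modules.
Variables (k : fieldType) (R : falgType k).
Implicit Types M N P : fmodule R.

Definition is_hom M N (f : M -> N) :=
  linear f /\ forall a x, f (act a x) = act a (f x).

Definition mod_iso M N := exists f : M -> N, is_hom f /\ bijective f.

Definition projective P :=
  forall M N (g : M -> N) (f : P -> N),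
    is_hom g -> (forall y, exists x, g x = y) -> is_hom f ->
  exists h : P -> M, is_hom h /\ forall x, g (h x) = f x.

Record submodule M := Submodule {
  sub_space :> {vspace M};
  sub_stable : forall a x, x \in sub_space -> act a x \in sub_space }.

Fact sub0_stable M a x : x \in (0%VS : {vspace M}) -> act a x \in (0%VS : {vspace M}).
Proof.
rewrite !memv0 => /eqP->; apply/eqP.
by have := act_linr a (-1) (0 : M) 0; rewrite scaler0 addr0 scaleN1r addNr.
Qed.
Definition sub0 M : submodule M := Submodule (@sub0_stable M).

Fact subT_stable M a x : x \in (fullv : {vspace M}) -> act a x \in (fullv : {vspace M}).
Proof. by rewrite !memvf. Qed.
Definition subT M : submodule M := Submodule (@subT_stable M).

Section SubquotientModule.
Variables (M : fmodule R) (X Y : submodule M).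

Let B := subquot X Y.
Definition sq_act (a : R) (u : B) : B := qpi X Y (act a (qrepr u)).

Lemma actB a (x y : M) : act a (x - y) = act a x - act a y.
Proof. by rewrite addrC -scaleN1r act_linr scaleN1r addrC. Qed.

Fact sq_act_linl (u : B) : linear (sq_act^~ u).
Proof. by move=> a b c; rewrite /sq_act act_linl linearP. Qed.
Fact sq_act_linr a : linear (sq_act a).
Proof. by move=> c u v; rewrite /sq_act linearP act_linr linearP. Qed.
Fact sq_act1 u : sq_act 1 u = u.
Proof. by rewrite /sq_act act1 qpi_repr. Qed.
Lemma sq_act_qpi a x : x \in sub_space X -> sq_act a (qpi X Y x) = qpi X Y (act a x).
Proof.
move=> Xx; apply: qpi_eq; try by apply: sub_stable; rewrite ?qrepr_in.
rewrite -actB; apply: sub_stable; rewrite -rpredN opprB.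
by have := repr_qpi Y Xx; rewrite memv_cap => /andP[].
Qed.
Fact sq_actM a b u : sq_act (a * b) u = sq_act a (sq_act b u).
Proof.
by rewrite {3}/sq_act sq_act_qpi /sq_act ?actM //; apply/sub_stable/qrepr_in.
Qed.

Definition subquot_mod : fmodule R :=
  FModule sq_act_linl sq_act_linr sq_act1 sq_actM.

End SubquotientModule.

Definition sub_mod M (X : submodule M) := subquot_mod X (sub0 M).
Definition quot_mod M (U : submodule M) := subquot_mod (subT M) U.

Definition maximal_sub M (N : submodule M) :=
  (sub_space N != fullv) /\
  forall U : submodule M, (N <= U)%VS ->
    sub_space U = sub_space N \/ sub_space U = fullv.

Definition rad_space M : {vspace M} :=
  xget fullv [set U : {vspace M} | forall x,
    x \in U <-> forall N : submodule M, maximal_sub N -> x \in sub_space N].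

Lemma rad_spaceP M x :
  x \in rad_space M <-> forall N : submodule M, maximal_sub N -> x \in sub_space N.
Proof.
apply: (xgetPex fullv (P := fun U : {vspace M} => forall x, x \in U <->
  forall N : submodule M, maximal_sub N -> x \in sub_space N)).
apply: vspace_of_predP => [N _|a u v Pu Pv N maxN]; first exact: mem0v.
by rewrite rpredD ?rpredZ ?Pu ?Pv.
Qed.

Fact rad_stable M a x : x \in rad_space M -> act a x \in rad_space M.
Proof.
by move=> /rad_spaceP rx; apply/rad_spaceP => N maxN; apply/sub_stable/rx.
Qed.
Definition rad M : submodule M := Submodule (@rad_stable M).

(* M has a chain of submodules 0 = F 0 <= F 1 <= ... <= F n = M, with
   n = size Cs, whose i-th factor F i.+1 / F i belongs to the i-th class of
   modules in Cs. *)
Definition has_filtration M (Cs : seq (fmodule R -> Prop)) :=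
  exists F : nat -> submodule M,
    [/\ sub_space (F 0%N) = 0%VS,
        sub_space (F (size Cs)) = fullv &
        forall i, (i < size Cs)%N ->
          (F i <= F i.+1)%VS /\
          nth (fun _ => False) Cs i (subquot_mod (F i.+1) (F i))].

Definition filtered (C : fmodule R -> Prop) M :=
  exists n, has_filtration M (nseq n C).

Fact regular_linl (x : R) : linear ( *%R^~ x).
Proof. by move=> a u v; rewrite mulrDl scalerAl. Qed.
Fact regular_linr (x : R) : linear ( *%R x).
Proof. by move=> a u v; rewrite mulrDr scalerAr. Qed.
Definition regular_mod : fmodule R :=
  @FModule k R R *%R regular_linl regular_linr (@mul1r R)
           (fun a b c => esym (mulrA a b c)).

End Modules.

Section Idempotents.
Variables (k : fieldType) (A : falgType k) (L : finType) (e : L -> A).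

Definition idempotent_elt (x : A) := x * x = x.

Definition primitive (x : A) :=
  [/\ idempotent_elt x, x != 0 &
      forall f g : A, idempotent_elt f -> idempotent_elt g ->
        f * g = 0 -> g * f = 0 -> x = f + g -> f = 0 \/ g = 0].

Record complete_primitive_orthogonal : Prop := {
  cpo_primitive : forall i, primitive (e i);
  cpo_orthogonal : forall i j, i != j -> e i * e j = 0;
  cpo_complete : \sum_i e i = 1 }.

Fact proj_stable i (a x : regular_mod A) :
  x \in (fullv * <[e i]>)%VS -> act a x \in (fullv * <[e i]>)%VS.
Proof.
by move=> Px; rewrite (subvP (prodvSl _ (subvf (fullv * fullv)))) // -prodvA memv_mul ?memvf.
Qed.
Definition proj_sub i : submodule (regular_mod A) := Submodule (@proj_stable i).

Definition Pmod i : fmodule A := sub_mod (proj_sub i).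

Definition Smod i : fmodule A := quot_mod (rad (Pmod i)).

(* A is basic when the indecomposable projectives A e_i of a complete set of
   primitive orthogonal idempotents are pairwise non-isomorphic. *)
Definition basic := forall i j, i != j -> ~ mod_iso (Pmod i) (Pmod j).

Definition comp_series (M : fmodule A) (s : seq L) :=
  has_filtration M [seq (fun N : fmodule A => mod_iso N (Smod i)) | i <- s].

(* U is the least submodule of P_i such that P_i / U has property C, that is,
   P_i / U is the largest quotient of P_i with property C. *)
Definition largest_quotient (C : fmodule A -> Prop) i (U : submodule (Pmod i)) :=
  C (quot_mod U) /\
  forall U' : submodule (Pmod i), C (quot_mod U') -> (U <= U')%VS.

Section Stratification.
Variable le : rel L.

Definition std_cond i (M : fmodule A) :=
  exists2 s, comp_series M s & all (fun j => le j i) s.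

Definition prop_std_cond i (M : fmodule A) :=
  exists2 s, comp_series M s &
    count_mem i s = 1%N /\ all (fun j => (j == i) || (le j i && (j != i))) s.

Definition is_standard (N : fmodule A) :=
  exists i, exists2 U : submodule (Pmod i),
    largest_quotient (std_cond i) U & mod_iso N (quot_mod U).

Definition is_proper_standard (N : fmodule A) :=
  exists i, exists2 U : submodule (Pmod i),
    largest_quotient (prop_std_cond i) U & mod_iso N (quot_mod U).

Definition standardly_stratified := filtered is_standard (regular_mod A).

Definition properly_stratified :=
  filtered is_standard (regular_mod A) /\
  filtered is_proper_standard (regular_mod A).

End Stratification.
End Idempotents.

Definition linear_order (L : Type) (le : rel L) :=
  [/\ reflexive le, antisymmetric le, transitive le & total le].

Record lincat (k : fieldType) := LinCat {
  ob : Type;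
  hom : ob -> ob -> lmodType k;
  idm : forall x, hom x x;
  comp : forall x y z, hom y z -> hom x y -> hom x z;
  comp_linl : forall x y z (f : hom x y), linear (fun g : hom y z => comp g f);
  comp_linr : forall x y z (g : hom y z), linear (fun f : hom x y => comp g f);
  comp_idl : forall x y (f : hom x y), comp (idm y) f = f;
  comp_idr : forall x y (f : hom x y), comp f (idm x) = f;
  comp_assoc : forall x y z t (h : hom z t) (g : hom y z) (f : hom x y),
    comp (comp h g) f = comp h (comp g f) }.

Definition cat_iso (k : fieldType) (C D : lincat k) :=
  exists (F : ob C -> ob D)
         (G : forall x y, {linear hom x y -> hom (F x) (F y)}),
    [/\ bijective F,
        forall x y, bijective (G x y),
        forall x, G x x (idm x) = idm (F x) &
        forall x y z (g : hom y z) (f : hom x y),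
          G x z (comp g f) = comp (G y z g) (G x y f)].

Definition directed (k : fieldType) (C : lincat k) :=
  exists le : rel (ob C),
    [/\ reflexive le, antisymmetric le, transitive le &
        forall x y, (exists f : hom (l := C) x y, f != 0) -> le x y].

(* The category associated with an algebra B and a family e of idempotents:
   its objects are the indices of e, its morphism spaces from i to j are the
   subspaces e_j B e_i of B. *)
Section AssociatedCategory.
Variables (k : fieldType) (B : algType k) (L : Type) (e : L -> B).
Hypothesis e_idem : forall i, e i * e i = e i.

Definition corner_pred (i j : L) := [pred x : B | e j * x * e i == x].
Fact corner_closed i j : submod_closed (corner_pred i j).
Proof.
split=> [|a x y]; rewrite !inE ?mulr0 ?mul0r //.
move=> /eqP ex /eqP ey.
by rewrite mulrDr mulrDl -scalerAr -scalerAl ex ey.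
Qed.
HB.instance Definition _ i j :=
  GRing.isSubmodClosed.Build k B (corner_pred i j) (corner_closed i j).

Record corner (i j : L) := Corner { cval :> B; _ : cval \in corner_pred i j }.
HB.instance Definition _ i j := [isSub for @cval i j].
HB.instance Definition _ i j := [Choice of corner i j by <:].
HB.instance Definition _ i j := [SubChoice_isSubLmodule of corner i j by <:].

Lemma cornerE i j (x : corner i j) : e j * cval x * e i = cval x.
Proof. by case: x => x /= /eqP. Qed.
Lemma corner_mul1 i j (x : corner i j) : cval x * e i = cval x.
Proof. by rewrite -(cornerE x) -mulrA e_idem. Qed.
Lemma corner_1mul i j (x : corner i j) : e j * cval x = cval x.
Proof. by rewrite -(cornerE x) !mulrA e_idem. Qed.

Fact corner_id_in i : e i \in corner_pred i i.
Proof. by rewrite inE !e_idem. Qed.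
Fact corner_comp_in i j l (y : corner j l) (x : corner i j) :
  cval y * cval x \in corner_pred i l.
Proof. by rewrite inE mulrA corner_1mul -mulrA corner_mul1. Qed.

Definition assoc_cat : lincat k.
Proof.
refine (@LinCat k L (fun i j => corner i j) (fun i => Corner (corner_id_in i))
  (fun i j l y x => Corner (corner_comp_in y x)) _ _ _ _ _) => /=.
- by move=> i j l f a x y; apply: val_inj; rewrite /= mulrDl -scalerAl.
- by move=> i j l f a x y; apply: val_inj; rewrite /= mulrDr -scalerAr.
- by move=> i j f; apply: val_inj; rewrite /= corner_1mul.
- by move=> i j f; apply: val_inj; rewrite /= corner_mul1.
- by move=> i j l m h g f; apply: val_inj; rewrite /= mulrA.
Defined.

End AssociatedCategory.

(* The direct sum of a family of vector spaces indexed by I: the dependent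
   functions with finite support. *)
Section DirectSum.
Variables (k : fieldType) (I : choiceType) (V : I -> lmodType k).

Record dsum := DSum {
  dsum_fun :> forall i, V i;
  dsum_finite : finite_set [set i | dsum_fun i != 0] }.

Lemma dsumP (x y : dsum) : (forall i, x i = y i) -> x = y.
Proof.
case: x y => [x fx] [y fy] /= xyE.
have exy : x = y by apply: functional_extensionality_dep.
by case: y / exy fy {xyE} => fy; congr DSum; apply: Prop_irrelevance.
Qed.

HB.instance Definition _ := gen_eqMixin dsum.
HB.instance Definition _ := gen_choiceMixin dsum.

Fact dsum0_finite : finite_set [set i : I | (0 : V i) != 0].
Proof. by apply: (@sub_finite_set _ _ set0) => // i /=; rewrite eqxx. Qed.
Definition dsum0 := DSum dsum0_finite.

Fact dsum_add_finite (x y : dsum) : finite_set [set i | x i + y i != 0].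
Proof.
apply: (@sub_finite_set _ _ ([set i | x i != 0] `|` [set i | y i != 0])%classic).
  move=> i /=; case: (eqVneq (x i) 0) => [->|]; last by left.
  by rewrite add0r; right.
by rewrite finite_setU; split; apply: dsum_finite.
Qed.
Definition dsum_add x y := DSum (dsum_add_finite x y).

Fact dsum_opp_finite (x : dsum) : finite_set [set i | - x i != 0].
Proof.
by apply: sub_finite_set (dsum_finite x) => i /=; rewrite oppr_eq0.
Qed.
Definition dsum_opp x := DSum (dsum_opp_finite x).

Fact dsum_scale_finite a (x : dsum) : finite_set [set i | a *: x i != 0].
Proof.
by apply: sub_finite_set (dsum_finite x) => i /=; rewrite scaler_eq0 negb_or => /andP[].
Qed.
Definition dsum_scale a x := DSum (dsum_scale_finite a x).

Fact dsum_addA : associative dsum_add.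
Proof. by move=> x y z; apply: dsumP => i /=; rewrite addrA. Qed.
Fact dsum_addC : commutative dsum_add.
Proof. by move=> x y; apply: dsumP => i /=; rewrite addrC. Qed.
Fact dsum_add0 : left_id dsum0 dsum_add.
Proof. by move=> x; apply: dsumP => i /=; rewrite add0r. Qed.
Fact dsum_addN : left_inverse dsum0 dsum_opp dsum_add.
Proof. by move=> x; apply: dsumP => i /=; rewrite addNr. Qed.
HB.instance Definition _ :=
  GRing.isZmodule.Build dsum dsum_addA dsum_addC dsum_add0 dsum_addN.

Fact dsum_scaleA a b x : dsum_scale a (dsum_scale b x) = dsum_scale (a * b) x.
Proof. by apply: dsumP => i /=; rewrite scalerA. Qed.
Fact dsum_scale1 : left_id 1 dsum_scale.
Proof. by move=> x; apply: dsumP => i /=; rewrite scale1r. Qed.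
Fact dsum_scaleDr : right_distributive dsum_scale +%R.
Proof. by move=> a x y; apply: dsumP => i /=; rewrite scalerDr. Qed.
Fact dsum_scaleDl x : {morph dsum_scale^~ x : a b / a + b}.
Proof. by move=> a b; apply: dsumP => i /=; rewrite scalerDl. Qed.
HB.instance Definition _ :=
  GRing.Zmodule_isLmodule.Build k dsum
    dsum_scaleA dsum_scale1 dsum_scaleDr dsum_scaleDl.

Lemma dsum0E i : (0 : dsum) i = 0. Proof. by []. Qed.
Lemma dsumDE (x y : dsum) i : (x + y) i = x i + y i. Proof. by []. Qed.
Lemma dsumZE a (x : dsum) i : (a *: x) i = a *: x i. Proof. by []. Qed.
Lemma dsum_sumE (J : Type) (r : seq J) (F : J -> dsum) i :
  (\sum_(j <- r) F j) i = \sum_(j <- r) F j i.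
Proof. by elim/big_rec2: _ => [|j u v _ <-]; rewrite ?dsum0E ?dsumDE. Qed.

Definition dinj_fun i (v : V i) j : V j :=
  if @eqP I i j is ReflectT ij then ecast j (V j) ij v else 0.

Fact dinj_finite i v : finite_set [set j | @dinj_fun i v j != 0].
Proof.
apply: (@sub_finite_set _ _ [set i]%classic) => // j /=; rewrite /dinj_fun.
by case: eqP => [/esym //|_]; rewrite eqxx.
Qed.
Definition dinj i (v : V i) : dsum := DSum (dinj_finite v).

Lemma dinj_id i (v : V i) : dinj v i = v.
Proof.
by rewrite /= /dinj_fun; case: eqP => // ii; rewrite (eq_axiomK ii).
Qed.
Lemma dinj_ne i j (v : V i) : i != j -> dinj v j = 0.
Proof. by rewrite /= /dinj_fun; case: eqP. Qed.

Fact dinj_linear i : linear (@dinj i).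
Proof.
move=> a u v; apply: dsumP => j; rewrite dsumDE dsumZE.
have [<-|ij] := eqVneq i j; first by rewrite !dinj_id.
by rewrite !dinj_ne // scaler0 addr0.
Qed.
HB.instance Definition _ i :=
  GRing.isLinear.Build k (V i) dsum _ (@dinj i) (@dinj_linear i).

(* the map induced on the direct sum by maps (linear in all uses) defined on
   the summands *)
Definition dlift (W : lmodType k) (h : forall i, V i -> W) (x : dsum) : W :=
  \sum_(i \in [set: I]) h i (x i).

Section Lift.
Variables (W : lmodType k) (h : forall i, V i -> W).
Hypothesis h0 : forall i, h (0 : V i) = 0.

Lemma dliftE (r : seq I) (x : dsum) : uniq r ->
  (forall i, x i != 0 -> i \in r) -> dlift h x = \sum_(i <- r) h (x i).
Proof.
move=> ur xr; rewrite /dlift (fsbigE r) //; first by apply: eq_bigl => i; rewrite in_setT.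
by move=> i _ ir; have [->//|/xr] := eqVneq (x i) 0; rewrite (negPf ir).
Qed.

Lemma dsum_support (x : dsum) : exists s : seq I, forall i, x i != 0 -> i \in s.
Proof.
have /finite_seqP[s sE] := dsum_finite x; exists s => i xi.
by have : [set j | x j != 0]%classic i by []; rewrite sE.
Qed.

Lemma dlift_inj i (v : V i) : dlift h (dinj v) = h v.
Proof.
rewrite (@dliftE [:: i]) ?big_seq1 ?dinj_id // => j.
by rewrite inE; apply: contraNT => ji; rewrite dinj_ne // eq_sym.
Qed.
End Lift.

Lemma dlift_linear (W : lmodType k) (h : forall i, V i -> W) :
  (forall i, linear (@h i)) -> linear (dlift h).
Proof.
move=> hl a x y.
have h0 i : h i 0 = 0.
  by have := hl i (-1) 0 0; rewrite scaler0 addr0 scaleN1r addNr.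
have [s1 xs] := dsum_support x; have [s2 ys] := dsum_support y.
pose s := undup (s1 ++ s2).
have us : uniq s by apply: undup_uniq.
have sx i : x i != 0 -> i \in s by move=> /xs; rewrite mem_undup mem_cat => ->.
have sy i : y i != 0 -> i \in s.
  by move=> /ys; rewrite mem_undup mem_cat orbC => ->.
rewrite !(dliftE h0 us) // ?scaler_sumr -?big_split /=; last first.
  move=> i; apply: contraNT => ns /=.
  rewrite (contraNeq (@sx i) ns) (contraNeq (@sy i) ns).
  by rewrite scaler0 addr0.
by apply: eq_bigr => i _; rewrite hl.
Qed.

Lemma dsum_decomp (x : dsum) : x = dlift dinj x.
Proof.
have [s1 xs1] := dsum_support x; pose s := undup s1.
have us : uniq s by apply: undup_uniq.
have xs i : x i != 0 -> i \in s by move=> /xs1; rewrite mem_undup.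
rewrite (dliftE (fun i => linear0 (@dinj i)) us xs).
apply: dsumP => i; rewrite dsum_sumE.
have [si|nsi] := boolP (i \in s).
  rewrite (bigD1_seq i si us) dinj_id big1 ?Monoid.mulm1 // => j ji.
  exact: dinj_ne.
rewrite big_seq big1 => [|j js]; first exact: (contraNeq (@xs i) nsi).
by apply: dinj_ne; apply: contraNneq nsi => <-.
Qed.

Lemma dsum_ind (P : dsum -> Prop) :
  P 0 -> (forall x y, P x -> P y -> P (x + y)) ->
  (forall i (v : V i), P (dinj v)) -> forall x, P x.
Proof.
move=> P0 PD Pi x; rewrite (dsum_decomp x) /dlift.
by elim/big_ind: _.
Qed.

End DirectSum.

(* The associated graded algebra of A along a proper two-sided ideal J, with
   summands J^i / J^(i+1) and J^0 = A. *)
Section GradedAlgebra.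
Variables (k : fieldType) (A : falgType k) (J : {vspace A}).

Record proper_ideal : Prop := ProperIdeal {
  ideal_mull : (fullv * J <= J)%VS;
  ideal_mulr : (J * fullv <= J)%VS;
  ideal_proper : 1 \notin J }.

(* (J ^+ 0)%VS is the line 1%VS, hence the case distinction *)
Definition ideal_pow (i : nat) : {vspace A} :=
  if i is 0%N then fullv else (J ^+ i)%VS.

Definition gr_part (i : nat) : lmodType k :=
  subquot (ideal_pow i) (ideal_pow i.+1).

Definition gr (_ : proper_ideal) := dsum gr_part.

Variable HJ : proper_ideal.
Local Notation grJ := (gr HJ).

HB.instance Definition _ := GRing.Lmodule.on grJ.

(* the class of a in the summand J^i / J^(i+1), meaningful for a in J^i *)
Definition homog (i : nat) (a : A) : grJ :=
  @dinj k nat gr_part i (qpi (ideal_pow i) (ideal_pow i.+1) a).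

Fact homog_linear i : linear (homog i).
Proof.
move=> a u v; rewrite /homog linearP.
exact: (linearP (@dinj k nat gr_part i)).
Qed.
HB.instance Definition _ i :=
  GRing.isLinear.Build k A grJ _ (homog i) (homog_linear i).

Definition part_repr i (u : gr_part i) : A := qrepr u.

Fact part_repr_linear i : linear (@part_repr i).
Proof. by move=> a u v; rewrite /part_repr -linearP. Qed.
HB.instance Definition _ i :=
  GRing.isLinear.Build k (gr_part i) A _ (@part_repr i) (@part_repr_linear i).

(* (a mod J^(i+1)) (b mod J^(j+1)) = ab mod J^(i+j+1), extended bilinearly *)
Definition gr_mul (x y : grJ) : grJ :=
  @dlift k nat gr_part grJ (fun i u =>
    @dlift k nat gr_part grJ (fun j v =>
      homog (i + j) (part_repr u * part_repr v)) y) x.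

Lemma ideal_powS i : (ideal_pow i.+1 <= ideal_pow i)%VS.
Proof.
case: i => [|i]; first exact: subvf.
rewrite /ideal_pow [X in (X <= _)%VS]expvSl expvSl prodvA.
apply: prodvSl; apply: subv_trans (ideal_mulr HJ).
by apply: prodvSr; apply: subvf.
Qed.

Lemma ideal_pow_mul i j a b :
  a \in ideal_pow i -> b \in ideal_pow j -> a * b \in ideal_pow (i + j).
Proof.
move=> Ja Jb; have := memv_mul Ja Jb; apply: subvP.
case: i j {Ja Jb} => [|i] [|j]; rewrite ?addn0 ?add0n ?subvf //=.
- rewrite expvSl prodvA; exact/prodvSl/(ideal_mull HJ).
- rewrite expvSr -prodvA; exact/prodvSr/(ideal_mulr HJ).
by rewrite -expvD.
Qed.

Lemma homog_eq i a b : a \in ideal_pow i -> b \in ideal_pow i ->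
  a - b \in ideal_pow i.+1 -> homog i a = homog i b.
Proof. by move=> *; rewrite /homog (@qpi_eq _ _ _ _ a b). Qed.

Lemma part_repr_in i (u : gr_part i) : part_repr u \in ideal_pow i.
Proof. exact: qrepr_in. Qed.

Lemma part_reprP i a (u v : gr_part i) :
  part_repr (a *: u + v) = a *: part_repr u + part_repr v.
Proof. exact: part_repr_linear. Qed.

Fact gr_mul_linl y : linear (gr_mul^~ y).
Proof.
apply: dlift_linear => i a u v.
have [s0 ys0] := dsum_support y; pose s := undup s0.
have us : uniq s by apply: undup_uniq.
have ys j : y j != 0 -> j \in s by move=> /ys0; rewrite mem_undup.
rewrite !(dliftE _ us ys); try by move=> j; rewrite linear0 mulr0 linear0.
rewrite scaler_sumr -big_split; apply: eq_bigr => j _.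
rewrite part_reprP mulrDl -scalerAl.
exact: homog_linear.
Qed.

Fact gr_mul_linr x : linear (gr_mul x).
Proof.
move=> a y z; rewrite /gr_mul.
have [s0 xs0] := dsum_support x; pose s := undup s0.
have us : uniq s by apply: undup_uniq.
have xs j : x j != 0 -> j \in s by move=> /xs0; rewrite mem_undup.
have hl (i : nat) (u : gr_part i) :
    linear (@dlift k nat gr_part grJ
      (fun j v => homog (i + j) (part_repr u * part_repr v))).
  apply: dlift_linear => j b v w.
  rewrite part_reprP mulrDr -scalerAr.
  exact: homog_linear.
have h0 (t : grJ) (i : nat) : @dlift k nat gr_part grJ
    (fun j v => homog (i + j) (part_repr (0 : gr_part i) * part_repr v)) t = 0.
  by rewrite /dlift fsbig1 // => j _; rewrite linear0 mul0r linear0.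
rewrite !(dliftE _ us xs) //.
rewrite scaler_sumr -big_split /=; apply: eq_bigr => j _.
exact: hl.
Qed.

Lemma gr_mul_homog i j a b : a \in ideal_pow i -> b \in ideal_pow j ->
  gr_mul (homog i a) (homog j b) = homog (i + j) (a * b).
Proof.
move=> Ja Jb; rewrite /gr_mul dlift_inj; last first.
  by move=> l; rewrite /dlift fsbig1 // => m _; rewrite linear0 mul0r linear0.
rewrite dlift_inj; last by move=> l; rewrite linear0 mulr0 linear0.
set a' := part_repr _; set b' := part_repr _.
have Ja' : a' \in ideal_pow i by apply: part_repr_in.
have Jb' : b' \in ideal_pow j by apply: part_repr_in.
have := repr_qpi (ideal_pow i.+1) Ja; rewrite memv_cap => /andP[_ aa'].
have := repr_qpi (ideal_pow j.+1) Jb; rewrite memv_cap => /andP[_ bb'].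
apply/esym/homog_eq; try by apply: ideal_pow_mul.
rewrite -[a * b](subrK (a' * b)) -mulrBl -addrA -mulrBr rpredD //.
  by rewrite -addSn; apply: ideal_pow_mul.
by rewrite -addnS; apply: ideal_pow_mul.
Qed.

Lemma gr_ind (P : grJ -> Prop) :
  P 0 -> (forall x y, P x -> P y -> P (x + y)) ->
  (forall i a, a \in ideal_pow i -> P (homog i a)) -> forall x, P x.
Proof.
move=> P0 PD Ph; apply: dsum_ind => // i v.
have -> : dinj v = homog i (part_repr v) by rewrite /homog qpi_repr.
exact/Ph/part_repr_in.
Qed.

Fact gr_mulDl : left_distributive gr_mul +%R.
Proof. by move=> x y z; have := gr_mul_linl z 1 x y; rewrite !scale1r. Qed.
Fact gr_mulDr : right_distributive gr_mul +%R.
Proof. by move=> z x y; have := gr_mul_linr z 1 x y; rewrite !scale1r. Qed.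
Fact gr_mul0l x : gr_mul 0 x = 0.
Proof. by have := gr_mul_linl x (-1) 0 0; rewrite scaler0 addr0 scaleN1r addNr. Qed.
Fact gr_mul0r x : gr_mul x 0 = 0.
Proof. by have := gr_mul_linr x (-1) 0 0; rewrite scaler0 addr0 scaleN1r addNr. Qed.

Fact gr_mulA : associative gr_mul.
Proof.
move=> x y z; elim/gr_ind: x => [|x x' IH IH'|i a Ja].
- by rewrite !gr_mul0l.
- by rewrite !gr_mulDl IH IH'.
elim/gr_ind: y => [|y y' IH IH'|j b Jb].
- by rewrite !(gr_mul0l, gr_mul0r).
- by rewrite gr_mulDl !gr_mulDr gr_mulDl IH IH'.
elim/gr_ind: z => [|z z' IH IH'|l c Jc].
- by rewrite !gr_mul0r.
- by rewrite !gr_mulDr IH IH'.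
have Jab := ideal_pow_mul Ja Jb; have Jbc := ideal_pow_mul Jb Jc.
by rewrite !gr_mul_homog // addnA mulrA.
Qed.

Fact gr_mul1l : left_id (homog 0 1) gr_mul.
Proof.
move=> x; elim/gr_ind: x => [|x x' IH IH'|i a Ja].
- by rewrite gr_mul0r.
- by rewrite gr_mulDr IH IH'.
by rewrite gr_mul_homog ?memvf // mul1r.
Qed.

Fact gr_mul1r : right_id (homog 0 1) gr_mul.
Proof.
move=> x; elim/gr_ind: x => [|x x' IH IH'|i a Ja].
- by rewrite gr_mul0l.
- by rewrite gr_mulDl IH IH'.
by rewrite gr_mul_homog ?memvf // mulr1 addn0.
Qed.

Fact gr_1neq0 : homog 0 1 != 0.
Proof.
apply/eqP => /(congr1 (fun x : grJ => dsum_fun x 0%N)).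
rewrite /homog dinj_id => /eqP; rewrite (qpi_eq0 _ (memvf 1)) /=.
by rewrite expv1 (negPf (ideal_proper HJ)).
Qed.

HB.instance Definition _ := GRing.Zmodule_isNzRing.Build grJ
  gr_mulA gr_mul1l gr_mul1r gr_mulDl gr_mulDr gr_1neq0.

Fact gr_scalerAl (a : k) (x y : grJ) : a *: (x * y) = (a *: x) * y.
Proof. by have := gr_mul_linl y a x 0; rewrite /= gr_mul0l !addr0 => <-. Qed.
HB.instance Definition _ :=
  GRing.LSemiModule_isLSemiAlgebra.Build k grJ gr_scalerAl.

Fact gr_scalerAr (a : k) (x y : grJ) : a *: (x * y) = x * (a *: y).
Proof. by have := gr_mul_linr x a y 0; rewrite /= gr_mul0r !addr0 => <-. Qed.
HB.instance Definition _ :=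
  GRing.LSemiAlgebra_isSemiAlgebra.Build k grJ gr_scalerAr.

End GradedAlgebra.

Section GradedCategory.
Variables (k : fieldType) (A : falgType k) (L : finType) (e : L -> A).
Hypothesis He : complete_primitive_orthogonal e.

Lemma cpo_idem i : e i * e i = e i.
Proof. by have [] := cpo_primitive He i. Qed.

Definition alg_cat : lincat k := assoc_cat cpo_idem.

Definition off_diag : {vspace A} :=
  (\sum_i \sum_(j | j != i) <[e j]> * fullv * <[e i]>)%VS.

Lemma mem_off_diag i j x : j != i -> e j * x * e i \in off_diag.
Proof.
move=> ji; rewrite /off_diag.
apply: (subvP (sumv_sup i _ (sumv_sup j ji (subvv _)))) => //.
by rewrite !memv_mul ?memv_line ?memvf.
Qed.

Lemma corner_decomp x : x = \sum_i \sum_j e j * x * e i.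
Proof.
under eq_bigr do rewrite -mulr_suml -mulr_suml (cpo_complete He) mul1r.
by rewrite -mulr_sumr (cpo_complete He) mulr1.
Qed.

Lemma mem_corner i j x :
  x \in (<[e j]> * fullv * <[e i]>)%VS -> e j * x * e i = x.
Proof.
move=> ex; pose fl := (amull (e j) - \1)%VF; pose fr := (amulr (e i) - \1)%VF.
have flE y : (y \in lker fl) = (e j * y == y).
  by rewrite memv_ker add_lfunE opp_lfunE id_lfunE lfunE /= subr_eq0.
have frE y : (y \in lker fr) = (y * e i == y).
  by rewrite memv_ker add_lfunE opp_lfunE id_lfunE lfunE /= subr_eq0.
have /eqP-> : e j * x == x.
  rewrite -flE; apply: (subvP _ x ex); rewrite -prodvA.
  apply/prodvP => _ y /vlineP[a ->] _.
  by rewrite flE -!scalerAl -scalerAr mulrA cpo_idem.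
apply/eqP; rewrite -frE; apply: (subvP _ x ex).
apply/prodvP => y _ _ /vlineP[a ->].
by rewrite frE -!scalerAr -scalerAl -mulrA cpo_idem.
Qed.

Lemma off_diagP x : x \in off_diag <-> forall i, e i * x * e i = 0.
Proof.
split=> [Jx l|xii]; last first.
  rewrite (corner_decomp x); apply: rpred_sum => i _; apply: rpred_sum => j _.
  by have [->|ji] := eqVneq j i; [rewrite xii mem0v | apply: mem_off_diag].
move: Jx => /memv_sumP[v vP ->]; rewrite mulr_sumr mulr_suml big1 // => i _.
have /memv_sumP[w wP ->] := vP i isT.
rewrite mulr_sumr mulr_suml big1 // => j ji.
rewrite -(mem_corner (wP j ji)).
have [<-|il] := eqVneq i l.
  have ij : i != j by rewrite eq_sym.
  by rewrite !mulrA (cpo_orthogonal He ij) !mul0r.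
by rewrite -!mulrA (cpo_orthogonal He il) !mulr0.
Qed.

Hypothesis Hd : directed alg_cat.

Lemma directed_off_diag : proper_ideal off_diag.
Proof.
have [le [_ le_anti _ leP]] := Hd.
have le_hom i j x : e j * x * e i != 0 -> le i j.
  move=> x0; apply: leP.
  have cx : e j * x * e i \in corner_pred e i j.
    by rewrite inE !mulrA cpo_idem -!mulrA cpo_idem.
  exists (Corner cx); apply: contraNneq x0 => f0; apply/eqP.
  exact: (congr1 (@cval _ _ _ _ _ _) f0).
have mix l a b : a \in off_diag \/ b \in off_diag -> e l * (a * b) * e l = 0.
  move=> Jab; rewrite -[a](mulr1) -(cpo_complete He) mulr_sumr mulr_suml.
  rewrite mulr_sumr mulr_suml big1 // => j _.
  have -> : e l * (a * e j * b) * e l = (e l * a * e j) * (e j * b * e l).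
    by rewrite -{1}(cpo_idem j) !mulrA.
  have [->|jl] := eqVneq j l.
    by case: Jab => /off_diagP->; rewrite ?mul0r ?mulr0.
  have [->|/le_hom lejl] := eqVneq (e l * a * e j) 0; first by rewrite mul0r.
  have [->|/le_hom lelj] := eqVneq (e j * b * e l) 0; first by rewrite mulr0.
  by case/eqP: jl; apply: le_anti; rewrite lejl lelj.
split.
- apply/prodvP => a x _ Jx; apply/off_diagP => l.
  by apply: mix; right.
- apply/prodvP => x a Jx _; apply/off_diagP => l.
  by apply: mix; left.
apply/negP => /off_diagP J1; case/eqP: (oner_neq0 A).
rewrite -(cpo_complete He) big1 // => i _.
by have := J1 i; rewrite mulr1 cpo_idem.
Qed.

Definition gr_idem (i : L) : gr directed_off_diag :=
  homog directed_off_diag 0 (e i).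

Fact gr_idemP i : gr_idem i * gr_idem i = gr_idem i.
Proof.
have e0 : e i \in ideal_pow off_diag 0 by apply: memvf.
by have := gr_mul_homog directed_off_diag e0 e0; rewrite cpo_idem.
Qed.

Definition graded_cat : lincat k := assoc_cat gr_idemP.

End GradedCategory.

(* Finite-dimensional (R, S)-bimodules, with k acting centrally. *)
Record bimod (k : fieldType) (R S : falgType k) := Bimod {
  bim_space :> vectType k;
  lact : R -> bim_space -> bim_space;
  ract : bim_space -> S -> bim_space;
  lact_linl : forall x, linear (lact^~ x);
  lact_linr : forall r, linear (lact r);
  ract_linl : forall s, linear (ract^~ s);
  ract_linr : forall x, linear (ract x);
  lact1 : forall x, lact 1 x = x;
  ract1 : forall x, ract x 1 = x;
  lactM : forall r r' x, lact (r * r') x = lact r (lact r' x);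
  ractM : forall s s' x, ract x (s * s') = ract (ract x s) s';
  lractA : forall r x s, ract (lact r x) s = lact r (ract x s) }.

Section BimoduleSides.
Variables (k : fieldType) (R S : falgType k) (M : bimod R S).

Definition left_mod : fmodule R :=
  FModule (@lact_linl _ _ _ M) (@lact_linr _ _ _ M) (@lact1 _ _ _ M)
          (@lactM _ _ _ M).

Fact ractM_op (s s' : S^c) (x : M) : ract x (s * s') = ract (ract x s') s.
Proof. exact: (ractM (s' : S) (s : S) x). Qed.

Definition right_mod : fmodule S^c :=
  @FModule k S^c M (fun (s : S^c) x => ract x (s : S))
    (@ract_linr _ _ _ M) (@ract_linl _ _ _ M) (@ract1 _ _ _ M) ractM_op.

End BimoduleSides.

Definition regular_bimod (k : fieldType) (R : falgType k) : bimod R R :=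
  @Bimod k R R R *%R *%R
    (@regular_linl k R) (@regular_linr k R)
    (@regular_linl k R) (@regular_linr k R)
    (@mul1r R) (@mulr1 R)
    (fun a b x => esym (mulrA a b x)) (fun a b x => mulrA x a b)
    (fun a x b => esym (mulrA a x b)).

(* The tensor product of M and N over S.  The tensor product over k is realised
   as matrices, with respect to the bases vbasis of M and N; it is then divided
   by the span of the (m s) (x) n - m (x) (s n), where it suffices to let m, s, n
   run through bases (see [relator_in]). *)
Section TensorProduct.
Variables (k : fieldType) (R S T : falgType k).
Variables (M : bimod R S) (N : bimod S T).

Local Notation bM := (vbasis {: M}).
Local Notation bN := (vbasis {: N}).
Local Notation bS := (vbasis {: S}).

Definition ktens : vectType k := 'M[k]_(\dim {: M}, \dim {: N}).

Definition kpure (m : M) (n : N) : ktens :=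
  \matrix_(i, j) (coord bM i m * coord bN j n).

Definition relator (m : M) (s : S) (n : N) : ktens :=
  kpure (ract m s) n - kpure m (lact s n).

Definition relations : {vspace ktens} :=
  (\sum_(i < \dim {: M}) \sum_(j < \dim {: S}) \sum_(l < \dim {: N})
     <[relator bM`_i bS`_j bN`_l]>)%VS.

Definition tens : vectType k := subquot fullv relations.

Definition pure (m : M) (n : N) : tens := qpi fullv relations (kpure m n).

(* meaningful when beta is bilinear and S-balanced, see [tlift_pure] *)
Definition tlift (W : lmodType k) (beta : M -> N -> W) (x : tens) : W :=
  \sum_i \sum_j (qrepr x : 'M_(_, _)) i j *: beta bM`_i bN`_j.

Fact kpure_linl n : linear (kpure^~ n).
Proof. by move=> a u v; apply/matrixP=> i j; rewrite !mxE linearP mulrDl mulrA. Qed.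
Fact kpure_linr m : linear (kpure m).
Proof. by move=> a u v; apply/matrixP=> i j; rewrite !mxE linearP mulrDr mulrCA. Qed.

Lemma pure_linl n : linear (pure^~ n).
Proof. by move=> a u v; rewrite /pure kpure_linl linearP. Qed.
Lemma pure_linr m : linear (pure m).
Proof. by move=> a u v; rewrite /pure kpure_linr linearP. Qed.

Lemma lin_basis (V : vectType k) (W : lmodType k) (f : V -> W) (v : V) :
  linear f -> f v = \sum_(i < \dim {: V}) coord (vbasis {: V}) i v *: f (vbasis {: V})`_i.
Proof.
move=> fl; pose F := GRing.isLinear.Build _ _ _ _ f fl.
pose f' : {linear V -> W} := HB.pack f F.
rewrite -[f v]/(f' v) {1}(coord_vbasis (memvf v)) linear_sum.
by apply: eq_bigr => i _; rewrite linearZ.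
Qed.

Lemma relator_in m s n : relator m s n \in relations.
Proof.
have l1 u v : linear (fun m => relator m u v).
  move=> a x y; rewrite /relator ract_linl !kpure_linl scalerBr.
  by rewrite opprD addrACA.
have l2 u v : linear (fun s => relator u s v).
  move=> a x y; rewrite /relator ract_linr lact_linl kpure_linl kpure_linr.
  by rewrite scalerBr opprD addrACA.
have l3 u v : linear (relator u v).
  move=> a x y; rewrite /relator lact_linr !kpure_linr scalerBr.
  by rewrite opprD addrACA.
rewrite (lin_basis m (l1 s n)); apply: rpred_sum => i _; apply: rpredZ.
rewrite (lin_basis s (l2 _ n)); apply: rpred_sum => j _; apply: rpredZ.
rewrite (lin_basis n (l3 _ _)); apply: rpred_sum => l _; apply: rpredZ.
rewrite memvE /relations.
apply: (sumv_sup i) => //; apply: (sumv_sup j) => //.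
exact: (sumv_sup l).
Qed.

Lemma pure_balanced m s n : pure (ract m s) n = pure m (lact s n).
Proof. by apply: qpi_eq; rewrite ?memvf // relator_in. Qed.

Fact tlift_linear (W : lmodType k) beta : linear (@tlift W beta).
Proof.
move=> a x y; rewrite /tlift linearP scaler_sumr -big_split; apply: eq_bigr => i _.
rewrite scaler_sumr -big_split; apply: eq_bigr => j _.
by rewrite !mxE scalerDl scalerA.
Qed.
HB.instance Definition _ (W : lmodType k) (beta : M -> N -> W) :=
  GRing.isLinear.Build k tens W _ (@tlift W beta) (@tlift_linear W beta).

Lemma tlift_pure (W : lmodType k) (beta : M -> N -> W) m n :
  (forall n, linear (beta^~ n)) -> (forall m, linear (beta m)) ->
  (forall m s n, beta (ract m s) n = beta m (lact s n)) ->
  tlift beta (pure m n) = beta m n.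
Proof.
move=> bl br bb.
pose f (x : ktens) : W := \sum_i \sum_j (x : 'M_(_, _)) i j *: beta bM`_i bN`_j.
have fl : linear f.
  move=> a x y; rewrite /f scaler_sumr -big_split; apply: eq_bigr => i _.
  rewrite scaler_sumr -big_split; apply: eq_bigr => j _.
  by rewrite !mxE scalerDl scalerA.
pose F := GRing.isLinear.Build _ _ _ _ f fl.
pose f' : {linear ktens -> W} := HB.pack f F.
have fk u v : f' (kpure u v) = beta u v.
  rewrite /= /f (lin_basis u (bl v)); apply: eq_bigr => i _.
  rewrite (lin_basis v (br _)) scaler_sumr; apply: eq_bigr => j _.
  by rewrite mxE scalerA.
have frel : forall x, x \in relations -> f' x = 0.
  move=> _ /memv_sumP[v vP ->]; rewrite linear_sum big1 // => i _.
  have /memv_sumP[w wP ->] := vP i isT; rewrite linear_sum big1 // => j _.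
  have /memv_sumP[z zP ->] := wP j isT; rewrite linear_sum big1 // => l _.
  have /vlineP[a ->] := zP l isT.
  by rewrite linearZ_LR linearB !fk bb subrr scaler0.
have : kpure m n - qrepr (pure m n) \in (fullv :&: relations)%VS.
  by apply: repr_qpi; apply: memvf.
rewrite capfv => /frel; rewrite linearB fk => /eqP; rewrite subr_eq0 => /eqP->.
by [].
Qed.

Lemma tens_span (P : tens -> Prop) :
  P 0 -> (forall a x y, P x -> P y -> P (a *: x + y)) ->
  (forall m n, P (pure m n)) -> forall x, P x.
Proof.
move=> P0 Pl Pp x; rewrite -(qpi_repr x).
have -> : qrepr x = \sum_i \sum_j (qrepr x : 'M_(_, _)) i j *: kpure bM`_i bN`_j.
  have fr (V : vectType k) : free (vbasis {:V}).
    exact/basis_free/vbasisP.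
  apply/matrixP => i j; rewrite summxE (bigD1 i) //= [X in _ + X]big1 ?addr0.
    rewrite summxE (bigD1 j) //= big1 ?addr0 => [|l lj].
      by rewrite !mxE !coord_free // !eqxx !mulr1.
    by rewrite !mxE !coord_free // (negPf lj) !mulr0.
  move=> l li; rewrite summxE big1 // => l' _.
  by rewrite !mxE !coord_free // (negPf li) mul0r mulr0.
rewrite linear_sum; elim/big_rec: _ => // i y _ Py.
rewrite -[X in P (X + _)]scale1r; apply: (Pl) => //.
rewrite linear_sum; elim/big_rec: _ => // j z _ Pz.
by rewrite linearZ_LR; apply: Pl => //; apply: Pp.
Qed.

Lemma tens_ext (W : lmodType k) (f g : tens -> W) :
  linear f -> linear g -> (forall m n, f (pure m n) = g (pure m n)) -> f =1 g.
Proof.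
move=> fl gl fg; apply: tens_span => //; last by move=> a x y; rewrite fl gl => -> ->.
have z (h : tens -> W) : linear h -> h 0 = 0.
  by move=> hl; have := hl (-1) 0 0; rewrite scaler0 addr0 scaleN1r addNr.
by rewrite !z.
Qed.

Definition tens_lact (r : R) : tens -> tens :=
  tlift (fun m n => pure (lact r m) n).
Definition tens_ract (x : tens) (t : T) : tens :=
  tlift (fun m n => pure m (ract n t)) x.

Lemma tens_lact_pure r m n : tens_lact r (pure m n) = pure (lact r m) n.
Proof.
rewrite /tens_lact tlift_pure // => {m n}.
- by move=> n a x y; rewrite lact_linr pure_linl.
- by move=> m a x y; rewrite pure_linr.
by move=> m s n; rewrite -lractA pure_balanced.
Qed.

Lemma tens_ract_pure t m n : tens_ract (pure m n) t = pure m (ract n t).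
Proof.
rewrite /tens_ract tlift_pure // => {m n}.
- by move=> n a x y; rewrite pure_linl.
- by move=> m a x y; rewrite ract_linl pure_linr.
by move=> m s n; rewrite lractA pure_balanced.
Qed.

Fact tens_lact_linr r : linear (tens_lact r).
Proof. exact: tlift_linear. Qed.
Fact tens_ract_linl t : linear (tens_ract^~ t).
Proof. exact: tlift_linear. Qed.

Fact tlift_linearW (W : lmodType k) (U : lmodType k) (beta : U -> M -> N -> W) (x : tens) :
  (forall m n, linear (fun u => beta u m n)) -> linear (fun u => tlift (beta u) x).
Proof.
move=> bl a u v; rewrite /tlift scaler_sumr -big_split; apply: eq_bigr => i _.
rewrite scaler_sumr -big_split; apply: eq_bigr => j _.
by rewrite bl scalerDr !scalerA mulrC.
Qed.

Fact tens_lact_linl x : linear (tens_lact^~ x).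
Proof.
by apply: tlift_linearW => m n a u v; rewrite lact_linl pure_linl.
Qed.
Fact tens_ract_linr x : linear (tens_ract x).
Proof.
by apply: tlift_linearW => m n a u v; rewrite ract_linr pure_linr.
Qed.

Fact tens_lact1 x : tens_lact 1 x = x.
Proof.
apply: (tens_ext (tens_lact_linr 1) (g := id)) => // m n.
by rewrite tens_lact_pure lact1.
Qed.
Fact tens_ract1 x : tens_ract x 1 = x.
Proof.
apply: (tens_ext (tens_ract_linl 1) (g := id)) => // m n.
by rewrite tens_ract_pure ract1.
Qed.
Fact tens_lactM r r' x : tens_lact (r * r') x = tens_lact r (tens_lact r' x).
Proof.
move: x; apply: tens_ext; first exact: tens_lact_linr.
  by move=> a x y; rewrite !tens_lact_linr.
by move=> m n; rewrite !tens_lact_pure lactM.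
Qed.
Fact tens_ractM t t' x : tens_ract x (t * t') = tens_ract (tens_ract x t) t'.
Proof.
move: x; apply: tens_ext; first exact: tens_ract_linl.
  by move=> a x y; rewrite !tens_ract_linl.
by move=> m n; rewrite !tens_ract_pure ractM.
Qed.
Fact tens_lractA r x t : tens_ract (tens_lact r x) t = tens_lact r (tens_ract x t).
Proof.
move: x; apply: tens_ext => [a x y|a x y|m n].
- by rewrite tens_lact_linr tens_ract_linl.
- by rewrite tens_ract_linl tens_lact_linr.
by rewrite !(tens_lact_pure, tens_ract_pure).
Qed.

Definition tens_bimod : bimod R T :=
  Bimod tens_lact_linl tens_lact_linr tens_ract_linl tens_ract_linr
        tens_lact1 tens_ract1 tens_lactM tens_ractM tens_lractA.

End TensorProduct.

Definition local_algebra (k : fieldType) (R : falgType k) :=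
  forall x y : R, x \isn't a GRing.unit -> y \isn't a GRing.unit ->
    x + y \isn't a GRing.unit.

(* oriented paths from v to w in a quiver with arrows E; pcons appends an arrow
   at the target end *)
Inductive qpath (V : Type) (E : V -> V -> Type) (v : V) : V -> Type :=
| pnil : qpath E v v
| pcons (w u : V) (a : E w u) (p : qpath E v w) : qpath E v u.

HB.instance Definition _ V E v w := gen_eqMixin (@qpath V E v w).
HB.instance Definition _ V E v w := gen_choiceMixin (@qpath V E v w).

Definition acyclic (V : Type) (E : V -> V -> Type) :=
  forall v (p : qpath E v v), p = pnil E v.

Fixpoint pcat (V : Type) (E : V -> V -> Type) (v w u : V)
    (q : qpath E w u) (p : qpath E v w) {struct q} : qpath E v u :=
  match q in qpath _ _ u0 return qpath E v u0 with
  | pnil => p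
  | pcons _ _ a q' => pcons a (pcat q' p)
  end.

Record bimod_quiver (k : fieldType) := BimodQuiver {
  vertex : finType;
  arrow : vertex -> vertex -> finType;
  quiver_acyclic : acyclic arrow;
  valg : vertex -> falgType k;
  valg_local : forall v, local_algebra (valg v);
  abim : forall v w, arrow v w -> bimod (valg w) (valg v) }.

Section FreeDirectedCategory.
Variables (k : fieldType) (Q : bimod_quiver k).
Local Notation path := (qpath (@arrow k Q)).

(* M_p; for p of length n > 0 this is g(a_n) (x) ... (x) g(a_1) (x) f(v), the
   last factor being absorbed by the canonical isomorphism *)
Fixpoint Mpath (v w : vertex Q) (p : path v w) : bimod (valg w) (valg v) :=
  match p in qpath _ _ w0 return bimod (valg w0) (valg v) with
  | pnil => regular_bimod (valg v)
  | pcons _ _ a p' => tens_bimod (abim a) (Mpath p')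
  end.

(* the product M_q x M_p -> M_qp: the action of f(w) if q is trivial, and
   (m (x) x) y = m (x) (x y) otherwise *)
Fixpoint mcat (v w u : vertex Q) (q : path w u) (p : path v w) {struct q} :
    Mpath q -> Mpath p -> Mpath (pcat q p) :=
  match q in qpath _ _ u0 return Mpath q -> Mpath p -> Mpath (pcat q p) with
  | pnil => fun x y => lact (x : valg w) y
  | pcons _ _ a q' => fun x y =>
      tlift (fun m x' => pure m (mcat x' y : Mpath (pcat q' p))) x
  end.

Definition fhom (v w : vertex Q) : lmodType k :=
  dsum (fun p : path v w => (Mpath p : lmodType k)).

Definition path_incl (v w : vertex Q) (p : path v w) (x : Mpath p) : fhom v w :=
  @dinj k (path v w) (fun p : path v w => (Mpath p : lmodType k)) p x.

Definition fid (v : vertex Q) : fhom v v := @path_incl v v (pnil _ v) (1 : valg v).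

Definition fcomp (v w u : vertex Q) (g : fhom w u) (f : fhom v w) : fhom v u :=
  dlift (fun q x => dlift (fun p y => path_incl (mcat x y)) f) g.

Lemma mcat_linl v w u (q : path w u) (p : path v w) (y : Mpath p) :
  linear (fun x : Mpath q => mcat x y).
Proof.
case: q => [|w' u' a q'] /=; first exact: lact_linl.
exact: tlift_linear.
Qed.

Lemma mcat_linr v w u (q : path w u) (p : path v w) (x : Mpath q) :
  linear (fun y : Mpath p => mcat x y).
Proof.
elim: q p x => [|w' u' a q' IH] p x /=; first exact: lact_linr.
apply: (@tlift_linearW _ _ _ _ (abim a) (Mpath q') _ _
  (fun y m x' => pure m (mcat x' y : Mpath (pcat q' p))) x) => m x' c y y'.
by rewrite IH pure_linr.
Qed.

Lemma mcat_pcons_lact v w u t (a : arrow u t) (q : path w u) (p : path v w)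
    (m : abim a) (x : Mpath q) (y : Mpath p) :
  (forall (r : valg u) (z : Mpath q), mcat (lact r z) y = lact r (mcat z y)) ->
  @mcat v w t (pcons a q) p (pure m x) y = pure m (mcat x y).
Proof.
move=> ml; rewrite /= tlift_pure // => [z c m1 m2|m1 c z1 z2|m1 s z].
- by rewrite pure_linl.
- by rewrite mcat_linl pure_linr.
by rewrite ml pure_balanced.
Qed.

Lemma mcat_lact v w u (q : path w u) (p : path v w) (r : valg u)
    (x : Mpath q) (y : Mpath p) :
  mcat (lact r x) y = lact r (mcat x y).
Proof.
elim: q r x => [|w' u' a q' IH] r x /=; first by rewrite -lactM.
move: x; apply: tens_ext => [c x x'|c x x'|m x].
- by rewrite tens_lact_linr linearP.
- by rewrite linearP tens_lact_linr.
have E := @mcat_pcons_lact v w w' u' a q' p _ _ y (fun r z => IH r z).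
by rewrite tens_lact_pure; move: (E (lact r m) x) (E m x) => /= -> ->;
   rewrite tens_lact_pure.
Qed.

Lemma mcat_pcons v w u t (a : arrow u t) (q : path w u) (p : path v w)
    (m : abim a) (x : Mpath q) (y : Mpath p) :
  @mcat v w t (pcons a q) p (pure m x) y = pure m (mcat x y).
Proof. by apply: mcat_pcons_lact => r z; apply: mcat_lact. Qed.

Fact path_incl_linear v w (p : path v w) : linear (@path_incl v w p).
Proof. exact: dinj_linear. Qed.

Lemma fhom_ind v w (P : fhom v w -> Prop) :
  P 0 -> (forall f g, P f -> P g -> P (f + g)) ->
  (forall p (x : Mpath p), P (path_incl x)) -> forall f, P f.
Proof. exact: dsum_ind. Qed.

Lemma linear_at0 (U W : lmodType k) (h : U -> W) : linear h -> h 0 = 0.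
Proof. by move=> hl; have := hl (-1) 0 0; rewrite scaler0 addr0 scaleN1r addNr. Qed.

Lemma linear_atD (U W : lmodType k) (h : U -> W) :
  linear h -> forall x y, h (x + y) = h x + h y.
Proof. by move=> hl x y; have := hl 1 x y; rewrite !scale1r. Qed.

Fact fcomp_linr v w u (g : fhom w u) : linear (fun f : fhom v w => fcomp g f).
Proof.
have hl q (x : Mpath q) : linear (fun f : fhom v w =>
    dlift (fun p y => path_incl (mcat x y)) f).
  by apply: dlift_linear => p c y y'; rewrite mcat_linr path_incl_linear.
have h0 (f : fhom v w) q : dlift (fun p y => path_incl (mcat (0 : Mpath q) y)) f = 0.
  rewrite /dlift fsbig1 // => p _.
  by rewrite (linear_at0 (mcat_linl (f p))) (linear_at0 (@path_incl_linear _ _ _)).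
move=> c f f'; rewrite /fcomp.
have [s0 gs0] := dsum_support g; pose s := undup s0.
have us : uniq s by apply: undup_uniq.
have gs q : g q != 0 -> q \in s by move=> /gs0; rewrite mem_undup.
rewrite !(dliftE _ us gs) //.
rewrite scaler_sumr -big_split; apply: eq_bigr => q _.
exact: hl.
Qed.

Fact fcomp_linl v w u (f : fhom v w) : linear (fun g : fhom w u => fcomp g f).
Proof.
apply: dlift_linear => q c x x'.
have [s0 fs0] := dsum_support f; pose s := undup s0.
have us : uniq s by apply: undup_uniq.
have fs p : f p != 0 -> p \in s by move=> /fs0; rewrite mem_undup.
have h0 (z : Mpath q) (p : path v w) : path_incl (mcat z (0 : Mpath p)) = 0.
  by rewrite (linear_at0 (@mcat_linr _ _ _ q p z)) (linear_at0 (@path_incl_linear _ _ _)).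
rewrite !(dliftE _ us fs) //.
rewrite scaler_sumr -big_split; apply: eq_bigr => p _.
by rewrite mcat_linl path_incl_linear.
Qed.

Lemma fcomp_incl v w u (q : path w u) (p : path v w) (x : Mpath q) (y : Mpath p) :
  fcomp (path_incl x) (path_incl y) = path_incl (mcat x y).
Proof.
rewrite /fcomp dlift_inj => [|q'].
  rewrite dlift_inj // => p'.
  by rewrite (linear_at0 (@mcat_linr _ _ _ q p' x)) (linear_at0 (@path_incl_linear _ _ _)).
rewrite /dlift fsbig1 // => p' _.
by rewrite (linear_at0 (mcat_linl _)) (linear_at0 (@path_incl_linear _ _ _)).
Qed.

Definition prepend v w u (a : arrow w u) (m : abim a) (f : fhom v w) : fhom v u :=
  dlift (fun p (x : Mpath p) => @path_incl v u (pcons a p) (pure m x)) f.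

Lemma prepend_incl v w u (a : arrow w u) (m : abim a) (p : path v w) (x : Mpath p) :
  prepend m (path_incl x) = @path_incl v u (pcons a p) (pure m x).
Proof.
rewrite /prepend dlift_inj // => p'.
by rewrite (linear_at0 (@pure_linr _ _ _ _ _ _ m)) (linear_at0 (@path_incl_linear _ _ _)).
Qed.

Fact fcomp_idl v w (f : fhom v w) : fcomp (fid w) f = f.
Proof.
elim/fhom_ind: f => [|f g IH IH'|p x].
- exact: (linear_at0 (@fcomp_linr v w w (fid w))).
- by rewrite (linear_atD (@fcomp_linr v w w (fid w))) IH IH'.
by rewrite /fid fcomp_incl /= lact1.
Qed.

Fact fcomp_idr v w (f : fhom v w) : fcomp f (fid v) = f.
Proof.
elim/fhom_ind: f => [|f g IH IH'|p x].
- exact: (linear_at0 (@fcomp_linl v v w (fid v))).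
- by rewrite (linear_atD (@fcomp_linl v v w (fid v))) IH IH'.
rewrite /fid fcomp_incl; elim: p x => [|w' u a p IH] x.
  by rewrite /= mulr1.
move: x; apply: tens_ext => [c x x'|c x x'|m x].
- by rewrite (mcat_linl (q := pcons a p)) path_incl_linear.
- by rewrite path_incl_linear.
by rewrite mcat_pcons -!prepend_incl IH.
Qed.

Fact fcomp_assoc x y z t (h : fhom z t) (g : fhom y z) (f : fhom x y) :
  fcomp (fcomp h g) f = fcomp h (fcomp g f).
Proof.
elim/fhom_ind: h => [|h h' IH IH'|r l].
- by rewrite !(linear_at0 (fcomp_linl _)).
- by rewrite !(linear_atD (fcomp_linl _)) IH IH'.
elim/fhom_ind: g => [|g g' IH IH'|q m].
- by rewrite (linear_at0 (fcomp_linr _)) !(linear_at0 (fcomp_linl _))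
             (linear_at0 (fcomp_linr _)).
- by rewrite (linear_atD (fcomp_linr _)) !(linear_atD (fcomp_linl _))
             (linear_atD (fcomp_linr _)) IH IH'.
elim/fhom_ind: f => [|f f' IH IH'|p n].
- by rewrite !(linear_at0 (fcomp_linr _)).
- by rewrite !(linear_atD (fcomp_linr _)) IH IH'.
rewrite !fcomp_incl; elim: r l => [|w u a r IH] l.
  by rewrite /= mcat_lact.
move: l; apply: tens_ext => [c l l'|c l l'|m0 l].
- by rewrite (mcat_linl (q := pcons a r)) (mcat_linl (q := pcons a _)) path_incl_linear.
- by rewrite (mcat_linl (q := pcons a r)) path_incl_linear.
by rewrite !mcat_pcons -!prepend_incl IH.
Qed.

Definition free_cat : lincat k :=
  @LinCat k (vertex Q) fhom fid fcomp
    (fun v w u f => @fcomp_linl v w u f) (fun v w u g => @fcomp_linr v w u g)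
    fcomp_idl fcomp_idr fcomp_assoc.

End FreeDirectedCategory.

Definition left_regular (k : fieldType) (Q : bimod_quiver k) :=
  forall v w (a : arrow (b := Q) v w), projective (left_mod (abim a)).

Definition right_regular (k : fieldType) (Q : bimod_quiver k) :=
  forall v w (a : arrow (b := Q) v w), projective (right_mod (abim a)).

Definition regular (k : fieldType) (Q : bimod_quiver k) :=
  left_regular Q /\ right_regular Q.

(* Main.v *)
(* Put A_w = e_w A e_w and let t(x, v) be the number of copies of Delta_x that a
   Delta-filtration of P_v must contain.  A greedy choice of submodules shows that
   A is standardly stratified for a linear order if and only if
     sum over w, v, x of t(x, v) * dim (e_w Delta_x) <= dim A,
   and filtrations by proper standard modules are governed by the same inequality
   for the opposite algebra.
   If the inequality holds for all orders, the orders in which w is the largest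
   element, in which u and then w are the two least elements, and in which w is the
   least element give, respectively: e_w A e_v has the dimension of a free A_w-module on
   its top; the irreducible bimodule e_w (J / J^2) e_u is free over A_w; and
   dim e_w A e_v is the sum over u of dim e_w (J / J^2) e_u times the rank of
   e_u A e_v.  Hence the free category on the bimodules e_w (J / J^2) e_u is
   A_w-generated in degree (v, w) by at most rank (e_w A e_v) elements, and its
   surjection onto the graded category is injective for dimension reasons.
   Conversely, morphism spaces of a left (right) regular free category are free
   over the local algebras on the target (source) side, with ranks counting paths;
   splitting every path at its largest vertex for a given order yields the
   inequality for that order. *)
Require Import Defs.
From HB Require Import structures.
From mathcomp Require Import all_boot all_order all_algebra all_field.
From mathcomp Require Import boolp zify.

Set Implicit Arguments.
Unset Strict Implicit.
Unset Printing Implicit Defensive.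

Import GRing.Theory.
Local Open Scope ring_scope.

(** * Connected algebras *)

(** Dimension counts suffice because the field is algebraically closed: each [A_w] is [k e_w] plus a
    nilpotent ideal, so simple modules are one-dimensional, composition multiplicities are
    dimensions of [e_j M], and minimal numbers of generators are dimensions of tops. The inequality
    reverse to stratification holds for every order, so stratification leaves no slack in any single
    corner [e_w A e_v], and the special orders can be evaluated corner by corner. The graded algebra
    need not be isomorphic to [A], so filtrations cannot be carried over directly; but its corners
    are linearly identified with those of [A], and generators matter only modulo [J^2], which degree
    one already sees. Hence all counts take place in [A]. For proper standard modules the
    multiplicity and the dimension of a factor trade places, which is why the opposite algebra
    appears. Directedness enters through the vanishing of cycles: [e_w A e_u A e_w = 0] for
    [u != w]. *)

Section FalgElements.
Variables (k : fieldType) (R : falgType k).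

Lemma annihilating_poly (y : R) : exists2 p : {poly k}, p != 0 & horner_alg y p = 0.
Proof.
pose n := \dim {:R}; pose X := [tuple y ^+ i | i < n.+1].
have : ~ (forall c, \sum_(i < n.+1) c i *: X`_i = 0 -> forall i, c i = 0).
  move=> /freeP /eqP fX; have := dimvS (subvf <<X>>%VS).
  by rewrite fX size_tuple ltnn.
move=> /existsNP[c /not_implyP[sc /existsNP[i ci]]].
exists (\poly_(j < n.+1) c (inord j)).
  apply/eqP => /(congr1 (fun p : {poly k} => p`_i)).
  by rewrite coef0 coef_poly ltn_ord inord_val.
have XE j : X`_j = if (j < n.+1)%N then y ^+ j else 0.
  case: ltnP => jn; last by rewrite nth_default ?size_tuple.
  by rewrite -(tnth_nth 0 X (Ordinal jn)) tnth_mktuple.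
rewrite /horner_alg /horner_morph (@horner_coef_wide _ n.+1); last first.
  by rewrite (leq_trans (size_poly _ _)) // size_poly.
rewrite -[RHS]sc; apply: eq_bigr => j _.
by rewrite coef_map /= coef_poly ltn_ord inord_val XE ltn_ord mulr_algl.
Qed.

Lemma left_inverse_nilpotent (x z : R) n : z * x = 1 -> x ^+ n <> 0.
Proof.
move=> zx; elim: n => [|n IH]; first by move/eqP; rewrite expr0 oner_eq0.
by rewrite exprS => xn; apply: IH; rewrite -[LHS]mul1r -zx -mulrA xn mulr0.
Qed.

Lemma unit_sub_nilpotent (x : R) n : x ^+ n = 0 -> exists z, z * (1 - x) = 1.
Proof.
move=> xn; exists (\sum_(i < n) x ^+ i).
rewrite mulrBr mulr1 big_distrl /=; case: n xn => [/eqP|n xn].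
  by rewrite expr0 oner_eq0.
under [X in _ - X]eq_bigr do rewrite -exprSr.
by rewrite big_ord_recl big_ord_recr /= xn expr0 addr0 addrK.
Qed.

End FalgElements.

Section SumOfLines.
Variables (k : fieldType) (A : falgType k).

Lemma dim_sum_line (C : {vspace A}) (s : seq A) :
  (\dim (\sum_(m <- s) C * <[m]>) <= size s * \dim C)%N.
Proof.
elim: s => [|m s IH]; first by rewrite big_nil dimv0.
rewrite big_cons /= mulSn; apply: leq_trans (dimv_add_leqif _ _).1 _.
rewrite leq_add // -limg_amulr.
by rewrite -(limg_ker_dim (amulr m) C) leq_addl.
Qed.

Lemma sum_line_mem (C : {vspace A}) (s : seq A) m c :
  m \in s -> c \in C -> c * m \in (\sum_(m <- s) C * <[m]>)%VS.
Proof.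
elim: s => // m' s IH; rewrite inE big_cons => /orP[/eqP->|ms] cC.
  by rewrite (subvP (addvSl _ _)) // memv_mul ?memv_line.
by rewrite (subvP (addvSr _ _)) // IH.
Qed.

Lemma sum_line_sub (C U : {vspace A}) (s : seq A) :
  (forall m c, m \in s -> c \in C -> c * m \in U) -> (\sum_(m <- s) C * <[m]> <= U)%VS.
Proof.
elim: s => [|m s IH] sub; first by rewrite big_nil sub0v.
rewrite big_cons subv_add IH ?andbT => [|m' c m's]; last by apply: sub; rewrite inE m's orbT.
rewrite -limg_amulr; apply/subvP => _ /memv_imgP[c cC ->]; rewrite lfunE /=.
by apply: sub; rewrite ?mem_head.
Qed.

End SumOfLines.

Section Connected.
Variables (k : closedFieldType) (R : falgType k).
Hypothesis connected : forall f : R, f * f = f -> f = 0 \/ f = 1.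

(** Fitting's argument. Write [p = q * 'X^m] with [q] prime to ['X]; for [m > 0] a Bezout relation,
    evaluated at [y], gives complementary idempotents, and connectedness kills one of them. *)
Lemma nilpotent_or_unit (y : R) : (exists n, y ^+ n = 0) \/ exists z, z * y = 1.
Proof.
have [p p0 py] := annihilating_poly y.
have [[//|m] [q q0 pE]] := multiplicity_XsubC p 0; rewrite p0 /= in q0.
  right; move: pE; rewrite expr0 mulr1 => pE; rewrite -pE in q0.
  have /Bezout_coprimepP[[u v] /= ] : coprimep p 'X by rewrite -['X]subr0 coprimep_XsubC.
  rewrite -size_poly_eq1 => /size_poly1P[c c0 uv].
  exists (c^-1 *: horner_alg y v).
  have := congr1 (horner_alg y) uv.
  rewrite rmorphD !rmorphM /= py mulr0 add0r horner_algX horner_algC -scalerAl => ->.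
  by rewrite scalerA mulVf // scale1r.
have /Bezout_coprimepP[[u v] /= ] : coprimep q ('X ^+ m.+1).
  by rewrite coprimep_expr // -['X]subr0 coprimep_XsubC.
rewrite -size_poly_eq1 => /size_poly1P[c c0 uv].
pose f := c^-1 *: horner_alg y (u * q); pose g := c^-1 *: horner_alg y (v * 'X ^+ m.+1).
have fg1 : f + g = 1.
  rewrite /f /g -scalerDr -rmorphD /= uv horner_algC scalerA mulVf //.
  by rewrite scale1r.
have fg0 : g * f = 0.
  rewrite /f /g -scalerAl -scalerAr -rmorphM /=.
  have -> : v * 'X^(m.+1) * (u * q) = v * u * p.
    by rewrite pE subr0 mulrCA !mulrA [_ * u]mulrC -!mulrA ['X^_ * _]mulrC.
  by rewrite rmorphM /= py mulr0 !scaler0.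
have ff : f * f = f by rewrite -[RHS]mul1r -fg1 mulrDl fg0 addr0.
(* If [f] vanishes, the Bezout relation reads [v(y) y^(m+1) = c], which inverts [y]; if [f = 1],
   then [y^(m+1) = y^(m+1) f] is a multiple of [p(y) = 0]. *)
case: (connected ff) => fE.
  right; exists (c^-1 *: horner_alg y (v * 'X^m)).
  by rewrite -fg1 fE add0r /g exprSr mulrA !rmorphM /= horner_algX -scalerAl.
left; exists m.+1; rewrite -[LHS]mulr1 -fE /f -scalerAr.
rewrite -{1}(horner_algX y) -rmorphXn -rmorphM /=.
have -> : 'X^(m.+1) * (u * q) = u * p by rewrite pE subr0 mulrCA ['X^_ * _]mulrC.
by rewrite rmorphM /= py mulr0 scaler0.
Qed.

Lemma nilpotent_mull (a x : R) n : x ^+ n = 0 -> exists m, (a * x) ^+ m = 0.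
Proof.
move=> xn; have [//|[z]] := nilpotent_or_unit (a * x).
by rewrite mulrA => /left_inverse_nilpotent /(_ xn).
Qed.

Lemma nilpotent_mulr (a x : R) n : x ^+ n = 0 -> exists m, (x * a) ^+ m = 0.
Proof.
move=> /(nilpotent_mull a)[m axm]; exists m.+1.
have -> : (x * a) ^+ m.+1 = x * (a * x) ^+ m * a.
  elim: m {axm} => [|m IH]; first by rewrite expr1 expr0 mulr1.
  by rewrite exprS IH [(a * x) ^+ m.+1]exprS !mulrA.
by rewrite axm mulr0 mul0r.
Qed.

(** If [z (x + y) = 1], then [z x = 1 - z y] with [z y] nilpotent, so the nilpotent [x] would have a
    left inverse. *)
Lemma nilpotentD (x y : R) n m :
  x ^+ n = 0 -> y ^+ m = 0 -> exists l, (x + y) ^+ l = 0.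
Proof.
move=> xn ym; have [//|[z zxy]] := nilpotent_or_unit (x + y).
have [l zyl] := nilpotent_mull z ym; have [t tzy] := unit_sub_nilpotent zyl.
have : (t * z) * x = 1 by rewrite -mulrA -[RHS]tzy -zxy [z * (x + y)]mulrDr addrK.
by move=> /left_inverse_nilpotent /(_ xn).
Qed.

(** An annihilating polynomial splits into linear factors; if every [x - c] had a left inverse, the
    factors could be cancelled one by one from the vanishing product. *)
Lemma eigenvalue_exists (x : R) : exists c : k, exists n, (x - c%:A) ^+ n = 0.
Proof.
have [p p0 px] := annihilating_poly x.
have [r pE] := closed_field_poly_normal p.
have lp0 : lead_coef p != 0 by rewrite lead_coef_eq0.
move: px; rewrite pE -mul_polyC rmorphM /= horner_algC -scalerAl mul1r => /(congr1 ( *:%R (lead_coef p)^-1)).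
rewrite scalerA mulVf // scale1r scaler0 => /eqP {pE}.
elim: r => [|c r IH]; first by rewrite big_nil rmorph1 oner_eq0.
rewrite big_cons rmorphM /= rmorphB /= horner_algX horner_algC.
have [[n xn] _|[z zx]] := nilpotent_or_unit (x - c%:A); first by exists c, n.
by move=> /eqP/(congr1 ( *%R z)); rewrite mulrA zx mul1r mulr0 => /eqP/IH.
Qed.

(** For dimension reasons the powers of [N] stabilise at some [P] with [P = N P], and Nakayama gives
    [P = 0]. *)
Lemma nil_ideal_nilpotent (N : {vspace R}) :
  (forall x, x \in N -> exists n, x ^+ n = 0) ->
  (forall a x, x \in N -> a * x \in N /\ x * a \in N) -> exists n, (N ^+ n)%VS = 0%VS.
Proof.
move=> nilN idN.
have stab : exists2 n, (0 < n)%N & (N ^+ n)%VS = (N ^+ n.+1)%VS.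
  (* Exponents start at 1, because [N ^+ 0] is the line through 1 and need not contain [N]. *)
  have NS n : (N ^+ n.+2 <= N ^+ n.+1)%VS.
    elim: n => [|n IH]; last by rewrite [X in (X <= _)%VS]expvSl [X in (_ <= X)%VS]expvSl prodvSr.
    by rewrite expv1 expv2; apply/prodvP => a x _ /(idN a)[].
  have [//|nst] := pselect (exists2 n, (0 < n)%N & (N ^+ n)%VS = (N ^+ n.+1)%VS).
  have lt n : (\dim (N ^+ n.+1) + n <= \dim {:R})%N.
    elim: n => [|n IH]; first by rewrite addn0 dimvS ?subvf.
    rewrite addnS -addSn; apply: leq_trans IH; rewrite leq_add2r.
    rewrite ltn_neqAle dimvS ?NS // andbT; apply: contra_notN nst => /eqP e.
    by exists n.+1 => //; apply/esym/eqP; rewrite eqEdim NS e leqnn.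
  by have := lt (\dim {:R}).+1; rewrite addnS ltnNge leq_addl.
case: stab => n _ st; exists n; set P := (N ^+ n)%VS in st *.
have PE : P = (N * P)%VS by rewrite /P -expvSl.
(* Nakayama: one generator of P after the other is redundant. *)
suff gen (ys : seq R) : {subset ys <= P} -> (P <= \sum_(y <- ys) fullv * <[y]>)%VS -> P = 0%VS.
  apply: (gen (vbasis P)) => [y /vbasis_mem//|]; rewrite -{1}(span_basis (vbasisP P)).
  by apply/span_subvP => y yP; rewrite -[y]mul1r sum_line_mem ?memvf.
elim: ys => [_|y ys IH ysP]; first by rewrite big_nil subv0 => /eqP.
rewrite big_cons; set Z := (\sum_(_ <- _) _)%VS => Pgen.
have Zl a z : z \in Z -> a * z \in Z.
  move=> zZ; suff : z \in (amull a @^-1: Z)%VS by rewrite -memv_preim lfunE.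
  apply: subvP z zZ; apply: sum_line_sub => m c ms _; rewrite -memv_preim lfunE /= mulrA.
  by rewrite sum_line_mem ?memvf.
apply: IH => [z zys|]; first by apply: ysP; rewrite inE zys orbT.
apply: (subv_trans Pgen); rewrite subv_add subvv andbT.
have : y \in (N * <[y]> + Z)%VS.
  have /subvP : (P <= N * <[y]> + Z)%VS; last by apply; apply: ysP; rewrite mem_head.
  rewrite [X in (X <= _)%VS]PE; apply: subv_trans (prodvSr N Pgen) _.
  rewrite prodvDr addvS //; last by apply/prodvP => a z _; apply: Zl.
  by rewrite prodvA prodvSl //; apply/prodvP => x a /(idN a)[].
(* Here [y = a y + z], and [1 - a] has a left inverse because [a] is nilpotent. *)
case/memv_addP => x xN [z zZ yE]; move: xN; rewrite -limg_amulr => /memv_imgP[a aN aE].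
have [m am] := nilN a aN; have [t ta] := unit_sub_nilpotent am.
have yZ : y = t * z.
  rewrite -[LHS]mul1r -ta -mulrA; congr (_ * _).
  by rewrite mulrBl mul1r {1}yE aE lfunE /= addrAC subrr add0r.
by apply/prodvP => b _ _ /vlineP[c ->]; rewrite -scalerAr memvZ // yZ !Zl.
Qed.

(** [N] is the set of nilpotent elements. The second clause says that the residue field is [k]; this
    is what algebraic closedness provides, and it lets dimensions of tops count generators. *)
Lemma nilradical_exists : exists N : {vspace R},
  [/\ 1 \notin N, forall x, exists c : k, x - c%:A \in N,
      forall a x, x \in N -> a * x \in N /\ x * a \in N,
      (exists n, (N ^+ n)%VS = 0%VS) &
      forall x, x \notin N -> exists z, z * x = 1].
Proof.
have [N NP] : exists N : {vspace R}, forall x, x \in N <-> exists n, x ^+ n = 0.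
  apply: vspace_of_predP => [|c x y [n xn] [m ym]]; first by exists 1%N.
  apply: (nilpotentD (n := n)) ym.
  by rewrite exprZn xn scaler0.
exists N; split.
- by apply/negP => /NP[n]; apply: (left_inverse_nilpotent (z := 1)); rewrite mulr1.
- by move=> x; have [c ?] := eigenvalue_exists x; exists c; apply/NP.
- by move=> a x /NP[n xn]; split; apply/NP; [apply: nilpotent_mull xn | apply: nilpotent_mulr xn].
- apply: nil_ideal_nilpotent => [x /NP //|a x /NP[n xn]].
  by split; apply/NP; [apply: nilpotent_mull xn | apply: nilpotent_mulr xn].
by move=> x Nx; case: (nilpotent_or_unit x) => // /NP; rewrite (negPf Nx).
Qed.

End Connected.

(** * Peirce decompositions and stratification inequalities *)

Section Dimensions.
Variables (k : fieldType) (V W : vectType k).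

Lemma dim_projection_sum (I : finType) (p : I -> 'End(V)) (U : {vspace V}) :
  (forall i j x, p i (p j x) = if i == j then p j x else 0) ->
  (forall x, x = \sum_i p i x) -> (forall i, (p i @: U <= U)%VS) ->
  \dim U = (\sum_i \dim (p i @: U))%N.
Proof.
move=> pp psum pU.
have UE : U = (\sum_i p i @: U)%VS.
  apply/eqP; rewrite eqEsubv; apply/andP; split; last by apply/subv_sumP => i _; apply: pU.
  apply/subvP => x Ux; rewrite (psum x); apply: memv_sumr => i _.
  exact: memv_img.
have dv : directv (\sum_i p i @: U)%VS.
  apply/directv_sum_independent => us usU us0 i _.
  have usE j : us j = p j (us j).
    by have /memv_imgP[y _ ->] := usU j isT; rewrite pp eqxx.
  have := congr1 (p i) us0; rewrite linear0 linear_sum (bigD1 i) //= -usE big1 ?addr0 //.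
  by move=> j ji; rewrite usE pp eq_sym (negPf ji).
by rewrite {1}UE; apply/directvP.
Qed.

(** Modulo [B], only a complement of [X0] in [X] contributes. *)
Lemma dim_img_add (f : 'Hom(V, W)) (X X0 : {vspace V}) (B : {vspace W}) :
  (X0 <= X)%VS -> (f @: X0 <= B)%VS ->
  (\dim (f @: X + B) <= \dim B + (\dim X - \dim X0))%N.
Proof.
move=> X0X fX0.
have XE : X = (X :\: X0 + X0)%VS by rewrite addv_diff; apply/esym/addv_idPl.
rewrite {1}XE limgD -addvA (addv_idPr fX0).
have -> : (\dim X - \dim X0)%N = \dim (X :\: X0).
  by rewrite -(dimv_cap_compl X X0) (capv_idPr X0X) addKn.
rewrite addnC; apply: leq_trans (dimv_add_leqif _ _).1 _.
by rewrite leq_add2r -(limg_ker_dim f (X :\: X0)) leq_addl.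
Qed.

Lemma linear_inj_dim (f : V -> W) (U : {vspace W}) : linear f ->
  (forall x, f x \in U) -> (forall x, f x = 0 -> x = 0) -> (\dim {: V} <= \dim U)%N.
Proof.
move=> fl fU f0; pose H := GRing.isLinear.Build _ _ _ _ f fl.
pose f' : {linear V -> W} := HB.pack f H.
have inj : (fullv :&: lker (linfun f') = 0)%VS.
  apply/eqP; rewrite -subv0; apply/subvP => x; rewrite memv_cap memv_ker lfunE /= => /andP[_ /eqP].
  by move=> /f0->; apply: mem0v.
rewrite -(limg_dim_eq inj); apply: dimvS; apply/subvP => _ /memv_imgP[x _ ->].
by rewrite lfunE.
Qed.

(** The second clause is what turns a generating family of the right size into a basis. *)
Lemma linear_onto_dim (f : V -> W) (U : {vspace W}) : linear f ->
  (forall y, y \in U -> exists x, f x = y) -> (\dim U <= \dim {: V})%N /\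
  ((\dim {: V} <= \dim U)%N -> forall x, f x = 0 -> x = 0).
Proof.
move=> fl fs; pose H := GRing.isLinear.Build _ _ _ _ f fl.
pose f' : {linear V -> W} := HB.pack f H.
have sub : (U <= limg (linfun f'))%VS.
  apply/subvP => y /fs[x <-]; apply/memv_imgP; exists x; rewrite ?memvf //.
  by rewrite lfunE.
have := limg_ker_dim (linfun f') fullv; rewrite capfv => dE.
have := dimvS sub; split=> [|dV x fx]; first by rewrite -dE (leq_trans _ (leq_addl _ _)).
have /eqP : \dim (lker (linfun f')) == 0%N.
  by rewrite -leqn0 -(leq_add2r (\dim (limg (linfun f')))) dE add0n (leq_trans dV).
move/eqP; rewrite dimv_eq0 => /eqP ker0.
by apply/eqP; rewrite -memv0 -ker0 memv_ker lfunE /= fx.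
Qed.

End Dimensions.

Lemma dim_ffun (k : fieldType) (V : vectType k) n :
  \dim {: {ffun 'I_n -> V}} = (n * \dim {: V})%N.
Proof. by rewrite !dimvf /dim /= card_ord mulnC. Qed.

Lemma sum_leq_eq (I : finType) (a b : I -> nat) :
  (forall i, (a i <= b i)%N) -> (\sum_i b i <= \sum_i a i)%N -> forall i, a i = b i.
Proof.
move=> ab sba i.
have [le eq] : (\sum_j a j <= \sum_j b j ?= iff [forall (j | true), a j == b j])%N.
  by apply: leqif_sum => j _; apply/leqif_eq/ab.
by move: eq; rewrite eqn_leq le sba => /esym/forallP/(_ i)/eqP.
Qed.

(** Iterating [F] from any start freezes the value at [w] after [h w + 1] rounds, since [F] reads
    only values at smaller heights. *)
Lemma height_recursion (L : Type) (T : Type) (h : L -> nat) (F : (L -> T) -> L -> T) :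
  (forall w f g, (forall u, (h u < h w)%N -> f u = g u) -> F f w = F g w) ->
  forall f0 : L -> T, exists f, forall w, f w = F f w.
Proof.
move=> Floc f0; pose g n := iter n F f0.
have gE n m w : (h w < n)%N -> (h w < m)%N -> g n w = g m w.
  elim: n m w => // n IH [//|m] w; rewrite !ltnS => wn wm /=.
  by apply: Floc => u uw; apply: IH; apply: leq_trans uw _.
exists (fun w => g (h w).+1 w) => w; apply: Floc => u uw.
exact: (gE (h w) (h u).+1).
Qed.

(* N i is the radical of the local algebra e_i A e_i, and h is a height function
   for the order directing A. *)
Record peirce (k : fieldType) (A : falgType k) (L : finType) (e : L -> A)
    (N : L -> {vspace A}) (h : L -> nat) : Prop := Peirce {
  pe_idem : forall i, e i * e i = e i;
  pe_orth : forall i j, i != j -> e i * e j = 0;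
  pe_sum : \sum_i e i = 1;
  pe_height : forall w u x, e w * x * e u != 0 -> w = u \/ (h u < h w)%N;
  pe_notin : forall i, e i \notin N i;
  pe_corner : forall i x, x \in N i -> e i * x * e i = x;
  pe_split : forall i x, exists c, e i * x * e i - c *: e i \in N i;
  pe_mull : forall i a x, x \in N i -> e i * a * x \in N i;
  pe_mulr : forall i a x, x \in N i -> x * a * e i \in N i;
  pe_nil : forall i, exists n, (N i ^+ n)%VS = 0%VS }.

Section Peirce.
Variables (k : fieldType) (A : falgType k) (L : finType) (e : L -> A).
Variables (N : L -> {vspace A}) (h : L -> nat) (Hp : peirce e N h).

Definition blk w v : 'End(A) := (amulr (e v) \o amull (e w))%VF.
Lemma blkE w v x : blk w v x = e w * x * e v.
Proof. by rewrite comp_lfunE !lfunE /=. Qed.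

(* The morphisms from v to w in the associated category. *)
Definition crn w v : {vspace A} := (blk w v @: fullv)%VS.

Lemma mem_crn w v x : e w * x * e v \in crn w v.
Proof. by rewrite -blkE memv_img ?memvf. Qed.

Lemma crnP w v x : reflect (e w * x * e v = x) (x \in crn w v).
Proof.
apply: (iffP idP) => [/memv_imgP[y _ ->]|<-]; last exact: mem_crn.
by rewrite blkE !mulrA (pe_idem Hp) -!mulrA (pe_idem Hp).
Qed.

Lemma crnl w v x : x \in crn w v -> e w * x = x.
Proof. by move=> /crnP xE; rewrite -{1}xE !mulrA (pe_idem Hp) xE. Qed.
Lemma crnr w v x : x \in crn w v -> x * e v = x.
Proof. by move=> /crnP xE; rewrite -{1}xE -!mulrA (pe_idem Hp) !mulrA xE. Qed.

Lemma crn_mul w u v x y : x \in crn w u -> y \in crn u v -> x * y \in crn w v.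
Proof.
move=> xC yC; apply/crnP.
by rewrite mulrA (crnl xC) -mulrA (crnr yC).
Qed.

Lemma crn_id w : e w \in crn w w.
Proof. by apply/crnP; rewrite !(pe_idem Hp). Qed.

Lemma crn_height w v x : x \in crn w v -> x != 0 -> w = v \/ (h v < h w)%N.
Proof. by move=> /crnP <-; apply: (pe_height Hp). Qed.

Lemma crn_eq0 w v : w != v -> (h w <= h v)%N -> crn w v = 0%VS.
Proof.
move=> wv hwv; apply/eqP; rewrite -subv0; apply/subvP => x xC; rewrite memv0.
by apply: contraT => /(crn_height xC)[/eqP|]; rewrite ?(negPf wv) // ltnNge hwv.
Qed.

(** Directedness excludes nonzero cycles: whichever of [w] and [u] is not the higher one, every
    morphism into it from the other is zero. *)
Lemma crn_through w u x y : w != u -> x \in crn w u -> y \in crn u w -> x * y = 0.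
Proof.
move=> wu xC yC; have [hwu|huw] := leqP (h w) (h u).
  by move: xC; rewrite (crn_eq0 wu hwu) memv0 => /eqP->; rewrite mul0r.
move: yC; rewrite (crn_eq0 _ (ltnW huw)) 1?eq_sym // memv0 => /eqP->.
by rewrite mulr0.
Qed.

Lemma radical_crn i : (N i <= crn i i)%VS.
Proof. by apply/subvP => x /(pe_corner Hp) xE; apply/crnP. Qed.

Lemma blk_stable_mem w v (U : {vspace A}) x :
  (blk w v @: U <= U)%VS -> (x \in (blk w v @: U)%VS) = (x \in U) && (x \in crn w v).
Proof.
move=> sU; apply/idP/andP => [xU|[Ux /crnP <-]].
  split; first exact: (subvP sU).
  exact: (subvP (limgS _ (subvf U))).
by rewrite -blkE memv_img.
Qed.

Definition bistable (U : {vspace A}) := forall w v, (blk w v @: U <= U)%VS.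

Lemma dim_blk U : bistable U -> \dim U = (\sum_w \sum_v \dim (blk w v @: U))%N.
Proof.
move=> sU; rewrite pair_big /=.
apply: (@dim_projection_sum k A (L * L)%type (fun i => blk i.1 i.2)) => [[w v] [w' v'] x|x|[w v]].
- rewrite /= !blkE; case: eqP => [[-> ->]|ne].
    by rewrite !mulrA (pe_idem Hp) -!mulrA (pe_idem Hp).
  have [ww|ww] := eqVneq w w'.
    have vv : v' != v by apply: contra_notN ne => /eqP->; rewrite ww.
    by rewrite -!mulrA (pe_orth Hp vv) !mulr0.
  by rewrite !mulrA (pe_orth Hp ww) !mul0r.
- rewrite -(pair_big xpredT xpredT (fun i j => blk i j x)) /=.
  under eq_bigr do under eq_bigr do rewrite blkE.
  under eq_bigr do rewrite -mulr_sumr (pe_sum Hp) mulr1.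
  by rewrite -mulr_suml (pe_sum Hp) mul1r.
exact: sU.
Qed.

Lemma bistablef : bistable fullv.
Proof. by move=> w v; apply: subvf. Qed.

(** The ideal [A e_S A]; its part in [A e_v] is the trace of the projectives [P_x], [x] in [S], in
    [P_v]. *)
Definition idl (S : {set L}) : {vspace A} :=
  (\sum_(x in S) fullv * <[e x]> * fullv)%VS.

Lemma mem_idl (S : {set L}) x a b : x \in S -> a * e x * b \in idl S.
Proof.
move=> xS; apply: (subvP (sumv_sup x xS (subvv _))).
by rewrite !memv_mul ?memv_line ?memvf.
Qed.

Lemma idl_ind (S : {set L}) (U : {vspace A}) :
  (forall x a b, x \in S -> a * e x * b \in U) -> (idl S <= U)%VS.
Proof.
move=> SU; apply/subv_sumP => x xS; apply/prodvP => u b.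
rewrite -limg_amulr => /memv_imgP[a _ ->] _; rewrite lfunE /=.
exact: SU.
Qed.

Lemma idlS (S T : {set L}) : S \subset T -> (idl S <= idl T)%VS.
Proof. by move=> /subsetP ST; apply: idl_ind => x a b /ST; apply: mem_idl. Qed.

Lemma idl_mull (S : {set L}) a x : x \in idl S -> a * x \in idl S.
Proof.
suff /subvP sub : (idl S <= amull a @^-1: idl S)%VS.
  by move=> /sub; rewrite -memv_preim lfunE.
apply: idl_ind => y b c yS; rewrite -memv_preim lfunE /= !mulrA.
exact: mem_idl.
Qed.

Lemma idl_mulr (S : {set L}) a x : x \in idl S -> x * a \in idl S.
Proof.
suff /subvP sub : (idl S <= amulr a @^-1: idl S)%VS.
  by move=> /sub; rewrite -memv_preim lfunE.
apply: idl_ind => y b c yS; rewrite -memv_preim lfunE /= -[_ * c * a]mulrA.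
exact: mem_idl.
Qed.

Lemma bistable_idl S : bistable (idl S).
Proof.
move=> w v; apply/subvP => _ /memv_imgP[x xS ->].
by rewrite blkE idl_mulr // idl_mull.
Qed.

Lemma blk_idl_sub w v S : (blk w v @: idl S <= crn w v)%VS.
Proof. exact/limgS/subvf. Qed.

Lemma mem_blk_idl w v S x :
  (x \in (blk w v @: idl S)%VS) = (x \in idl S) && (x \in crn w v).
Proof. exact/blk_stable_mem/bistable_idl. Qed.

Lemma crn_idl (S : {set L}) w v x : w \in S -> x \in crn w v -> x \in idl S.
Proof. by move=> wS xC; rewrite -(crnl xC) -[e w * x]mul1r mulrA mem_idl. Qed.

Lemma crn_idlr (S : {set L}) w v x : v \in S -> x \in crn w v -> x \in idl S.
Proof. by move=> wS xC; rewrite -(crnr xC) -[x * e v]mulr1 mem_idl. Qed.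

Lemma blk_idl_l (S : {set L}) w v : w \in S -> (blk w v @: idl S)%VS = crn w v.
Proof.
move=> wS; apply/eqP; rewrite eqEsubv blk_idl_sub; apply/subvP => x xC.
by rewrite mem_blk_idl xC (crn_idl wS xC).
Qed.

Lemma blk_idl_r (S : {set L}) w v : v \in S -> (blk w v @: idl S)%VS = crn w v.
Proof.
move=> wS; apply/eqP; rewrite eqEsubv blk_idl_sub; apply/subvP => x xC.
by rewrite mem_blk_idl xC (crn_idlr wS xC).
Qed.

Lemma blk_idl_ind (S : {set L}) w v (U : {vspace A}) :
  (forall x a b, x \in S -> a \in crn w x -> b \in crn x v -> a * b \in U) ->
  (blk w v @: idl S <= U)%VS.
Proof.
move=> SU; apply/subvP => _ /memv_imgP[y yS ->].
suff /subvP/(_ y yS) : (idl S <= blk w v @^-1: U)%VS by rewrite -memv_preim.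
apply: idl_ind => x a b xS; rewrite -memv_preim blkE.
have -> : e w * (a * e x * b) * e v = (e w * a * e x) * (e x * b * e v).
  by rewrite -{1}(pe_idem Hp x) !mulrA.
by apply: (SU x); rewrite ?mem_crn.
Qed.

Lemma idl_full : idl setT = fullv.
Proof.
apply/eqP; rewrite eqEsubv subvf; apply/subvP => x _.
rewrite -[x]mul1r -(pe_sum Hp) mulr_suml; apply: rpred_sum => i _.
by rewrite -[e i]mul1r mem_idl ?inE.
Qed.

Lemma idl0 : idl set0 = 0%VS.
Proof. by rewrite /idl big_set0. Qed.

(** Substituting the first inclusion into itself gives [X <= Z + N_i^m X] for all [m], and [N_i] is
    nilpotent. *)
Lemma nakayama i (X Z : {vspace A}) :
  (X <= Z + N i * X)%VS -> (N i * Z <= Z)%VS -> (X <= Z)%VS.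
Proof.
move=> XZ NZ; have [n Nn] := pe_nil Hp i.
suff XZn m : (X <= Z + N i ^+ m * X)%VS by have := XZn n; rewrite Nn prod0v addv0.
elim: m => [|m IH]; first by rewrite expv0 prod1v addvSr.
apply: subv_trans XZ _; rewrite subv_add addvSl /= expvSl -prodvA.
apply: subv_trans (prodvSr _ IH) _; rewrite prodvDr; apply: addvS => //.
Qed.

Definition above (key : L -> nat) m := [set x | (m <= key x)%N].

Lemma above_bound (key : L -> nat) : exists M, above key M = set0 /\ forall x, (key x < M)%N.
Proof.
exists (\max_x key x).+1; have lt x : (key x < (\max_x key x).+1)%N by rewrite ltnS leq_bigmax.
by split=> //; apply/setP => x; rewrite !inE leqNgt lt.
Qed.

(** The values of [key] may have gaps; passing a gap leaves the set unchanged. *)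
Lemma above_step (key : L -> nat) m : injective key ->
  (above key m = above key m.+1 /\ forall y, (m <= key y)%N = (m < key y)%N) \/
  exists x, [/\ key x = m, above key m = x |: above key m.+1 &
                forall y, (m <= key y)%N && (y != x) = (m < key y)%N].
Proof.
move=> ik; have [[x <-]|nx] := pselect (exists x, key x = m); [right; exists x | left].
  have E y : (key x <= key y)%N = (y == x) || (key x < key y)%N.
    by rewrite leq_eqVlt (inj_eq ik) eq_sym.
  split=> // [|y]; first by apply/setP => y; rewrite !inE E.
  by rewrite E; case: eqVneq => [->|_] /=; rewrite ?ltnn ?andbT.
have E y : (m <= key y)%N = (m < key y)%N.
  by rewrite leq_eqVlt; case: eqP => // my; case: nx; exists y.
by split=> //; apply/setP => y; rewrite !inE E.
Qed.

(* For S = {y > x}: the multiplicity of Delta_x in P_v, and dim e_w Delta_x. *)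
Definition rad_rank (S : {set L}) x v :=
  (\dim (crn x v) - \dim (blk x v @: (idl S + N x * fullv)))%N.
Definition quot_dim (S : {set L}) w x := (\dim (crn w x) - \dim (blk w x @: idl S))%N.

Lemma blk_rad x v : (blk x v @: (N x * fullv) = N x * crn x v)%VS.
Proof.
apply/eqP; rewrite eqEsubv; apply/andP; split.
  suff : (N x * fullv <= blk x v @^-1: (N x * crn x v))%VS.
    move=> /subvP sub; apply/subvP => _ /memv_imgP[y /sub yN ->].
    by rewrite memv_preim.
  apply/prodvP => n a Nn _; rewrite -memv_preim blkE.
  rewrite -[n](crnr (subvP (radical_crn x) _ Nn)).
  rewrite !mulrA (crnl (subvP (radical_crn x) _ Nn)) -!mulrA.
  by rewrite memv_mul // mulrA mem_crn.
apply/prodvP => n c Nn cC; apply/memv_imgP; exists (n * c); first by rewrite memv_mul ?memvf.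
by rewrite blkE mulrA (crnl (subvP (radical_crn x) _ Nn)) -mulrA (crnr cC).
Qed.

Lemma rad_rankE S x v :
  rad_rank S x v = (\dim (crn x v) - \dim (blk x v @: idl S + N x * crn x v))%N.
Proof. by rewrite /rad_rank limgD blk_rad. Qed.

Lemma radC_sub x v : (N x * crn x v <= crn x v)%VS.
Proof.
apply/prodvP => n c /(subvP (radical_crn x)) nC cC; exact: crn_mul nC cC.
Qed.

Lemma span_crn_sub x v (ys : seq A) : {subset ys <= crn x v} ->
  (<<ys>> <= \sum_(y <- ys) crn x x * <[y]>)%VS.
Proof.
move=> sub; apply/span_subvP => y yys; rewrite -(crnl (sub y yys)).
by rewrite sum_line_mem ?crn_id.
Qed.

Lemma sum_line_mull x w v (ys : seq A) a z : a \in crn w x ->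
  z \in (\sum_(y <- ys) crn x v * <[y]>)%VS -> a * z \in (\sum_(y <- ys) crn w v * <[y]>)%VS.
Proof.
move=> aC zS; set Z := (\sum_(y <- ys) crn w v * _)%VS.
suff : z \in (amull a @^-1: Z)%VS by rewrite -memv_preim lfunE.
apply: subvP z zS; apply: sum_line_sub => y c yys cC; rewrite -memv_preim lfunE /= mulrA.
exact: sum_line_mem yys (crn_mul aC cC).
Qed.

(* Lifts of a basis of the top of e_x B e_v, B = A / idl S, generate it over A_x. *)
Lemma top_generators S x v : exists ys : seq A,
  [/\ size ys = rad_rank S x v, {subset ys <= crn x v} &
      (crn x v <= \sum_(y <- ys) crn x x * <[y]> + blk x v @: idl S)%VS].
Proof.
set K := (blk x v @: idl S + N x * crn x v)%VS.
have KC : (K <= crn x v)%VS by rewrite subv_add blk_idl_sub radC_sub.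
exists (vbasis (crn x v :\: K)).
have dE : \dim (crn x v :\: K) = rad_rank S x v.
  by rewrite rad_rankE -(dimv_cap_compl (crn x v) K) (capv_idPr KC) addKn.
split; first by rewrite size_tuple.
  by move=> y /vbasis_mem; apply: (subvP (diffvSl _ _)).
set Z := (\sum_(y <- _) _ + _)%VS.
have sZ : (<<vbasis (crn x v :\: K)>> <= Z)%VS.
  apply: subv_trans (addvSl _ _); apply: span_crn_sub => y /vbasis_mem.
  exact: (subvP (diffvSl _ _)).
apply: (@nakayama x).
  rewrite -{1}(addv_diff_cap (crn x v) K) (capv_idPr KC) subv_add.
  rewrite -{1}(span_basis (vbasisP (crn x v :\: K))).
  rewrite (subv_trans sZ) ?addvSl //= subv_add addvSr andbT.
  by apply: subv_trans (addvSl _ _); apply: addvSr.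
rewrite prodvDr addvS //.
  by apply/prodvP => n z /(subvP (radical_crn x)) nC; apply: sum_line_mull.
apply/prodvP => n y Nn; rewrite !mem_blk_idl => /andP[yI yC].
by rewrite idl_mull //= (crn_mul (subvP (radical_crn x) _ Nn) yC).
Qed.

(** Modulo [idl S], the new part is [e_w A e_x] times lifts of a basis of the top of [e_x A e_v].
    Right multiplication by one lift sends [e_w (idl S) e_x] into [idl S], so each lift adds at most
    [quot_dim S w x]. *)
Lemma dim_idl_step S x w v :
  (\dim (blk w v @: idl (x |: S)) <=
   \dim (blk w v @: idl S) + rad_rank S x v * quot_dim S w x)%N.
Proof.
have [ys [<- ysC Cys]] := top_generators S x v.
have sub : (blk w v @: idl (x |: S) <=
            \sum_(y <- ys) crn w x * <[y]> + blk w v @: idl S)%VS.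
  apply: blk_idl_ind => z a b; rewrite !inE => /orP[/eqP->|zS] aC bC; last first.
    rewrite (subvP (addvSr _ _)) // mem_blk_idl (crn_mul aC bC) andbT.
    by rewrite idl_mull // (crn_idl zS bC).
  have /memv_addP[u uS [i iI ->]] := subvP Cys _ bC.
  rewrite mulrDr memv_add //; last first.
    move: iI; rewrite !mem_blk_idl => /andP[iS iC].
    by rewrite idl_mull //= (crn_mul aC iC).
  exact: sum_line_mull uS.
apply: leq_trans (dimvS sub) _ => {sub Cys}.
elim: ys ysC => [|y ys IH] ysC; first by rewrite big_nil add0v mul0n addn0.
rewrite big_cons -addvA -limg_amulr mulSn addnCA addnC.
have I0 : (amulr y @: (blk w x @: idl S) <=
           \sum_(y <- ys) crn w x * <[y]> + blk w v @: idl S)%VS.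
  apply: subv_trans (addvSr _ _); apply/subvP => _ /memv_imgP[z zM ->].
  move: zM; rewrite !mem_blk_idl => /andP[zI zC]; rewrite lfunE /= idl_mulr //=.
  by rewrite (crn_mul zC) // ysC ?mem_head.
apply: leq_trans (dim_img_add (blk_idl_sub _ _ _) I0) _.
by rewrite leq_add2r IH // => z zys; rewrite ysC // inE zys orbT.
Qed.

(** Sums [dim_idl_step] along the chain of ideals [idl (above key m)], which is zero from the bound
    [M] on. *)
Lemma dim_idl_above (key : L -> nat) (ik : injective key) m w v :
  (\dim (blk w v @: idl (above key m)) <=
   \sum_(x | (m <= key x)%N) rad_rank (above key (key x).+1) x v *
                             quot_dim (above key (key x).+1) w x)%N.
Proof.
have [M [M0 keyM]] := above_bound key.
have [n] : exists n, (M <= m + n)%N by exists M; rewrite leq_addl.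
elim: n m => [|n IH] m Mm.
  have -> : above key m = set0.
    by apply/setP => x; rewrite !inE leqNgt (leq_trans (keyM x)) // -[m]addn0.
  by rewrite idl0 limg0 dimv0.
have {}IH := IH m.+1; rewrite addSnnS in IH.
have [[-> lt]|[x [kx -> lt]]] := above_step m ik.
  by under eq_bigl do rewrite lt; apply: IH.
apply: leq_trans (dim_idl_step _ _ _ _) _.
rewrite (bigD1 x) ?kx //= addnC leq_add2l (eq_bigl _ _ lt); exact: IH.
Qed.

(* The reverse inequality holds for every order, see [dim_idl_above]. *)
Definition stratified_dims (key : L -> nat) : Prop :=
  (\sum_w \sum_v \sum_x rad_rank (above key (key x).+1) x v *
     quot_dim (above key (key x).+1) w x <= \dim {:A})%N.

(** Each corner is bounded by [dim_idl_above]; the bound assumed on the total leaves no slack in any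
    of them. *)
Lemma stratified_dim_crn (key : L -> nat) (ik : injective key) :
  stratified_dims key -> forall w v, \dim (crn w v) =
   (\sum_x rad_rank (above key (key x).+1) x v *
           quot_dim (above key (key x).+1) w x)%N.
Proof.
move=> sd w v.
have le w' v' : (\dim (crn w' v') <=
    \sum_x rad_rank (above key (key x).+1) x v' * quot_dim (above key (key x).+1) w' x)%N.
  have := dim_idl_above ik 0 w' v'.
  have -> : above key 0 = setT by apply/setP => x; rewrite !inE.
  by rewrite idl_full.
apply: (@sum_leq_eq (L * L)%type (fun i => \dim (crn i.1 i.2))
  (fun i => \sum_x rad_rank (above key (key x).+1) x i.2 *
     quot_dim (above key (key x).+1) i.1 x)%N _ _ (w, v)) => [i|]; first exact: le.
move: sd; rewrite /stratified_dims (dim_blk bistablef).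
by rewrite [X in (X <= _)%N]pair_big [X in (_ <= X)%N]pair_big.
Qed.

End Peirce.

(** * Consequences of stratification for all orders *)

(** Refines the coarse order given by [c] to a linear one; special orders are prescribed through
    [c]. *)
Definition lex_key (L : finType) (c : L -> nat) (x : L) : nat := (c x * #|L| + enum_rank x)%N.

Lemma lex_key_inj (L : finType) (c : L -> nat) : injective (lex_key c).
Proof.
move=> x y /(congr1 (modn^~ #|L|)); rewrite !modnMDl !modn_small //.
by move=> /ord_inj/enum_rank_inj.
Qed.

Lemma lex_key_lt (L : finType) (c : L -> nat) x y :
  (c x < c y)%N -> (lex_key c x < lex_key c y)%N.
Proof.
move=> xy; apply: (@leq_trans (c x * #|L| + #|L|)%N); first by rewrite ltn_add2l ltn_ord.
by rewrite addnC -mulSn (leq_trans _ (leq_addr _ _)) // leq_mul2r xy orbT.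
Qed.

Section StratifiedForAllOrders.
Variables (k : fieldType) (A : falgType k) (L : finType) (e : L -> A).
Variables (N : L -> {vspace A}) (h : L -> nat) (Hp : peirce e N h).

(** The minimal number of generators of [e_w A e_v] over [A_w], as the dimension of its top. *)
Definition rank w v := (\dim (crn e w v) - \dim (N w * crn e w v))%N.
(** For [w != u] this is [e_w J^2 e_u] (see [decomposable_pow] and [decomposable_sub]), so [irr_dim]
    and [irr_rank] measure the bimodule [e_w (J / J^2) e_u]. *)
Definition decomposable w u := (blk e w u @: idl e (~: [set w; u]))%VS.
Definition irr_dim w u := (\dim (crn e w u) - \dim (decomposable w u))%N.
Definition irr_rank w u :=
  (\dim (crn e w u) - \dim (decomposable w u + N w * crn e w u))%N.

Lemma rad_rank0 S x v : (blk e x v @: idl e S)%VS = 0%VS -> rad_rank e N S x v = rank x v.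
Proof. by move=> S0; rewrite (rad_rankE Hp) S0 add0v. Qed.

Lemma quot_dim_mem (S : {set L}) w x : (w \in S) || (x \in S) -> quot_dim e S w x = 0%N.
Proof.
by move=> /orP[] wS; rewrite /quot_dim ?(blk_idl_l Hp _ wS) ?(blk_idl_r Hp _ wS) subnn.
Qed.

Lemma rad_rank_mem (S : {set L}) x v : (x \in S) || (v \in S) -> rad_rank e N S x v = 0%N.
Proof.
move=> xvS; rewrite (rad_rankE Hp).
have -> : (blk e x v @: idl e S = crn e x v)%VS.
  by case/orP: xvS => wS; rewrite ?(blk_idl_l Hp _ wS) ?(blk_idl_r Hp _ wS).
by rewrite (addv_idPl (radC_sub Hp x v)) subnn.
Qed.

Lemma blk_idl_height (S : {set L}) w v :
  (forall x, x \in S -> [\/ x != w /\ (h w <= h x)%N | x != v /\ (h x <= h v)%N]) ->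
  (blk e w v @: idl e S)%VS = 0%VS.
Proof.
move=> SH; apply/eqP; rewrite -subv0; apply: (blk_idl_ind Hp) => x a b xS aC bC.
case: (SH x xS) => [[xw wx]|[xv vx]].
  move: aC; rewrite (crn_eq0 Hp _ wx) 1?eq_sym // memv0 => /eqP->.
  by rewrite mul0r mem0v.
by move: bC; rewrite (crn_eq0 Hp xv vx) memv0 => /eqP->; rewrite mulr0 mem0v.
Qed.

Lemma blk_idl_diag (S : {set L}) w : w \notin S -> (blk e w w @: idl e S)%VS = 0%VS.
Proof.
move=> wS; apply: blk_idl_height => x xS.
have xw : x != w by apply: contraNneq wS => <-.
by case: (leqP (h w) (h x)) => [|/ltnW]; [left|right].
Qed.

Lemma quot_dim_diag (S : {set L}) w : w \notin S -> quot_dim e S w w = \dim (crn e w w).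
Proof. by move=> wS; rewrite /quot_dim (blk_idl_diag wS) dimv0 subn0. Qed.

Hypothesis sdA : forall key : L -> nat, injective key -> stratified_dims e N key.

(** With [w] largest, [w] lies above every other [x], so [e_w Delta_x = 0]; nothing lies above [w],
    so the remaining term involves no ideal. *)
Lemma dim_crn_rank w v : \dim (crn e w v) = (rank w v * \dim (crn e w w))%N.
Proof.
pose key := lex_key (fun x => x == w); have ik : injective key by apply: lex_key_inj.
have lek x : x != w -> (key x < key w)%N.
  by move=> xw; apply: lex_key_lt; rewrite eqxx (negPf xw).
have keyw : above key (key w).+1 = set0.
  apply/setP => x; rewrite !inE; have [->|/lek xw] := eqVneq x w; first by rewrite ltnn.
  by rewrite ltnNge ltnW.
rewrite (stratified_dim_crn Hp ik (sdA ik)) (bigD1 w) //= big1 ?addn0.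
  by rewrite keyw rad_rank0 ?idl0 ?limg0 // quot_dim_diag ?inE.
by move=> x /lek xw; rewrite quot_dim_mem ?muln0 // inE xw.
Qed.

(** With [u] and then [w] least, the vertices above [w] are those outside [{w, u}]. The term [x = w]
    is the left side, and the terms above [w] already dominate [dim (decomposable w u)]. *)
Lemma irr_dim_rank w u : w != u -> (irr_rank w u * \dim (crn e w w) <= irr_dim w u)%N.
Proof.
move=> wu.
pose key := lex_key (fun x => if x == u then 0 else if x == w then 1 else 2)%N.
have ik : injective key by apply: lex_key_inj.
have keyw x : (key w < key x)%N = (x != w) && (x != u).
  have [->|xw] := eqVneq x w; first by rewrite ltnn.
  have [->|xu] := eqVneq x u.
    by apply/negbTE; rewrite -leqNgt ltnW //; apply: lex_key_lt; rewrite !eqxx (negPf wu).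
  by apply: lex_key_lt; rewrite (negPf wu) eqxx (negPf xw) (negPf xu).
have E : above key (key w).+1 = ~: [set w; u].
  by apply/setP => x; rewrite !inE keyw negb_or.
rewrite /irr_dim leq_subRL; last exact/dimvS/(blk_idl_sub e).
rewrite [leqRHS](stratified_dim_crn Hp ik (sdA ik)) (bigD1 w) //= addnC leq_add //.
  by rewrite E (rad_rankE Hp) quot_dim_diag ?inE ?eqxx.
rewrite /decomposable -E; apply: leq_trans (dim_idl_above Hp ik _ _ _) _.
rewrite [leqRHS](bigID (fun x => x == u)) /= [X in (_ <= _ + X)%N](eq_bigl (fun x => (key w < key x)%N)).
  exact: leq_addl.
by move=> x; rewrite keyw.
Qed.

(** The order is by height with [w] moved to the bottom. Morphisms from [v] to [u] through a vertex
    above [u] vanish, which gives [rank u v]; morphisms from [u] to [w] through a third vertex not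
    above [u] vanish, which gives [irr_dim w u]. *)
Lemma dim_crn_irr w v : w != v ->
  (\sum_(u | u != w) rank u v * irr_dim w u = \dim (crn e w v))%N.
Proof.
move=> wv; pose key := lex_key (fun x => if x == w then 0 else (h x).+1)%N.
have ik : injective key by apply: lex_key_inj.
have lekey x y : (h x < h y)%N -> y != w -> (key x < key y)%N.
  by move=> xy /negPf yw; apply: lex_key_lt; rewrite yw; case: eqP.
have keyw x : x != w -> (key w < key x)%N.
  by move=> /negPf xw; apply: lex_key_lt; rewrite eqxx xw.
have keywF x : (key x < key w)%N = false.
  by have [->|/keyw xw] := eqVneq x w; rewrite ?ltnn // ltnNge ltnW.
have hkey x y : y != w -> (key x < key y)%N -> (h x <= h y)%N \/ x = w.
  move=> yw xy; have [->|xw] := eqVneq x w; [by right | left].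
  by rewrite leqNgt; apply: contraL xy => /lekey/(_ xw) yx; rewrite -leqNgt ltnW.
rewrite [RHS](stratified_dim_crn Hp ik (sdA ik)) [RHS](bigD1 w) //=.
(* The term [x = w] vanishes because [v] lies above [w]. *)
rewrite rad_rank_mem ?mul0n ?add0n; last first.
  by rewrite !inE (keyw v) ?orbT // eq_sym.
apply: eq_bigr => u uw; congr (_ * _)%N.
  rewrite rad_rank0 //; apply: blk_idl_height => y; rewrite inE => uy; left; split.
    by apply: contraTneq uy => ->; rewrite ltnn.
  have yw : y != w by apply: contraTneq uy => ->; rewrite keywF.
  by case: (hkey _ _ yw uy) => // uw'; rewrite uw' eqxx in uw.
rewrite /irr_dim /quot_dim /decomposable; congr (_ - \dim _)%N.
apply/eqP; rewrite eqEsubv; apply/andP; split; last first.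
  apply/limgS/idlS/subsetP => x; rewrite !inE => ux.
  rewrite negb_or; apply/andP; split; apply: contraTneq ux => ->; rewrite ?ltnn //.
  by rewrite keywF.
apply: (blk_idl_ind Hp) => x a b; rewrite !inE negb_or => /andP[xw xu] aC bC.
case: (ltngtP (key u) (key x)) => [ux|xux|/ik ux]; last by rewrite ux eqxx in xu.
  rewrite (mem_blk_idl Hp) (crn_mul Hp aC bC) andbT.
  by rewrite idl_mull // (crn_idl Hp _ bC) // inE.
have [hxu|xw'] := hkey _ _ uw xux; last by rewrite xw' eqxx in xw.
by move: bC; rewrite (crn_eq0 Hp xu hxu) memv0 => /eqP->; rewrite mulr0 mem0v.
Qed.

End StratifiedForAllOrders.

(** * Counting paths *)

Section PathCount.
Variables (L : finType) (h : L -> nat) (r : L -> L -> nat).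

(* P w v is the number of paths from v to w avoiding S, if there are r w u arrows
   from u to w. *)
Definition path_count (S : {set L}) (P : L -> L -> nat) := forall w v, P w v =
  if (w \in S) || (v \in S) then 0%N else if w == v then 1%N else
  (\sum_(u | (h u < h w)%N) r w u * P u v)%N.

Lemma path_count_exists : exists P : {set L} -> L -> L -> nat, forall S, path_count S (P S).
Proof.
have [] := @height_recursion L ({set L} -> L -> nat) h (fun f w S v =>
  if (w \in S) || (v \in S) then 0%N else if w == v then 1%N else
  (\sum_(u | (h u < h w)%N) r w u * f u S v)%N) _ (fun _ _ _ => 0%N).
  move=> w f g fg; apply: functional_extensionality_dep => S.
  apply: functional_extensionality_dep => v.
  by under eq_bigr => u uw do rewrite fg //.
by move=> f fE; exists (fun S w v => f w S v) => S w v; rewrite fE.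
Qed.

Lemma path_count_height (S : {set L}) P y z : path_count S P ->
  y != z -> (h y <= h z)%N -> P y z = 0%N.
Proof.
move=> PE; have [m] := ubnP (h y); elim: m y => // m IHm y ym yz hyz.
rewrite PE (negPf yz); case: ifP => // _; apply: big1 => u uy.
rewrite IHm ?muln0 //; first exact: leq_trans uy _.
  by apply: contraTneq uy => ->; rewrite -leqNgt.
exact: leq_trans (ltnW uy) hyz.
Qed.

(* Directedness makes a path meet x at most once. *)
Lemma path_count_split (S : {set L}) x (P P' : L -> L -> nat) : x \notin S -> path_count S P -> path_count (x |: S) P' ->
  forall w v, P w v = (P' w v + P w x * P x v)%N.
Proof.
move=> xS PE P'E w v; have [n] := ubnP (h w); elim: n w => // n IH w wn.
have Pxx : P x x = 1%N by rewrite PE orbb (negPf xS) eqxx.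
have [->|wx] := eqVneq w x.
  by rewrite P'E !inE eqxx /= add0n Pxx mul1n.
have [->|vx] := eqVneq v x.
  by rewrite P'E !inE eqxx orbT add0n Pxx muln1.
rewrite PE P'E !inE (negPf wx) (negPf vx) /=.
have [wS|wS] /= := boolP (w \in S); first by rewrite PE wS.
have [vS|vS] /= := boolP (v \in S); first by rewrite [P x v]PE vS orbT muln0.
have [<-|wv] := eqVneq w v.
  case: (leqP (h w) (h x)) => [wx'|/ltnW xw].
    by rewrite (path_count_height PE wx wx') mul0n.
  by rewrite (path_count_height PE _ xw) ?muln0 // eq_sym.
rewrite [in P w x]PE (negPf wS) (negPf xS) (negPf wx) /= big_distrl -big_split /=.
apply: eq_bigr => u uw; rewrite -mulnA -mulnDr; congr (_ * _)%N.
by apply: IH; apply: leq_trans uw _.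
Qed.

(** [E m] concerns the paths avoiding all vertices of key at least [m]. Raising [m] past [key x]
    admits the paths through [x], and [path_count_split] factors them at [x], their largest
    vertex. *)
Lemma path_count_above (key : L -> nat) (ik : injective key) (P : {set L} -> L -> L -> nat) :
  (forall S, path_count S (P S)) -> forall w v, P set0 w v =
  (\sum_x P (above key (key x).+1) w x * P (above key (key x).+1) x v)%N.
Proof.
move=> PE w v.
have [M [M0 keyM]] := above_bound key.
have E m : P (above key m) w v =
    (\sum_(x | (key x < m)%N) P (above key (key x).+1) w x * P (above key (key x).+1) x v)%N.
  elim: m => [|m IH].
    rewrite big_pred0 // PE; have -> : above key 0 = setT by apply/setP => x; rewrite !inE.
    by rewrite inE.
  have [[<- lt]|[x [kx aE lt]]] := above_step m ik.
    by rewrite IH; apply: eq_bigl => y; rewrite ltnS [in LHS]ltnNge lt -leqNgt.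
  rewrite [RHS](bigD1 x) ?kx //= addnC.
  have xN : x \notin above key m.+1 by rewrite inE kx ltnn.
  have PX : path_count (x |: above key m.+1) (P (above key m)) by rewrite -aE.
  rewrite (path_count_split xN (PE _) PX) IH; congr (_ + _)%N; apply: eq_bigl => y.
  rewrite ltnS [in RHS]leq_eqVlt -kx (inj_eq ik).
  by case: eqVneq => [->|_] /=; rewrite ?ltnn ?andbT.
by have := E M; rewrite M0 => ->; apply: eq_bigl => x; rewrite keyM.
Qed.

End PathCount.

Lemma path_count_row (L : finType) (h : L -> nat) (r : L -> L -> nat) P :
  path_count h r set0 P -> forall w v,
  P w v = ((w == v) + \sum_u (if h u < h w then r w u else 0) * P u v)%N.
Proof.
move=> PE w v; rewrite PE !inE /=; have [<-|wv] := eqVneq w v.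
  rewrite big1 // => u _; case: ifP => // uw.
  rewrite (path_count_height PE _ (ltnW uw)) ?muln0 //.
  by apply: contraTneq uw => ->; rewrite ltnn.
by rewrite big_mkcond; apply: eq_bigr => u _; case: ifP.
Qed.

(** As matrices, [P = 1 + s P], and the transpose [Q] of [P'] satisfies [Q = 1 + Q s]. Expanding
    [Q P] by either equation leaves the same remainder [T], so [Q = P]. This compares extending
    paths at the source with extending them at the target. *)
Lemma path_count_transpose (L : finType) (h h' : L -> nat) (r r' : L -> L -> nat) P P' :
  (forall u w, (h' u < h' w)%N = (h w < h u)%N) -> (forall w u, r' w u = r u w) ->
  path_count h r set0 P -> path_count h' r' set0 P' -> forall w v, P' w v = P v w.
Proof.
move=> hh' rr' /path_count_row PE /path_count_row P'E v w.
pose s x y := if (h y < h x)%N then r x y else 0%N.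
have QE x y : P' y x = ((x == y) + \sum_u P' u x * s u y)%N.
  rewrite P'E eq_sym; congr (_ + _)%N; apply: eq_bigr => u _.
  by rewrite hh' rr' mulnC.
pose T := (\sum_u \sum_x P' u w * s u x * P x v)%N.
have E1 : (\sum_u P' u w * P u v = P' v w + T)%N.
  rewrite /T; under eq_bigr => u _ do rewrite PE mulnDr big_distrr.
  rewrite big_split /= (bigD1 v) //= eqxx muln1 big1 ?addn0 => [|u /negPf->]; last first.
    by rewrite muln0.
  by congr (_ + _)%N; apply: eq_bigr => u _; apply: eq_bigr => x _; rewrite mulnA.
have E2 : (\sum_u P' u w * P u v = P w v + T)%N.
  rewrite /T exchange_big; under eq_bigr => u _ do rewrite QE mulnDl big_distrl.
  rewrite big_split /= (bigD1 w) //= eqxx mul1n big1 ?addn0 // => u.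
  by rewrite eq_sym => /negPf->.
by apply/eqP; rewrite -(eqn_add2r T) -E1 E2.
Qed.

(** * Words in generators of the morphism spaces *)

Section Generators.
Variables (k : fieldType) (A : falgType k) (L : finType) (e : L -> A).
Variables (N : L -> {vspace A}) (h : L -> nat) (Hp : peirce e N h).
Variable X : L -> L -> seq A.
Hypothesis XC : forall w u, (h u < h w)%N -> {subset X w u <= crn e w u}.
Hypothesis Xgen : forall w u, (h u < h w)%N ->
  (crn e w u <= decomposable e w u + \sum_(m <- X w u) crn e w w * <[m]>)%VS.

Variables (S : {set L}) (v : L).

(** The recursion of [path_count] with products of generators in place of numbers, so that the lists
    have the lengths predicted by path counts. *)
Definition word_step (f : L -> seq A) (w : L) : seq A :=
  if (w \in S) || (v \in S) then [::] else if w == v then [:: e v] else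
  flatten [seq [seq m * g | m <- X w u, g <- f u] | u <- enum [pred u | (h u < h w)%N]].

Variable f : L -> seq A.
Hypothesis fE : forall w, f w = word_step f w.

Lemma word_crn w : {subset f w <= crn e w v}.
Proof.
have [n] := ubnP (h w); elim: n w => // n IH w wn x.
rewrite fE /word_step; case: ifP => // _; case: eqP => [->|_].
  by rewrite inE => /eqP->; apply: (crn_id Hp).
move=> /flatten_mapP[u]; rewrite mem_enum inE => uw /allpairsP[[m g] /= [mX gf ->]].
apply: (crn_mul Hp (XC uw mX)); apply: IH gf; exact: leq_trans uw _.
Qed.

Lemma size_word P : path_count h (fun w u => size (X w u)) S P ->
  forall w, size (f w) = P w v.
Proof.
move=> PE w; have [n] := ubnP (h w); elim: n w => // n IH w wn.
rewrite fE PE /word_step; case: ifP => // _; case: eqP => // _.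
rewrite size_flatten /shape -map_comp sumnE big_map big_enum /=.
apply: eq_bigr => u uw; rewrite size_allpairs IH //.
exact: leq_trans uw _.
Qed.

Let Y w := (\sum_(g <- f w) crn e w w * <[g]> + blk e w v @: idl e S)%VS.

Lemma word_span_crn w : (Y w <= crn e w v)%VS.
Proof.
rewrite subv_add blk_idl_sub andbT; apply: sum_line_sub => g c gf cC.
exact: (crn_mul Hp) cC (word_crn gf).
Qed.

(** Induction on the height difference. Modulo decomposables [a c] is a combination of generators,
    and a generator times a word is a word; a decomposable [a1 a2] passes through an intermediate
    height, so its two factors act in turn by induction. *)
Lemma word_span_mul w u a y : a \in crn e w u -> y \in Y u -> a * y \in Y w.
Proof.
have [n] := ubnP (h w - h u); elim: n w u a y => // n IH w u a y wun aC yY.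
have ayC := crn_mul Hp aC (subvP (word_span_crn u) _ yY).
have full : (w \in S) || (v \in S) -> (blk e w v @: idl e S = crn e w v)%VS.
  by case/orP=> wS; rewrite ?(blk_idl_l Hp _ wS) ?(blk_idl_r Hp _ wS).
have [wvS|wvS] := boolP ((w \in S) || (v \in S)).
  by rewrite (subvP (addvSr _ _)) // full.
have [wu|wu] := eqVneq w u.
  move: wu aC yY => <- aC {wun ayC u full wvS}; rewrite /Y.
  move=> /memv_addP[z zS [i iI ->]]; rewrite mulrDr memv_add //; last first.
    by move: iI; rewrite !(mem_blk_idl Hp) => /andP[iS iC]; rewrite idl_mull //= (crn_mul Hp aC iC).
  exact: (sum_line_mull Hp) aC zS.
have [->|a0] := eqVneq a 0; first by rewrite mul0r mem0v.
have uw : (h u < h w)%N by case: (crn_height Hp aC a0) => // /eqP; rewrite (negPf wu).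
have [wv|wv] := eqVneq w v.
  have := subvP (word_span_crn u) _ yY; rewrite -wv => yC.
  by rewrite (crn_through Hp wu aC yC) mem0v.
have {}yY : y \in (amull a @^-1: Y w)%VS; last by rewrite -memv_preim lfunE in yY.
move: y yY {ayC}; apply/subvP; rewrite subv_add; apply/andP; split; last first.
  apply/subvP => i; rewrite (mem_blk_idl Hp) => /andP[iS iC]; rewrite -memv_preim lfunE /=.
  by rewrite (subvP (addvSr _ _)) // (mem_blk_idl Hp) idl_mull // (crn_mul Hp aC iC).
apply: sum_line_sub => g c gf cC; rewrite -memv_preim lfunE /= mulrA.
have gY : g \in Y u.
  rewrite (subvP (addvSl _ _)) // -(crnl Hp (word_crn gf)).
  by apply: sum_line_mem => //; apply: (crn_id Hp).
have : a * c \in (amulr g @^-1: Y w)%VS; last by rewrite -memv_preim lfunE.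
apply: subvP (a * c) (crn_mul Hp aC cC); apply: subv_trans (Xgen uw) _.
rewrite subv_add; apply/andP; split; last first.
  apply: sum_line_sub => m d mX dC; rewrite -memv_preim lfunE /= -mulrA.
  rewrite (subvP (addvSl _ _)) //; apply: sum_line_mem => //.
  rewrite fE /word_step (negPf wvS) (negPf wv); apply/flatten_mapP; exists u.
    by rewrite mem_enum inE.
  by apply/allpairsP; exists (m, g).
apply: (blk_idl_ind Hp) => x a1 a2; rewrite !inE negb_or => /andP[xw xu] a1C a2C.
rewrite -memv_preim lfunE /= -mulrA.
have [->|a10] := eqVneq a1 0; first by rewrite mul0r mem0v.
have [->|a20] := eqVneq a2 0; first by rewrite mul0r mulr0 mem0v.
have xwh : (h x < h w)%N.
  by case: (crn_height Hp a1C a10) => // /eqP; rewrite eq_sym (negPf xw).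
have uxh : (h u < h x)%N.
  by case: (crn_height Hp a2C a20) => // /eqP; rewrite (negPf xu).
apply: (IH w x) => //; last apply: (IH x u) => //.
  by rewrite -ltnS; apply: leq_trans wun; rewrite ltnS ltn_sub2l.
by rewrite -ltnS; apply: leq_trans wun; rewrite ltnS ltn_sub2r.
Qed.

Lemma crn_word_span w : (crn e w v <= Y w)%VS.
Proof.
have [vS|vS] := boolP (v \in S).
  by rewrite /Y (blk_idl_r Hp _ vS) addvSr.
apply/subvP => x xC; rewrite -(crnr Hp xC); apply: word_span_mul xC _.
rewrite (subvP (addvSl _ _)) // fE /word_step (negPf vS) eqxx big_seq1.
by rewrite -{1}(pe_idem Hp v) memv_mul ?memv_line ?(crn_id Hp).
Qed.

End Generators.

(** * Path counts as bounds for the stratification dimensions *)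

Section FreeDimensions.
Variables (k : fieldType) (A : falgType k) (L : finType) (e : L -> A).
Variables (N : L -> {vspace A}) (h : L -> nat) (Hp : peirce e N h).
Variable X : L -> L -> seq A.
Hypothesis XC : forall w u, (h u < h w)%N -> {subset X w u <= crn e w u}.
Hypothesis Xgen : forall w u, (h u < h w)%N ->
  (crn e w u <= decomposable e w u + \sum_(m <- X w u) crn e w w * <[m]>)%VS.

Lemma word_generators S v P : path_count h (fun w u => size (X w u)) S P ->
  exists f : L -> seq A, forall w, [/\ size (f w) = P w v, {subset f w <= crn e w v} &
    (crn e w v <= \sum_(g <- f w) crn e w w * <[g]> + blk e w v @: idl e S)%VS].
Proof.
move=> PE; have [] := @height_recursion L (seq A) h (word_step e h X S v) _ (fun=> [::]).
  move=> w f g fg; rewrite /word_step; case: ifP => // _; case: ifP => // _.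
  congr flatten; apply/eq_in_map => u; rewrite mem_enum inE => uw.
  by rewrite fg.
move=> f fE; exists f => w; split.
- exact: (size_word fE PE).
- by move=> g; apply: (word_crn Hp XC fE).
exact: (crn_word_span Hp XC Xgen fE w).
Qed.

Lemma quot_dim_paths S P : path_count h (fun w u => size (X w u)) S P ->
  forall w x, (quot_dim e S w x <= P w x * \dim (crn e w w))%N.
Proof.
move=> PE w x; have [f /(_ w)[fP _ fs]] := word_generators x PE.
rewrite /quot_dim leq_subLR addnC; apply: leq_trans (dimvS fs) _.
apply: leq_trans (dimv_add_leqif _ _).1 _; rewrite leq_add2r -fP.
exact: dim_sum_line.
Qed.

Lemma rad_rank_paths S P : path_count h (fun w u => size (X w u)) S P ->
  forall x v, (rad_rank e N S x v <= P x v)%N.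
Proof.
move=> PE x v; have [f /(_ x)[fP fC fs]] := word_generators v PE.
rewrite (rad_rankE Hp) leq_subLR addnC -fP.
apply: leq_trans (leq_add (dim_span (f x)) (leqnn _)).
apply: leq_trans (dimv_add_leqif _ _).1; apply: dimvS; apply: subv_trans fs _.
rewrite subv_add; apply/andP; split; last first.
  by apply: subv_trans (addvSr _ _); apply: addvSl.
apply: sum_line_sub => g c gf cC; have gC := fC g gf.
(* The coefficient [c] is a scalar modulo [N x], so the words span the top over [k]. *)
have [a] := pe_split Hp x c; rewrite (crnP Hp _ _ _ cC) => cN.
rewrite -[c](subrK (a *: e x)) addrC mulrDl -scalerAl (crnl Hp gC) memv_add //.
  by rewrite memvZ // memv_span.
by rewrite (subvP (addvSr _ _)) // memv_mul.
Qed.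

(** Words bound both factors of each term by path counts, and [path_count_above] sums these to
    [P set0 w v * dim A_w]; by hypothesis the morphism spaces are at least that large. *)
Lemma free_stratified :
  (forall P, path_count h (fun w u => size (X w u)) set0 P ->
     forall w v, (P w v * \dim (crn e w w) <= \dim (crn e w v))%N) ->
  forall key : L -> nat, injective key -> stratified_dims e N key.
Proof.
move=> le key ik; have [P PE] := path_count_exists h (fun w u => size (X w u)).
rewrite /stratified_dims (dim_blk Hp (bistablef e)).
apply: leq_sum => w _; apply: leq_sum => v _; apply: leq_trans (le _ (PE set0) w v).
rewrite (path_count_above ik PE) big_distrl /=; apply: leq_sum => x _.
rewrite mulnAC mulnC leq_mul //; last exact: (rad_rank_paths (PE _)).
exact: (quot_dim_paths (PE _)).
Qed.

End FreeDimensions.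

(** * Modules over an algebra with idempotents *)

HB.instance Definition _ (k : fieldType) (R : falgType k) (M : fmodule R) (a : R) :=
  GRing.isLinear.Build k M M _ (act a) (@act_linr k R M a).

Section CyclicModules.
Variables (k : fieldType) (R : falgType k).
Implicit Types M : fmodule R.

Lemma act0l M (x : M) : act 0 x = 0.
Proof. by have := act_linl x (-1) 0 0; rewrite scaler0 addr0 scaleN1r addNr. Qed.
Lemma actDl M a b (x : M) : act (a + b) x = act a x + act b x.
Proof. by have := act_linl x 1 a b; rewrite !scale1r. Qed.
Lemma actZl M c a (x : M) : act (c *: a) x = c *: act a x.
Proof. by have := act_linl x c a 0; rewrite act0l !addr0. Qed.
Lemma actBl M a b (x : M) : act (a - b) x = act a x - act b x.
Proof. by rewrite actDl -scaleN1r actZl scaleN1r. Qed.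
Lemma act_suml M (I : Type) (r : seq I) (F : I -> R) (x : M) :
  act (\sum_(i <- r) F i) x = \sum_(i <- r) act (F i) x.
Proof. by elim/big_rec2: _ => [|i y z _ <-]; rewrite ?act0l ?actDl. Qed.

Lemma mod_iso_sym M M' : mod_iso M M' -> mod_iso M' M.
Proof.
case=> f [[fl fa] [g fK gK]]; exists g; split; last by exists f.
split=> [c x y|a x]; apply: (can_inj fK); last by rewrite fa !gK.
by rewrite fl !gK.
Qed.

(* For an idempotent u and V in R u: M is isomorphic to R u / V. *)
Definition cyclic_mod M (u : R) (V : {vspace R}) := exists z : M,
  [/\ forall m, exists a, m = act a z, act u z = z &
      forall a, act a z = 0 <-> a * u \in V].

Lemma cyclic_mod_iso M M' u V : mod_iso M M' -> cyclic_mod M' u V -> cyclic_mod M u V.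
Proof.
move=> /mod_iso_sym[f [[fl fa] [g fK gK]]] [z [zg uz zV]]; exists (f z); split.
- by move=> m; have [a ga] := zg (g m); exists a; rewrite -fa -ga gK.
- by rewrite -fa uz.
move=> a; rewrite -zV -fa; split=> [fz0|->]; last exact: linear_at0.
by apply: (can_inj fK); rewrite fz0 linear_at0.
Qed.

Lemma cyclic_iso M M' u V : cyclic_mod M u V -> cyclic_mod M' u V -> mod_iso M M'.
Proof.
move=> [z [zg _ zV]] [z' [z'g _ z'V]].
have zz' a : act a z = 0 <-> act a z' = 0 by rewrite zV z'V.
have eqz a b : act a z = act b z <-> act a z' = act b z'.
  split=> /eqP; rewrite -subr_eq0 -actBl => /eqP/zz'/eqP; rewrite actBl subr_eq0 => /eqP //.
have [c cE] := choice zg; have [c' c'E] := choice z'g.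
exists (fun m => act (c m) z'); split; last first.
  exists (fun m => act (c' m) z) => m; first by rewrite [RHS]cE; apply/eqz; rewrite -c'E.
  by rewrite [RHS]c'E; apply/eqz; rewrite -cE.
split=> [t x y|a x].
  by rewrite -actZl -actDl; apply/eqz; rewrite actDl actZl -!cE.
by rewrite -actM; apply/eqz; rewrite actM -!cE.
Qed.

(** [cyclic_mod] for the factor [X / Y], witnessed by an element of [M] instead of a class. *)
Definition cyclic_ext M (Y X : submodule M) (u : R) (V : {vspace R}) := exists x : M,
  [/\ x \in sub_space X, act u x = x,
      forall y, y \in sub_space X -> exists a, y - act a x \in sub_space Y &
      forall a, act a x \in sub_space Y <-> a * u \in V].

Lemma cyclic_factor M (Y X : submodule M) u V : u * u = u ->
  cyclic_mod (subquot_mod X Y) u V <-> cyclic_ext Y X u V.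
Proof.
move=> uu; split=> [[z [zg uz zV]]|[x [Xx ux xg xV]]].
  have zE : z = qpi X Y (qrepr z) by rewrite qpi_repr.
  have Xz : qrepr z \in sub_space X by apply: qrepr_in.
  have aE a : @act _ _ (subquot_mod X Y) a z = qpi X Y (act a (qrepr z)).
    by rewrite {1}zE; apply: sq_act_qpi.
  have a0 a : act a z = 0 <-> act a (qrepr z) \in sub_space Y.
    by rewrite aE -(qpi_eq0 Y (sub_stable a Xz)); split=> [->|/eqP].
  exists (act u (qrepr z)); split; rewrite ?sub_stable // -?actM ?uu //.
    move=> y Xy; have [a ya] := zg (qpi X Y y); exists a.
    rewrite -(qpi_eq0 (X := X)) ?rpredB ?sub_stable // linearB /= ya -{1}uz -actM aE.
    by rewrite -actM subrr.
  move=> a; rewrite -actM -a0 zV; by rewrite -mulrA uu.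
exists (qpi X Y x : subquot_mod X Y); split.
- move=> m; have [a ya] := xg _ (qrepr_in m); exists a.
  rewrite -[LHS]qpi_repr /= sq_act_qpi //; apply: qpi_eq; rewrite ?qrepr_in ?sub_stable //.
- by rewrite /= sq_act_qpi // ux.
move=> a; rewrite -xV /= sq_act_qpi // -(qpi_eq0 Y (sub_stable a Xx)).
by split=> [->|/eqP].
Qed.

(** A filtration seen from its lower end, the form in which submodules are chosen one after the
    other. *)
Fixpoint chain M (Y : submodule M) (Cs : seq (fmodule R -> Prop)) : Prop :=
  if Cs is C :: Cs' then exists X : submodule M,
    [/\ (Y <= X)%VS, C (subquot_mod X Y) & chain X Cs']
  else sub_space Y = fullv.

Lemma chain_filtration M Cs : chain (sub0 M) Cs -> has_filtration M Cs.
Proof.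
suff gen Y : chain Y Cs -> exists F : nat -> submodule M,
    [/\ F 0%N = Y, sub_space (F (size Cs)) = fullv &
        forall i, (i < size Cs)%N -> (F i <= F i.+1)%VS /\
          nth (fun _ => False) Cs i (subquot_mod (F i.+1) (F i))].
  by move=> /gen[F [F0 F1 FS]]; exists F; split=> //; rewrite F0.
elim: Cs Y => [|C Cs IH] Y /=; first by move=> Yf; exists (fun=> Y).
move=> [X [YX CX /IH[F [F0 F1 FS]]]]; exists (fun i => if i is j.+1 then F j else Y).
by split=> // -[|i] /= iC; [rewrite F0 | apply: FS].
Qed.

End CyclicModules.

Local Arguments act : simpl never.

(** * Indecomposable projectives, simple modules and composition series *)

Section PeirceModules.
Variables (k : fieldType) (A : falgType k) (L : finType) (e : L -> A).
Variables (N : L -> {vspace A}) (h : L -> nat) (Hp : peirce e N h).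

(** [x] is a nonzero scalar times [e_i] minus a nilpotent element, and a geometric series inverts
    it. *)
Lemma peirce_unit i x : x \in crn e i i -> x \notin N i -> exists z, z * x = e i.
Proof.
move=> xC xN; have [c] := pe_split Hp i x; rewrite (crnP Hp _ _ _ xC) => cN.
have c0 : c != 0 by apply: contraNneq xN => c0; rewrite c0 scale0r subr0 in cN.
pose m := - c^-1 *: (x - c *: e i).
have [n Nn] := pe_nil Hp i.
have mN : m \in N i by rewrite memvZ.
have mn : m ^+ n = 0.
  apply/eqP; rewrite -memv0 -Nn; elim: n {Nn} => [|n IH]; first by rewrite expr0 expv0 memv_line.
  by rewrite exprS expvSl memv_mul.
have [z zm] := unit_sub_nilpotent mn; exists (c^-1 *: z).
have xE : x = c *: ((1 - m) * e i).
  have nC := subvP (radical_crn Hp i) _ cN.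
  rewrite mulrBl mul1r /m -scalerAl (crnr Hp nC) scaleNr opprK scalerDr scalerA.
  by rewrite mulfV // scale1r addrC subrK.
by rewrite {1}xE -scalerAl -scalerAr scalerA mulVf // scale1r mulrA zm mul1r.
Qed.

Lemma mem_proj i a : (a \in (fullv * <[e i]>)%VS) = (a * e i == a).
Proof.
rewrite -limg_amulr; apply/memv_imgP/eqP => [[b _ ->]|ae].
  by rewrite lfunE /= -mulrA (pe_idem Hp).
by exists a; rewrite ?memvf // lfunE.
Qed.

Lemma mem_proj_mul i a : a * e i \in (fullv * <[e i]>)%VS.
Proof. by rewrite mem_proj -mulrA (pe_idem Hp). Qed.

Definition pcls i (a : A) : Pmod e i := qpi (proj_sub e i) (sub0 (regular_mod A)) a.

HB.instance Definition _ i := GRing.isLinear.Build k A (Pmod e i) _ (pcls i) (@qpi_linear k _ _ _).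

Lemma act_pcls i a b : b \in (fullv * <[e i]>)%VS -> act a (pcls i b) = pcls i (a * b).
Proof. by move=> bP; apply: (sq_act_qpi (sub0 (regular_mod A)) a (x := b)). Qed.

Lemma pcls_eq0 i a : a \in (fullv * <[e i]>)%VS -> (pcls i a == 0) = (a == 0).
Proof. by move=> aP; rewrite (@qpi_eq0 _ _ (proj_sub e i)) //= memv0. Qed.

Lemma pcls_surj i (x : Pmod e i) : exists2 a, a \in (fullv * <[e i]>)%VS & x = pcls i a.
Proof. by exists (qrepr x); rewrite ?qrepr_in // /pcls qpi_repr. Qed.

(* The preimage of U in A e_i: submodules of P_i are handled as left ideals of A
   contained in A e_i. *)
Definition quot_ideal i (U : submodule (Pmod e i)) : {vspace A} :=
  ((fullv * <[e i]>) :&: linfun (pcls i) @^-1: U)%VS.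

Lemma mem_quot_ideal i (U : submodule (Pmod e i)) a :
  (a \in quot_ideal U) = (a \in (fullv * <[e i]>)%VS) && (pcls i a \in sub_space U).
Proof. by rewrite memv_cap -memv_preim lfunE. Qed.

Lemma quot_ideal_sub i (U : submodule (Pmod e i)) : (quot_ideal U <= fullv * <[e i]>)%VS.
Proof. exact: capvSl. Qed.

Lemma quot_idealS i (U U' : submodule (Pmod e i)) :
  (quot_ideal U <= quot_ideal U')%VS -> (U <= U')%VS.
Proof.
move=> /subvP sub; apply/subvP => x; have [a aP ->] := pcls_surj x => aU.
by have := sub a; rewrite !mem_quot_ideal aP aU => /(_ isT).
Qed.

Lemma quot_ideal_mull i (U : submodule (Pmod e i)) a x :
  x \in quot_ideal U -> a * x \in quot_ideal U.
Proof.
rewrite !mem_quot_ideal => /andP[xP xU]; rewrite -act_pcls // sub_stable // andbT.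
by rewrite mem_proj -mulrA; move: xP; rewrite mem_proj => /eqP->.
Qed.

Lemma quot_ideal_exists i (V : {vspace A}) : (V <= fullv * <[e i]>)%VS ->
  (forall a x, x \in V -> a * x \in V) -> exists U : submodule (Pmod e i), quot_ideal U = V.
Proof.
move=> VP Vl.
have st a (x : Pmod e i) : x \in (linfun (pcls i) @: V)%VS -> act a x \in (linfun (pcls i) @: V)%VS.
  move=> /memv_imgP[b bV ->]; rewrite lfunE /= act_pcls ?(subvP VP) //.
  by apply/memv_imgP; exists (a * b); rewrite ?Vl // lfunE.
exists (Submodule st); apply/eqP; rewrite eqEsubv; apply/andP; split; apply/subvP => a.
  rewrite mem_quot_ideal => /andP[aP /memv_imgP[b bV]]; rewrite lfunE /= => ab.
  have : pcls i (a - b) == 0 by rewrite linearB /= ab subrr.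
  by rewrite pcls_eq0 ?rpredB ?(subvP VP _ bV) // => /eqP/subr0_eq->.
move=> aV; rewrite mem_quot_ideal (subvP VP) //=.
by apply/memv_imgP; exists a => //; rewrite lfunE.
Qed.

Definition qcls i (U : submodule (Pmod e i)) (a : A) : quot_mod U :=
  qpi (subT _) U (pcls i a).

HB.instance Definition _ i (U : submodule (Pmod e i)) :=
  GRing.isLinear.Build k A (quot_mod U) _ (qcls U)
    (fun c a b => etrans (congr1 _ (linearP (pcls i) c a b)) (linearP (qpi (subT _) U) c _ _)).

Lemma act_qcls i (U : submodule (Pmod e i)) a b :
  b \in (fullv * <[e i]>)%VS -> act a (qcls U b) = qcls U (a * b).
Proof.
move=> bP; rewrite /qcls -act_pcls //.
by apply: (sq_act_qpi U a (X := subT _)); apply: memvf.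
Qed.

Lemma qcls_eq0 i (U : submodule (Pmod e i)) a :
  a \in (fullv * <[e i]>)%VS -> (qcls U a == 0) = (a \in quot_ideal U).
Proof.
by move=> aP; rewrite mem_quot_ideal aP /qcls (@qpi_eq0 _ _ (subT _)) //= memvf.
Qed.

Lemma qcls_surj i (U : submodule (Pmod e i)) (x : quot_mod U) :
  exists2 a, a \in (fullv * <[e i]>)%VS & x = qcls U a.
Proof.
have [a aP xE] := pcls_surj (qrepr x); exists a => //.
by rewrite /qcls -xE qpi_repr.
Qed.

Lemma proj_id i : e i \in (fullv * <[e i]>)%VS.
Proof. by rewrite mem_proj (pe_idem Hp). Qed.

Lemma cyclic_quot_mod i (U : submodule (Pmod e i)) :
  cyclic_mod (quot_mod U) (e i) (quot_ideal U).
Proof.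
exists (qcls U (e i)); split; first 2 last.
- by move=> a; rewrite act_qcls ?proj_id // -(qcls_eq0 _ (mem_proj_mul i a)); split=> [->|/eqP].
- move=> m; have [a aP ->] := qcls_surj m; exists a; rewrite act_qcls ?proj_id //.
  by move: aP; rewrite mem_proj => /eqP->.
by rewrite act_qcls ?proj_id // (pe_idem Hp).
Qed.

(** The sum of [N_i] and all [e_j A e_i] with [j != i]; [quot_ideal_rad] identifies it with the
    radical of [P_i]. *)
Definition max_ideal i : {vspace A} :=
  ((fullv * <[e i]>) :&: amull (e i) @^-1: N i)%VS.

Lemma mem_max_ideal i a :
  (a \in max_ideal i) = (a \in (fullv * <[e i]>)%VS) && (e i * a \in N i).
Proof. by rewrite memv_cap -memv_preim lfunE. Qed.

Lemma max_ideal_mull i a x : x \in max_ideal i -> a * x \in max_ideal i.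
Proof.
rewrite !mem_max_ideal !mem_proj => /andP[/eqP xe xN].
rewrite -mulrA xe eqxx /=.
(* A detour of [e_i a x] through another [e_j] is a cycle at [i] and vanishes. *)
have -> : e i * (a * x) = e i * a * (e i * x).
  rewrite !mulrA -[in LHS](mulr1 (e i * a)) -(pe_sum Hp) mulr_sumr mulr_suml.
  rewrite (bigD1 i) //= big1 ?addr0 // => j ji.
  have -> : e i * a * e j * x = (e i * a * e j) * (e j * x * e i).
    by rewrite -[e j * x * e i]mulrA xe mulrA -[_ * e j * e j]mulrA (pe_idem Hp).
  by apply: (crn_through Hp _ (mem_crn e i j a) (mem_crn e j i x)); rewrite eq_sym.
exact: (pe_mull Hp).
Qed.

Lemma quot_ideal_full i (U : submodule (Pmod e i)) :
  e i \in quot_ideal U -> sub_space U = fullv.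
Proof.
move=> eU; apply/eqP; rewrite eqEsubv subvf; apply/subvP => x _.
have [a aP ->] := pcls_surj x; have := quot_ideal_mull a eU.
by move: aP; rewrite mem_proj mem_quot_ideal => /eqP-> /andP[].
Qed.

(** A submodule containing some [a] with [e_i a] outside [N_i] contains [e_i], by inverting [e_i a],
    and is all of [P_i]; so [max_ideal i] is the only maximal submodule. *)
Lemma quot_ideal_rad i : quot_ideal (Defs.rad (Pmod e i)) = max_ideal i.
Proof.
have [|a x|R RE] := @quot_ideal_exists i (max_ideal i); first exact: capvSl.
  exact: max_ideal_mull.
have maxR (U : submodule (Pmod e i)) : sub_space U != fullv -> (U <= R)%VS.
  move=> Uf; apply: quot_idealS; rewrite RE; apply/subvP => a aU.
  have aP := subvP (quot_ideal_sub _) _ aU.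
  rewrite mem_max_ideal aP /=; apply: contraNT Uf => aN.
  have aC : e i * a \in crn e i i.
    by move: aP; rewrite mem_proj => /eqP <-; rewrite mulrA mem_crn.
  have [z za] := peirce_unit aC aN.
  apply/eqP/quot_ideal_full; rewrite -za mulrA; exact: quot_ideal_mull.
have Rf : sub_space R != fullv.
  apply/eqP => Rf; have : e i \in quot_ideal R by rewrite mem_quot_ideal proj_id Rf memvf.
  by rewrite RE mem_max_ideal (pe_idem Hp) (negPf (pe_notin Hp i)) andbF.
have RM : maximal_sub R.
  split=> // U RU; have [->|Uf] := eqVneq (sub_space U) fullv; [by right | left].
  by apply/eqP; rewrite eqEsubv RU maxR.
rewrite -RE; apply/eqP; rewrite eqEsubv; apply/andP; split; apply/subvP => a.
  rewrite !mem_quot_ideal => /andP[-> /rad_spaceP/(_ R RM)] //.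
rewrite !mem_quot_ideal => /andP[-> aR]; apply/rad_spaceP => M [Mf Mmax].
by have [<-|Rfull] := Mmax R (maxR M Mf); last by rewrite Rfull eqxx in Rf.
Qed.

Lemma cyclic_Smod i : cyclic_mod (Smod e i) (e i) (max_ideal i).
Proof. by rewrite -quot_ideal_rad; apply: cyclic_quot_mod. Qed.

Definition eimg (M : fmodule A) i (X : {vspace M}) : {vspace M} :=
  (linfun (@act k A M (e i)) @: X)%VS.

(** Since [A_i] is [k e_i + N_i], the simple module [S_i] is one-dimensional. *)
Lemma simple_ext M (Y X : submodule M) i : (Y <= X)%VS -> cyclic_ext Y X (e i) (max_ideal i) ->
  exists x, [/\ act (e i) x = x, x \notin sub_space Y & sub_space X = (Y + <[x]>)%VS].
Proof.
move=> YX [x [Xx ex xg xV]]; exists x; split=> //.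
  apply/negP => xY; have : act 1 x \in sub_space Y by rewrite act1.
  by rewrite xV mul1r mem_max_ideal (pe_idem Hp) (negPf (pe_notin Hp i)) andbF.
apply/eqP; rewrite eqEsubv subv_add YX -memvE Xx /= andbT; apply/subvP => y Xy.
have [a ya] := xg y Xy; have [c cN] := pe_split Hp i a.
have /xV acY : (a - c *: 1) * e i \in max_ideal i.
  rewrite mem_max_ideal mem_proj_mul mulrBl -scalerAl mul1r mulrBr -scalerAr.
  by rewrite mulrA (pe_idem Hp).
move: acY; rewrite actBl actZl act1 => acY.
have -> : y = (y - act a x) + (act a x - c *: x) + c *: x by rewrite addrA !subrK.
by apply: memv_add; [apply: rpredD | apply/memvZ/memv_line].
Qed.

Lemma dim_eimg_ext M (Y X : submodule M) i j : (Y <= X)%VS ->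
  cyclic_ext Y X (e i) (max_ideal i) ->
  \dim (eimg j X) = (\dim (eimg j Y) + (i == j))%N.
Proof.
move=> YX /(simple_ext YX)[x [ex xY XE]].
rewrite /eimg XE limgD limg_line lfunE /=.
case: eqVneq => [<-|ij]; last first.
  rewrite addn0; congr (\dim _); apply/addv_idPl; rewrite -memvE.
  by rewrite -ex -actM (pe_orth Hp) 1?eq_sym // act0l mem0v.
rewrite ex addn1 dimv_disjoint_sum ?dim_vline.
  have [x0|_] := eqVneq x 0; last by rewrite addn1.
  by rewrite x0 mem0v in xY.
apply/eqP; rewrite -subv0; apply/subvP => y; rewrite memv_cap => /andP[yY /vlineP[c yc]].
rewrite memv0 yc; have [->|c0] := eqVneq c 0; first by rewrite scale0r.
case/negP: xY; have -> : x = c^-1 *: y by rewrite yc scalerA mulVf // scale1r.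
move: yY => /memv_imgP[y' y'Y ->]; rewrite lfunE /=.
by rewrite memvZ // sub_stable.
Qed.

(** For a vector of [e_i M] outside [Y], take the least power of [N_i] sending it into [Y]; the
    preceding power yields the required vector. *)
Lemma socle_ext M (Y : submodule M) i : ~~ (eimg i fullv <= Y)%VS ->
  exists v, [/\ act (e i) v = v, v \notin sub_space Y &
                forall n, n \in N i -> act n v \in sub_space Y].
Proof.
move=> /subvPn[_ /memv_imgP[m _ ->]]; rewrite lfunE /=.
set v := act (e i) m => vY.
pose P n := `[< forall a, a \in (N i ^+ n)%VS -> act a v \in sub_space Y >].
have exP : exists n, P n.
  have [n Nn] := pe_nil Hp i; exists n; apply/asboolP => a.
  by rewrite Nn memv0 => /eqP->; rewrite act0l mem0v.
have ev : act (e i) v = v by rewrite /v -actM (pe_idem Hp).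
case: (ex_minnP exP) => -[|n] /asboolP Pn minn.
  by case/negP: vY; rewrite -[v]act1; apply: Pn; rewrite expv0 memv_line.
have /asboolPn/existsNP[a /not_implyP[aN /negP aY]] : ~~ P n.
  by apply/negP => /minn; rewrite ltnn.
exists (act a v); split=> //.
  case: n aN {Pn minn aY} => [|n aN].
    by rewrite expv0 => /vlineP[c ->]; rewrite actZl act1 linearZ /= ev.
  have : (N i ^+ n.+1 <= limg (amull (e i)))%VS.
    rewrite expvSl; apply/prodvP => u b uN _; apply/memv_imgP; exists (u * b); rewrite ?memvf //.
    by rewrite lfunE /= mulrA (crnl Hp (subvP (radical_crn Hp i) _ uN)).
  move=> /subvP/(_ a aN)/memv_imgP[b _ ->]; rewrite lfunE /=.
  by rewrite -actM !mulrA (pe_idem Hp).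
by move=> b bN; rewrite -actM; apply: Pn; rewrite expvSl memv_mul.
Qed.

(** Among the [i] with [e_i M] not inside [Y], one of maximal height is taken: every [e_j a e_i]
    with [j != i] then maps into [Y], so a vector from [socle_ext] spans a simple submodule modulo
    [Y]. *)
Lemma chain_exists M (Y : submodule M) :
  exists s : seq L, chain Y [seq (fun X : fmodule A => mod_iso X (Smod e i)) | i <- s].
Proof.
have [n] := ubnP (\dim {:M} - \dim Y); elim: n Y => // n IH Y Yn.
have [Yf|Yf] := eqVneq (sub_space Y) fullv; first by exists [::].
have [i0 i0Y] : exists i, ~~ (eimg i (fullv : {vspace M}) <= Y)%VS.
  apply: contrapT => /forallNP sub; case/eqP: Yf; apply/eqP; rewrite eqEsubv subvf.
  apply/subvP => m _; rewrite -[m]act1 -(pe_sum Hp) act_suml rpred_sum // => i _.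
  have /negP := sub i; rewrite negbK => /subvP; apply.
  by apply/memv_imgP; exists m; rewrite ?memvf // lfunE.
case: (@arg_maxnP _ i0 (fun i => ~~ (eimg i (fullv : {vspace M}) <= Y)%VS) h i0Y) => i iY maxi.
have [v [ev vY Nv]] := socle_ext iY.
have cE a : exists2 c, act a v - c *: v \in sub_space Y & e i * a * e i - c *: e i \in N i.
  have [c cN] := pe_split Hp i a; exists c => //.
  have -> : act a v - c *: v = act (e i * a * e i - c *: e i) v +
      \sum_(j | j != i) act (e j * a * e i) v.
    have aE : act a v = act (e i * a * e i) v + \sum_(j | j != i) act (e j * a * e i) v.
      rewrite -{1}[act a v]act1 -(pe_sum Hp) act_suml (bigD1 i) //=.
      by congr (_ + _); [|apply: eq_bigr => j _]; rewrite !actM ev.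
    by rewrite {1}aE actBl actZl ev addrAC.
  rewrite rpredD ?Nv // rpred_sum // => j ji.
  have [->|a0] := eqVneq (e j * a * e i) 0; first by rewrite act0l mem0v.
  have ij : (h i < h j)%N by case: (pe_height Hp a0) => // /eqP; rewrite (negPf ji).
  have /negPn/subvP jY : ~~ ~~ (eimg j (fullv : {vspace M}) <= Y)%VS.
    by apply: contraL ij => /maxi; rewrite -leqNgt.
  apply: jY; apply/memv_imgP; exists (act (a * e i) v); rewrite ?memvf //.
  by rewrite lfunE /= -actM mulrA.
have st a x : x \in (Y + <[v]>)%VS -> act a x \in (Y + <[v]>)%VS.
  move=> /memv_addP[y yY [_ /vlineP[c ->] ->]].
  rewrite linearD linearZ /= rpredD //; first by rewrite (subvP (addvSl _ _)) // sub_stable.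
  have [c' c'Y _] := cE a; rewrite rpredZ // -[act a v](subrK (c' *: v)).
  by rewrite memv_add ?memvZ ?memv_line.
pose X := Submodule st; have YX : (Y <= X)%VS by apply: addvSl.
have [|s sX] := IH X.
  rewrite -ltnS; apply: leq_trans Yn; rewrite ltnS ltn_sub2l //.
    have := dimv_leqif_eq (subvf Y); rewrite ltn_neqAle => -[-> ->].
    by rewrite andbT.
  have := dimv_leqif_sup YX; rewrite ltn_neqAle => -[-> ->]; rewrite andbT.
  by apply: contra vY => /subvP; apply; rewrite (subvP (addvSr _ _)) ?memv_line.
exists (i :: s) => /=; exists X; split=> //.
apply: cyclic_iso (cyclic_Smod i); apply: (cyclic_factor Y X _ (pe_idem Hp i)).2.
exists v; split=> //.
- by rewrite (subvP (addvSr _ _)) ?memv_line.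
- move=> _ /memv_addP[y yY [_ /vlineP[c ->] ->]]; exists (c *: 1).
  by rewrite actZl act1 addrK.
move=> a; have [c cY cN] := cE a.
rewrite mem_max_ideal mem_proj_mul mulrA /=; split=> [aY|aN].
  have cv : c *: v \in sub_space Y by rewrite -[c *: v](subKr (act a v)) rpredB.
  have c0 : c = 0.
    apply/eqP; apply: contraNT vY => c0.
    by rewrite -[v]scale1r -(mulVf c0) -scalerA memvZ.
  by rewrite c0 scale0r subr0 in cN.
have c0 : c = 0.
  apply/eqP; apply: contraNT (pe_notin Hp i) => c0.
  rewrite -[e i]scale1r -(mulVf c0) -scalerA memvZ //.
  by rewrite -[c *: e i](subKr (e i * a * e i)) rpredB.
by move: cY; rewrite c0 scale0r subr0.
Qed.

Lemma comp_series_exists M : exists s : seq L, comp_series e M s.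
Proof. by have [s /chain_filtration sM] := chain_exists (sub0 M); exists s. Qed.

(** Turns the conditions on composition factors that define standard modules into conditions on the
    spaces [e_j M]. *)
Lemma comp_series_count M s : comp_series e M s ->
  forall j, count_mem j s = \dim (eimg j (fullv : {vspace M})).
Proof.
move=> [F [F0 Fn FS]] j; move: Fn FS; rewrite size_map => Fn FS.
suff IH n : (n <= size s)%N -> \dim (eimg j (F n)) = count_mem j (take n s).
  by rewrite -Fn IH // take_size.
elim: n => [|n IH] ns; first by rewrite take0 /eimg F0 limg0 dimv0.
have i0 : L by case: (s) ns.
have [le isoF] := FS n ns; rewrite (nth_map i0) // in isoF.
have cF := cyclic_mod_iso isoF (cyclic_Smod _).
have /(dim_eimg_ext j le) -> := (cyclic_factor _ _ _ (pe_idem Hp _)).1 cF.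
by rewrite IH ?(ltnW ns) // (take_nth i0) // -cats1 count_cat /= addn0.
Qed.

End PeirceModules.

(** * Filtrations by standard and proper standard modules *)

Section StandardModules.
Variables (k : fieldType) (A : falgType k) (L : finType) (e : L -> A).
Variables (N : L -> {vspace A}) (h : L -> nat) (Hp : peirce e N h).
Variables (le : rel L) (key : L -> nat).
Hypothesis leE : forall i j, le i j = (key i <= key j)%N.

Lemma std_condP i M : std_cond e le i M <->
  forall j, (key i < key j)%N -> eimg e j (fullv : {vspace M}) = 0%VS.
Proof.
split=> [[s sM /allP les] j ij|M0].
  apply/eqP; rewrite -dimv_eq0 -(comp_series_count Hp sM); apply/eqP/count_memPn.
  by apply: contraTN ij => /les; rewrite leE -leqNgt.
have [s sM] := comp_series_exists Hp M; exists s => //; apply/allP => j.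
rewrite leE leqNgt; apply: contraL => /M0 j0; apply/count_memPn.
by rewrite (comp_series_count Hp sM) j0 dimv0.
Qed.

Lemma prop_std_condP i M : prop_std_cond e le i M <->
  (forall j, (key i < key j)%N -> eimg e j (fullv : {vspace M}) = 0%VS) /\
  \dim (eimg e i (fullv : {vspace M})) = 1%N.
Proof.
split=> [[s sM [si /allP les]]|[M0 Mi]].
  split; last by rewrite -(comp_series_count Hp sM).
  apply/std_condP; exists s => //; apply/allP => j /les /orP[/eqP->|/andP[] //].
  by rewrite leE.
have [s sM als] := (std_condP i M).2 M0; exists s => //.
rewrite (comp_series_count Hp sM) Mi; split=> //; apply/allP => j js.
by have [//|_] := eqVneq j i; rewrite (allP als).
Qed.

(** The left ideal of [A e_i] with quotient [Delta_i]; adding [A N_i] to it leaves a single copy of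
    [S_i]. *)
Definition std_ideal i : {vspace A} := (amulr (e i) @: idl e (above key (key i).+1))%VS.
Definition prop_std_ideal i : {vspace A} := (std_ideal i + fullv * N i)%VS.

Lemma mem_std_ideal i a :
  (a \in std_ideal i) = (a \in idl e (above key (key i).+1)) && (a \in (fullv * <[e i]>)%VS).
Proof.
apply/idP/andP => [/memv_imgP[b bI ->]|[aI]].
  by rewrite lfunE /= idl_mulr // (mem_proj_mul Hp).
by rewrite (mem_proj Hp) => /eqP <-; apply/memv_imgP; exists a; rewrite // lfunE.
Qed.

Lemma std_ideal_sub i : (std_ideal i <= fullv * <[e i]>)%VS.
Proof. by apply/subvP => a; rewrite mem_std_ideal => /andP[]. Qed.

Lemma std_ideal_mull i a x : x \in std_ideal i -> a * x \in std_ideal i.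
Proof.
rewrite !mem_std_ideal !(mem_proj Hp) => /andP[xI /eqP xe].
by rewrite idl_mull // -mulrA xe eqxx.
Qed.

Lemma prop_std_ideal_sub i : (prop_std_ideal i <= fullv * <[e i]>)%VS.
Proof.
rewrite subv_add std_ideal_sub; apply/prodvP => a n _ nN.
by rewrite (mem_proj Hp) -mulrA (crnr Hp (subvP (radical_crn Hp i) _ nN)).
Qed.

Lemma prop_std_ideal_mull i a x : x \in prop_std_ideal i -> a * x \in prop_std_ideal i.
Proof.
move=> /memv_addP[y yI [z zN ->]]; rewrite mulrDr memv_add ?std_ideal_mull //.
have /subvP sub : (fullv * N i <= amull a @^-1: (fullv * N i))%VS.
  apply/prodvP => b n _ nN; rewrite -memv_preim lfunE /= mulrA.
  by rewrite memv_mul ?memvf.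
by have := sub z zN; rewrite -memv_preim lfunE.
Qed.

Lemma eimg_quot_mod i (U : submodule (Pmod e i)) j :
  eimg e j (fullv : {vspace (quot_mod U)}) = 0%VS <->
  forall a, e j * a * e i \in quot_ideal U.
Proof.
split=> [U0 a|UC].
  rewrite -qcls_eq0 ?(mem_proj_mul Hp) // -mulrA -act_qcls ?(mem_proj_mul Hp) //.
  by rewrite -memv0 -U0; apply/memv_imgP; exists (qcls U (a * e i)); rewrite ?memvf // lfunE.
apply/eqP; rewrite -subv0; apply/subvP => _ /memv_imgP[m _ ->]; rewrite lfunE /=.
have [a aP ->] := qcls_surj m; rewrite act_qcls // memv0.
move: aP; rewrite (mem_proj Hp) => /eqP <-.
by rewrite mulrA qcls_eq0 ?UC ?(mem_proj_mul Hp).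
Qed.

Lemma std_ideal_quot i (U : submodule (Pmod e i)) :
  (std_ideal i <= quot_ideal U)%VS <->
  forall j, (key i < key j)%N -> eimg e j (fullv : {vspace (quot_mod U)}) = 0%VS.
Proof.
split=> [/subvP sub j ij|U0].
  apply/eimg_quot_mod => a; apply: sub; rewrite mem_std_ideal (mem_proj_mul Hp) andbT.
  by rewrite -[e j]mul1r -mulrA mem_idl // inE.
apply/subvP => _ /memv_imgP[b bI ->].
suff /subvP/(_ b bI) : (idl e (above key (key i).+1) <= amulr (e i) @^-1: quot_ideal U)%VS.
  by rewrite -memv_preim.
apply: idl_ind => j x y; rewrite inE => /U0/eimg_quot_mod jU.
by rewrite -memv_preim lfunE /= -!mulrA (quot_ideal_mull Hp) // mulrA.
Qed.

(** Shared by standard and proper standard modules: [V i] is the least left ideal of [A e_i] whose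
    quotient satisfies [C i]. *)
Lemma largest_cyclic (C : L -> fmodule A -> Prop) (V : L -> {vspace A}) M :
  (forall i, (V i <= fullv * <[e i]>)%VS) -> (forall i a x, x \in V i -> a * x \in V i) ->
  (forall i (U : submodule (Pmod e i)), quot_ideal U = V i -> C i (quot_mod U)) ->
  (forall i (U : submodule (Pmod e i)), C i (quot_mod U) -> (V i <= quot_ideal U)%VS) ->
  (exists i, exists2 U : submodule (Pmod e i), largest_quotient (C i) U & mod_iso M (quot_mod U)) <->
  exists i, cyclic_mod M (e i) (V i).
Proof.
move=> VP Vl VC CV.
have largestE i (U : submodule (Pmod e i)) : largest_quotient (C i) U <-> quot_ideal U = V i.
  split=> [[CU Umin]|UE]; last first.
    by split=> [|U' /CV sub]; [apply: VC | apply: quot_idealS; rewrite UE].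
  have [U' U'E] := quot_ideal_exists (VP i) (Vl i).
  apply/eqP; rewrite eqEsubv CV // andbT -U'E; apply/subvP => a.
  rewrite !(mem_quot_ideal) => /andP[-> aU].
  by apply: (subvP _ _ aU); apply/Umin/VC.
split=> [[i [U /largestE UE iso]]|[i cM]].
  by exists i; apply: cyclic_mod_iso iso _; rewrite -UE; apply: (cyclic_quot_mod Hp U).
have [U UE] := quot_ideal_exists (VP i) (Vl i).
exists i, U; first exact/largestE.
by apply: cyclic_iso cM _; rewrite -UE; apply: (cyclic_quot_mod Hp).
Qed.

Lemma is_standardP M : is_standard e le M <-> exists i, cyclic_mod M (e i) (std_ideal i).
Proof.
apply: largest_cyclic => [i|i a x|i U UE|i U /std_condP/std_ideal_quot//].
- exact: std_ideal_sub.
- exact: std_ideal_mull.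
by apply/std_condP/std_ideal_quot; rewrite UE.
Qed.

(** As [e_i (P_i / U)] is the line of [e_i], each [n] in [N_i] has [n - c e_i] in [U] for some [c].
    For nonzero [c] this element is invertible in [A_i], which would force [e_i] into [U]. *)
Lemma prop_std_quot i (U : submodule (Pmod e i)) :
  (forall j, (key i < key j)%N -> eimg e j (fullv : {vspace (quot_mod U)}) = 0%VS) ->
  \dim (eimg e i (fullv : {vspace (quot_mod U)})) = 1%N ->
  (prop_std_ideal i <= quot_ideal U)%VS.
Proof.
move=> U0 U1; rewrite subv_add (std_ideal_quot _).2 //=.
have ei : e i \notin quot_ideal U.
  apply/negP => eU; have : eimg e i (fullv : {vspace (quot_mod U)}) = 0%VS.
    by apply/eimg_quot_mod => a; apply: (quot_ideal_mull Hp).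
  by move=> E; rewrite E dimv0 in U1.
have zE x : x \in crn e i i -> qcls U x \in eimg e i (fullv : {vspace (quot_mod U)}).
  move=> xC; apply/memv_imgP; exists (qcls U x); rewrite ?memvf // lfunE /= act_qcls.
    by rewrite (crnl Hp xC).
  by rewrite (mem_proj Hp) (crnr Hp xC).
have z0 : qcls U (e i) != 0 by rewrite qcls_eq0 // (proj_id Hp).
have lE : eimg e i (fullv : {vspace (quot_mod U)}) = <[qcls U (e i)]>%VS.
  apply/esym/eqP; rewrite eqEdim -memvE zE ?(crn_id Hp) //.
  by rewrite U1 dim_vline z0.
apply/prodvP => a n _ nN; apply: (quot_ideal_mull Hp).
have nC := subvP (radical_crn Hp i) _ nN.
have nP : n \in (fullv * <[e i]>)%VS by rewrite (mem_proj Hp) (crnr Hp nC).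
have := zE n nC; rewrite lE => /vlineP[c cE].
have nc : n - c *: e i \in quot_ideal U.
  rewrite -qcls_eq0; last by rewrite rpredB ?rpredZ ?(proj_id Hp).
  by rewrite linearB linearZ /= cE subrr.
have [c0|c0] := eqVneq c 0; first by rewrite c0 scale0r subr0 in nc.
have ncC : n - c *: e i \in crn e i i by rewrite rpredB ?rpredZ ?(crn_id Hp).
have ncN : n - c *: e i \notin N i.
  apply: contra (pe_notin Hp i) => ncN.
  rewrite -[e i]scale1r -(mulVf c0) -scalerA memvZ //.
  by rewrite -[c *: e i](subKr n) rpredB.
have [z ze] := peirce_unit Hp ncC ncN.
by case/negP: ei; rewrite -ze; apply: (quot_ideal_mull Hp).
Qed.

Lemma quot_prop_std i (U : submodule (Pmod e i)) : quot_ideal U = prop_std_ideal i ->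
  prop_std_cond e le i (quot_mod U).
Proof.
move=> UE; apply/prop_std_condP; split; first by apply/std_ideal_quot; rewrite UE addvSl.
have -> : eimg e i (fullv : {vspace (quot_mod U)}) = <[qcls U (e i)]>%VS.
  apply/eqP; rewrite eqEsubv; apply/andP; split.
    apply/subvP => _ /memv_imgP[m _ ->]; rewrite lfunE /=.
    have [a aP ->] := qcls_surj m; rewrite act_qcls //.
    have [c cN] := pe_split Hp i a.
    have aE : e i * a * e i = e i * a.
      by move: aP; rewrite (mem_proj Hp) -mulrA => /eqP->.
    apply/vlineP; exists c; apply/eqP; rewrite -subr_eq0 -linearZ -linearB qcls_eq0.
      rewrite UE (subvP (addvSr _ _)) // -aE -[X in X \in _]mul1r.
      by rewrite memv_mul ?memvf.
    rewrite rpredB ?rpredZ ?(proj_id Hp) // -aE; exact: (mem_proj_mul Hp).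
  rewrite -memvE; apply/memv_imgP; exists (qcls U (e i)); rewrite ?memvf // lfunE /=.
  by rewrite act_qcls ?(proj_id Hp) // (pe_idem Hp).
rewrite dim_vline qcls_eq0 ?(proj_id Hp) // UE.
(* The first summand has zero corner at [i], as there are no nonzero cycles, and [e_i A N_i] lies in
   [N_i]. *)
have /negPf -> // : e i \notin prop_std_ideal i.
apply: contra (pe_notin Hp i) => /memv_addP[x xI [y yN exy]].
have -> : e i = e i * x * e i + e i * y * e i.
  by rewrite -mulrDl -mulrDr -exy !(pe_idem Hp).
rewrite rpredD //.
  have -> : e i * x * e i = 0; last exact: mem0v.
  move: xI; rewrite mem_std_ideal => /andP[xI _].
  have := memv_img (blk e i i) xI; rewrite (blk_idl_diag Hp) ?inE ?ltnn //.
  by rewrite memv0 blkE => /eqP.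
have /subvP sub : (fullv * N i <= blk e i i @^-1: N i)%VS.
  apply/prodvP => a n _ nN; rewrite -memv_preim blkE mulrA -[_ * n * _]mulrA.
  rewrite (crnr Hp (subvP (radical_crn Hp i) _ nN)); exact: (pe_mull Hp).
by have := sub y yN; rewrite -memv_preim blkE.
Qed.

Lemma is_proper_standardP M :
  is_proper_standard e le M <-> exists i, cyclic_mod M (e i) (prop_std_ideal i).
Proof.
apply: largest_cyclic => [i|i a x|i U|i U /prop_std_condP[U0 U1]].
- exact: prop_std_ideal_sub.
- exact: prop_std_ideal_mull.
- exact: quot_prop_std.
exact: prop_std_quot.
Qed.

End StandardModules.

Lemma dim_img_add_eq (k : fieldType) (U W : vectType k) (f : 'Hom(U, W))
    (X X0 : {vspace U}) (B : {vspace W}) :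
  (X0 <= X)%VS -> (forall x, x \in X -> (f x \in B) = (x \in X0)) ->
  \dim (f @: X + B) = (\dim B + (\dim X - \dim X0))%N.
Proof.
move=> X0X fX; pose D := (X :\: X0)%VS.
have XE : X = (D + X0)%VS by rewrite addv_diff; apply/esym/addv_idPl.
have fX0 : (f @: X0 <= B)%VS.
  by apply/subvP => _ /memv_imgP[x xX0 ->]; rewrite fX // (subvP X0X).
have D0 x : x \in D -> f x \in B -> x = 0.
  move=> xD; rewrite fX ?(subvP (diffvSl _ _) _ xD) // => xX0.
  by apply/eqP; rewrite -memv0 -(capv_diff X X0) memv_cap xD.
have -> : (\dim X - \dim X0)%N = \dim D.
  by rewrite -(dimv_cap_compl X X0) (capv_idPr X0X) addKn.
rewrite {1}XE limgD -addvA (addv_idPr fX0) addnC dimv_disjoint_sum; last first.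
  apply/eqP; rewrite -subv0; apply/subvP => y; rewrite memv_cap => /andP[/memv_imgP[x xD ->] xB].
  by rewrite (D0 x xD xB) linear0 mem0v.
rewrite limg_dim_eq //; apply/eqP; rewrite -subv0; apply/subvP => x.
rewrite memv_cap memv_ker => /andP[xD /eqP fx]; rewrite (D0 x xD) ?mem0v //.
by rewrite fx mem0v.
Qed.

Lemma dim_diff_le (k : fieldType) (U : vectType k) (R X Y : {vspace U}) :
  (X <= Y)%VS -> (\dim (R :\: Y) <= \dim (R :\: X))%N.
Proof.
move=> XY; have := dimvS (capvS (subvv R) XY).
have := dimv_cap_compl R X; have := dimv_cap_compl R Y; lia.
Qed.

Lemma dim_diff_lt (k : fieldType) (U : vectType k) (R X Y : {vspace U}) y :
  (X <= Y)%VS -> y \in R -> y \notin X -> y \in Y -> (\dim (R :\: Y) < \dim (R :\: X))%N.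
Proof.
move=> XY yR yX yY.
have : (\dim (R :&: X) < \dim (R :&: Y))%N.
  rewrite ltn_neqAle dimvS ?capvS // andbT; apply: contra yX => /eqP dE.
  have /eqP E : (R :&: X == R :&: Y)%VS by rewrite eqEdim capvS // dE leqnn.
  have : y \in (R :&: Y)%VS by rewrite memv_cap yR.
  by rewrite -E memv_cap => /andP[].
have := dimv_cap_compl R X; have := dimv_cap_compl R Y; lia.
Qed.

(** * Greedy filtrations of [A] by cyclic modules [A e_i / V_i] *)

Section CyclicFiltrations.
Variables (k : fieldType) (A : falgType k) (L : finType) (e : L -> A).
Variables (N : L -> {vspace A}) (h : L -> nat) (Hp : peirce e N h).
Variables (key : L -> nat) (ik : injective key).
Variables V K : L -> {vspace A}.

Let S i := above key (key i).+1.
Definition erow i : {vspace A} := limg (amull (e i)).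
(** The dimension of the factor [A e_i / V_i]; the dimension [row_dim] of [e_i A / K_i] stands for
    its multiplicity. *)
Definition col_dim i := (\dim (fullv * <[e i]>) - \dim (V i))%N.
Definition row_dim i := (\dim (erow i) - \dim (K i))%N.

Hypothesis V_proj : forall i, (V i <= fullv * <[e i]>)%VS.
Hypothesis V_mull : forall i a x, x \in V i -> a * x \in V i.
Hypothesis V_idl : forall i, (std_ideal e key i <= V i)%VS.
Hypothesis K_row : forall i, (K i <= erow i)%VS.

Lemma erowP i x : reflect (e i * x = x) (x \in erow i).
Proof.
apply: (iffP idP) => [/memv_imgP[y _ ->]|<-].
  by rewrite lfunE /= mulrA (pe_idem Hp).
by apply/memv_imgP; exists x; rewrite ?memvf // lfunE.
Qed.

Definition cyclic_class (M : fmodule A) := exists i, cyclic_mod M (e i) (V i).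

Lemma dim_cyclic_ext (Y X : submodule (regular_mod A)) i : (Y <= X)%VS ->
  cyclic_ext Y X (e i) (V i) -> exists x : A,
  [/\ e i * x = x, forall a, a * x \in sub_space Y <-> a * e i \in V i,
      sub_space X = (Y + fullv * <[x]>)%VS & \dim X = (\dim Y + col_dim i)%N].
Proof.
move=> YX [x [Xx ex xg xV]]; exists x.
have XE : sub_space X = (Y + fullv * <[x]>)%VS.
  apply/eqP; rewrite eqEsubv subv_add YX /=; apply/andP; split.
    apply/subvP => y Xy; have [a ya] := xg y Xy.
    rewrite -[y](subrK (act a x)) memv_add // -limg_amulr.
    by apply/memv_imgP; exists a; rewrite ?memvf // lfunE.
  rewrite -limg_amulr; apply/subvP => _ /memv_imgP[a _ ->]; rewrite lfunE.
  exact: (sub_stable (M := regular_mod A)).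
split=> //.
have -> : sub_space X = (amulr x @: (fullv * <[e i]>) + Y)%VS.
  rewrite XE addvC -!limg_amulr; congr (_ + _)%VS; apply/eqP; rewrite eqEsubv.
  apply/andP; split; apply/subvP => _ /memv_imgP[a aP ->]; rewrite lfunE /=; apply/memv_imgP.
    exists (a * e i); last by rewrite lfunE /= -mulrA [e i * x]ex.
    by apply/memv_imgP; exists a; rewrite ?memvf // lfunE.
  by exists a; rewrite ?memvf // lfunE.
rewrite (dim_img_add_eq (V_proj i)) // => a; rewrite (mem_proj Hp) lfunE /= => /eqP ae.
by rewrite -{2}ae; apply/idP/idP => /xV.
Qed.

(** Along a filtration the image of [F m] in [e_i A / K_i] grows by at most one dimension at a
    factor of type [i] and not at all at the others. So the number [s i] of such factors is at least
    [row_dim i], and [dim A] is the sum of [s i * col_dim i]. *)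
Lemma filtered_dims :
  (forall i x, x \in idl e (S i) -> e i * x \in K i) ->
  ((forall i n a, n \in N i -> n * a \in K i) \/ (forall i, (N i <= V i)%VS)) ->
  filtered cyclic_class (regular_mod A) ->
  (\sum_i row_dim i * col_dim i <= \dim {:A})%N.
Proof.
move=> KI NKV [n [F [F0 Fn FS]]]; rewrite size_nseq in Fn FS.
have claim m : (m <= n)%N -> exists s : L -> nat,
    \dim (F m) = (\sum_i s i * col_dim i)%N /\
    forall i, (\dim ((F m :&: erow i) + K i) <= \dim (K i) + s i)%N.
  elim: m => [|m IH] mn.
    exists (fun=> 0%N); rewrite F0 dimv0 big1 //; split=> // i.
    by rewrite cap0v add0v addn0.
  have [s [sdim sle]] := IH (ltnW mn).
  have [le] := FS m mn; rewrite nth_nseq mn => -[j].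
  move=> /(cyclic_factor _ _ _ (pe_idem Hp j))/(dim_cyclic_ext le)[x [ex xV FE FD]].
  exists (fun i => s i + (i == j))%N; split.
    rewrite FD sdim; under [in RHS]eq_bigr do rewrite mulnDl.
    rewrite big_split /=; congr (_ + _)%N.
    by rewrite (bigD1 j) //= eqxx mul1n big1 ?addn0 // => i /negPf->.
  move=> i; pose U := ((F m :&: erow i) + K i)%VS.
  have UF y : y \in sub_space (F m) -> e i * y = y -> y \in U.
    move=> yF yE; rewrite (subvP (addvSl _ _)) // memv_cap yF /=.
    exact/erowP.
  have UK y : y \in K i -> y \in U by apply: (subvP (addvSr _ _)).
  have sub y : y \in (F m.+1 :&: erow i)%VS -> y \in (U + (if i == j then <[x]> else 0))%VS.
    rewrite memv_cap FE => /andP[/memv_addP[f fF [z]]].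
    rewrite -limg_amulr => /memv_imgP[a _ ->]; rewrite lfunE /= => -> /erowP yE.
    rewrite -yE mulrDr rpredD //.
      apply: (subvP (addvSl _ _)); apply: UF; last by rewrite mulrA (pe_idem Hp).
      exact: (sub_stable (M := regular_mod A)).
    have aE : e i * (a * x) = e i * a * e j * x by rewrite -[_ * e j * x]mulrA ex mulrA.
    have [ij|ij] := eqVneq i j; last first.
      (* If [i] is below [j], then [e_j] lies in [idl (S i)] and [e_i a x] falls into [K i]; if [i]
         is above [j], then [e_i a e_j] lies in [V j], which sends [x] into [F m]. *)
      rewrite (subvP (addvSl _ _)) //; case: (ltngtP (key i) (key j)) => [lt|lt|/ik ij'].
      - apply/UK/KI; rewrite -ex; apply: idl_mull.
        by rewrite -[e j]mul1r mem_idl // inE.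
      - apply: UF; last by rewrite !mulrA (pe_idem Hp).
        rewrite aE; apply/xV; apply/(subvP (V_idl j)).
        rewrite (mem_std_ideal Hp) (mem_proj Hp) -!mulrA !(pe_idem Hp) eqxx andbT.
        by rewrite -[e i]mul1r mem_idl // inE.
      by rewrite ij' eqxx in ij.
    rewrite aE ij; have [c cN] := pe_split Hp j a.
    rewrite -[e j * a * e j](subrK (c *: e j)) mulrDl -scalerAl ex.
    apply: memv_add; last by rewrite memvZ ?memv_line.
    have nC := subvP (radical_crn Hp j) _ cN.
    (* For standard factors [N_i A] lies in [K i]; for proper standard ones [N_i] lies in [V i] and
       sends [x] into [F m]. *)
    case: NKV => [NK|NV]; first by rewrite -ij; apply: UK; apply: NK; rewrite ij.
    rewrite -ij; apply: UF; rewrite ij; last by rewrite mulrA (crnl Hp nC).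
    by apply/xV; rewrite (crnr Hp nC); apply: (subvP (NV j)).
  have US : (\dim U <= \dim (K i) + s i)%N := sle i.
  have K1 : ((F m.+1 :&: erow i) + K i <= U + (if i == j then <[x]> else 0))%VS.
    rewrite subv_add; apply/andP; split; first by apply/subvP => y /sub.
    exact: subv_trans (addvSr _ _) (addvSl _ _).
  apply: leq_trans (dimvS K1) _; apply: leq_trans (dimv_add_leqif _ _).1 _.
  rewrite addnA leq_add //; case: (i == j); last by rewrite dimv0.
  by rewrite dim_vline; case: (x != 0).
have [s [sdim sle]] := claim n (leqnn n).
rewrite -Fn sdim; apply: leq_sum => i _; rewrite leq_mul // /row_dim leq_subLR.
by apply: leq_trans (sle i); rewrite Fn capfv dimvS ?addvSl.
Qed.

Hypothesis greedy : forall (F : submodule (regular_mod A)) i,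
  (idl e (S i) <= F)%VS -> ~~ (erow i <= F)%VS ->
  exists y : A, [/\ y \in erow i, y \notin (F + K i)%VS &
                    forall a, a \in V i -> a * y \in sub_space F].

(* F is enlarged at the largest i with e_i A not inside F; each such step lowers the
   defect by col_dim i and raises dim F by at most col_dim i, with equality only
   if the new factor is A e_i / V i. *)
Definition defect (F : {vspace A}) := (\sum_i \dim (erow i :\: (F + K i)) * col_dim i)%N.

Lemma greedy_step (F : submodule (regular_mod A)) : sub_space F != fullv ->
  exists i (F' : submodule (regular_mod A)),
  [/\ (F <= F')%VS, sub_space F' != sub_space F, (defect F' + col_dim i <= defect F)%N,
      (\dim F' <= \dim F + col_dim i)%N &
      (\dim F' = \dim F + col_dim i)%N -> cyclic_ext F F' (e i) (V i)].
Proof.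
move=> Ff; have [i0 i0F] : exists i, ~~ (erow i <= F)%VS.
  apply: contrapT => /forallNP sub; case/eqP: Ff; apply/eqP; rewrite eqEsubv subvf.
  apply/subvP => m _; rewrite -[m]mul1r -(pe_sum Hp) mulr_suml rpred_sum // => i _.
  have /negP := sub i; rewrite negbK => /subvP; apply.
  by apply/erowP; rewrite mulrA (pe_idem Hp).
case: (@arg_maxnP _ i0 (fun i => ~~ (erow i <= F)%VS) key i0F) => i iF maxi.
(* Maximality of [i] puts every [e_j A] with [j] above [i] inside the left ideal [F]. *)
have IF : (idl e (S i) <= F)%VS.
  apply: idl_ind => j a b; rewrite inE => ij; rewrite -mulrA.
  apply: (sub_stable (M := regular_mod A)).
  have /negPn/subvP jF : ~~ ~~ (erow j <= F)%VS.
    by apply: contraL ij => /maxi; rewrite -leqNgt.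
  by apply: jF; apply/erowP; rewrite mulrA (pe_idem Hp).
have [y [/erowP yE yFK Vy]] := greedy IF iF.
have colE x : x \in (fullv * <[y]>)%VS <-> exists a, x = a * y.
  rewrite -limg_amulr; split=> [/memv_imgP[a _ ->]|[a ->]]; first by exists a; rewrite lfunE.
  by apply/memv_imgP; exists a; rewrite ?memvf // lfunE.
have st a x : x \in (F + fullv * <[y]>)%VS -> @act _ _ (regular_mod A) a x \in (F + fullv * <[y]>)%VS.
  move=> /memv_addP[f fF [_ /colE[b ->] ->]]; rewrite [act _ _]mulrDr memv_add //.
    exact: (sub_stable (M := regular_mod A)).
  by apply/colE; exists (a * b); rewrite mulrA.
pose F' := Submodule st; have FF' : (F <= F')%VS by apply: addvSl.
have yF' : y \in sub_space F' by rewrite (subvP (addvSr _ _)) //; apply/colE; exists 1; rewrite mul1r.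
have F'E : sub_space F' = (amulr y @: (fullv * <[e i]>) + F)%VS.
  rewrite addvC /=; congr (_ + _)%VS; apply/eqP; rewrite eqEsubv; apply/andP; split.
    apply/subvP => _ /colE[a ->]; apply/memv_imgP; exists (a * e i); first exact: (mem_proj_mul Hp).
    by rewrite lfunE /= -mulrA yE.
  by apply/subvP => _ /memv_imgP[a _ ->]; rewrite lfunE /=; apply/colE; exists a.
exists i, F'; split=> //.
- by apply: contraNneq yFK => F'F; rewrite (subvP (addvSl _ _)) // -F'F.
- rewrite /defect (bigD1 i) //= [leqRHS](bigD1 i) //= addnAC leq_add //.
    rewrite addnC -mulSn leq_mul2r; apply/orP; right.
    apply: (@dim_diff_lt _ _ _ _ _ y) => //; first by apply: addvS.
      exact/erowP.
    by rewrite (subvP (addvSl _ _)).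
  by apply: leq_sum => j _; rewrite leq_mul2r; apply/orP; right; apply/dim_diff_le/addvS.
- rewrite F'E; apply: dim_img_add (V_proj i) _.
  by apply/subvP => _ /memv_imgP[a /Vy ay ->]; rewrite lfunE.
move=> dE; exists y; split=> //.
  move=> _ /memv_addP[f fF [_ /colE[a ->] ->]]; exists a.
  by rewrite [act _ _]/(a * y) addrK.
(* The annihilator of [y] modulo [F], within [A e_i]; a full gain in dimension forces it down to
   [V i]. *)
pose T := ((fullv * <[e i]>) :&: amulr y @^-1: F)%VS.
have VT : (V i <= T)%VS.
  apply/subvP => a aV; rewrite memv_cap (subvP (V_proj i)) // -memv_preim lfunE /=.
  exact: Vy.
have TE : T = V i.
  apply/esym/eqP; rewrite eqEdim VT /=.
  have TP a : a \in (fullv * <[e i]>)%VS -> (amulr y a \in sub_space F) = (a \in T).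
    by move=> aP; rewrite memv_cap aP -memv_preim.
  have := dim_img_add_eq (capvSl _ _ : (T <= fullv * <[e i]>)%VS) TP.
  rewrite -F'E dE /col_dim => /addnI E.
  have dT : (\dim T <= \dim (fullv * <[e i]>))%N by apply/dimvS/capvSl.
  by rewrite -(subKn dT) -E subKn // dimvS.
move=> a; rewrite -TE memv_cap (mem_proj_mul Hp) -memv_preim lfunE /= -mulrA yE.
by [].
Qed.

(** No greedy step increases [dim F + defect F], and at [F = A] the sum is at least [dim A]. *)
Lemma dim_le_defect (F : submodule (regular_mod A)) : (\dim {:A} <= \dim F + defect F)%N.
Proof.
have [n] := ubnP (\dim {:A} - \dim F); elim: n F => // n IH F Fn.
have [->|Ff] := eqVneq (sub_space F) fullv; first exact: leq_addr.
have [i [F' [FF' F'F dF' F'le _]]] := greedy_step Ff.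
have lt : (\dim F < \dim F')%N.
  rewrite ltn_neqAle dimvS // andbT; apply: contra F'F => /eqP dE.
  by rewrite eq_sym eqEdim FF' dE leqnn.
have := dimvS (subvf F'); have := IH F' _.
by lia.
Qed.

(** The sum cannot drop below [dim A], so every greedy step gains the full [col_dim i] and its
    factor is [A e_i / V_i]. *)
Lemma defect_chain (F : submodule (regular_mod A)) :
  (\dim F + defect F <= \dim {:A})%N -> exists n, chain F (nseq n cyclic_class).
Proof.
have [n] := ubnP (\dim {:A} - \dim F); elim: n F => // n IH F Fn Fle.
have [Ff|Ff] := eqVneq (sub_space F) fullv; first by exists 0%N.
have [i [F' [FF' F'F dF' F'le FF'c]]] := greedy_step Ff.
have lt : (\dim F < \dim F')%N.
  rewrite ltn_neqAle dimvS // andbT; apply: contra F'F => /eqP dE.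
  by rewrite eq_sym eqEdim FF' dE leqnn.
have F'f := dimvS (subvf F'); have leF' := dim_le_defect F'.
have [||m chF'] := IH F'; first lia; first lia.
exists m.+1, F'; split=> //; exists i; apply: (cyclic_factor _ _ _ (pe_idem Hp i)).2.
by apply: FF'c; lia.
Qed.

Lemma dims_filtered : (\sum_i row_dim i * col_dim i <= \dim {:A})%N ->
  filtered cyclic_class (regular_mod A).
Proof.
move=> le; have [|n /chain_filtration ch] := @defect_chain (sub0 _); last by exists n.
rewrite dimv0 add0n; apply: leq_trans le; apply: leq_sum => i _.
rewrite leq_mul // /row_dim /= add0v -(dimv_cap_compl (erow i) (K i)).
by rewrite (capv_idPr (K_row i)) addKn.
Qed.

End CyclicFiltrations.

(** * The opposite algebra *)

Definition reversed_height (L : finType) (h : L -> nat) (x : L) : nat :=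
  (\max_y h y - h x)%N.

Lemma reversed_height_lt (L : finType) (h : L -> nat) u w :
  (reversed_height h u < reversed_height h w)%N = (h w < h u)%N.
Proof.
have := @leq_bigmax L h u; have := @leq_bigmax L h w; rewrite /reversed_height.
move: (\max_y _) (h u) (h w) => M a b; lia.
Qed.

Section Converse.
Variables (k : fieldType) (A : falgType k) (L : finType) (e : L -> A).

(* Passing to the opposite algebra exchanges e_w A e_v and e_v A e_w. *)
Definition eC : L -> A^c := e.

(** [A] and [A^c] share one vector space, so subspaces of either are used as subspaces of the other;
    only images and products need translating. *)
Lemma conv_limg (f : 'End(A)) (g : 'End(A^c)) (U : {vspace A}) :
  (forall x : A, f x = g (x : A^c) :> A) ->
  (f @: U)%VS = (g @: (U : {vspace A^c}))%VS :> {vspace A}.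
Proof.
move=> fg; apply/vspaceP => y; apply/memv_imgP/memv_imgP => -[x xU ->]; exists x => //.
Qed.

Lemma conv_prodv (U V : {vspace A}) :
  (U * V)%VS = @prodv k A^c (V : {vspace A^c}) (U : {vspace A^c}) :> {vspace A}.
Proof.
apply/eqP; rewrite eqEsubv; apply/andP; split.
  apply/prodvP => u v uU vV.
  by have := @memv_mul k A^c V U v u vV uU.
have /subvP sub : (@prodv k A^c (V : {vspace A^c}) (U : {vspace A^c}) <= ((U * V)%VS : {vspace A^c}))%VS.
  apply/prodvP => v u vV uU; exact: (@memv_mul k A U V u v uU vV).
by apply/subvP => x /sub.
Qed.

Lemma conv_blk w v (U : {vspace A}) :
  (blk e w v @: U)%VS = (blk eC v w @: (U : {vspace A^c}))%VS :> {vspace A}.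
Proof. by apply: conv_limg => x; rewrite !blkE /= -mulrA. Qed.

Lemma conv_crn w v : crn e w v = crn eC v w :> {vspace A}.
Proof. exact: conv_blk. Qed.

Lemma conv_idl (S : {set L}) : idl e S = idl eC S :> {vspace A}.
Proof.
have E (x : L) (a b : A) : a * e x * b = (b : A^c) * eC x * (a : A^c) by rewrite -mulrA.
apply/eqP; rewrite eqEsubv; apply/andP; split.
  by apply: idl_ind => x a b xS; rewrite E; apply: (@mem_idl k A^c L eC S x b a xS).
have /subvP sub : (idl eC S <= (idl e S : {vspace A^c}))%VS.
  by apply: idl_ind => x a b xS; rewrite -E; apply: (@mem_idl k A L e S x b a xS).
by apply/subvP => x /sub.
Qed.

Lemma peirce_conv (N : L -> {vspace A}) (h h' : L -> nat) :
  (forall u w, (h' u < h' w)%N = (h w < h u)%N) ->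
  peirce e N h -> peirce eC (N : L -> {vspace A^c}) h'.
Proof.
move=> hh Hp; split.
- exact: (pe_idem Hp).
- by move=> i j ij; apply: (pe_orth Hp); rewrite eq_sym.
- exact: (pe_sum Hp).
- move=> w u x; rewrite hh => x0; have := @pe_height _ _ _ _ _ _ Hp u w x.
  by rewrite -mulrA => /(_ x0)[->|]; [left | right].
- exact: (pe_notin Hp).
- by move=> i x /(pe_corner Hp); rewrite -mulrA.
- by move=> i x; have [c cN] := pe_split Hp i x; exists c; rewrite -mulrA in cN.
- move=> i a x xN; by have := pe_mulr Hp a xN; rewrite -mulrA.
- move=> i a x xN; by have := pe_mull Hp a xN; rewrite -mulrA.
move=> i; have [n Nn] := pe_nil Hp i; exists n; rewrite -[RHS]Nn.
elim: n {Nn} => [|n IH].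
  rewrite !expv0; apply/vspaceP => x; by [].
by rewrite [RHS]expvSr conv_prodv expvSl IH.
Qed.

End Converse.

(** * Stratifications as dimension inequalities *)

Section RowBlocks.
Variables (k : fieldType) (A : falgType k) (L : finType) (e : L -> A).
Variables (N : L -> {vspace A}) (h : L -> nat) (Hp : peirce e N h).

Lemma dim_row_blk x (U : {vspace A}) : (forall v, amulr (e v) @: U <= U)%VS ->
  \dim (amull (e x) @: U) = (\sum_v \dim (blk e x v @: U))%N.
Proof.
move=> sU; rewrite (@dim_projection_sum _ _ L (fun v => amulr (e v))).
- by apply: eq_bigr => v _; rewrite -limg_comp.
- move=> i j y; rewrite !lfunE /= -mulrA eq_sym.
  by case: eqVneq => [->|ji]; rewrite ?(pe_idem Hp) // (pe_orth Hp ji) mulr0.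
- move=> y; under eq_bigr do rewrite lfunE /=.
  by rewrite -mulr_sumr (pe_sum Hp) mulr1.
move=> v; rewrite -limg_comp; apply/subvP => _ /memv_imgP[y yU ->].
rewrite -/(blk e x v) blkE -mulrA; apply/memv_imgP; exists (y * e v); last by rewrite lfunE.
by apply: (subvP (sU v)); apply/memv_imgP; exists y; rewrite ?lfunE.
Qed.

End RowBlocks.

Section StratifiedDims.
Variables (k : fieldType) (A : falgType k) (L : finType) (e : L -> A).
Variables (N : L -> {vspace A}) (h : L -> nat) (Hp : peirce e N h).

Lemma dim_col_blk x (U : {vspace A}) : (forall w, amull (e w) @: U <= U)%VS ->
  \dim (amulr (e x) @: U) = (\sum_w \dim (blk e w x @: U))%N.
Proof.
move=> sU; rewrite (@conv_limg _ _ _ (amull (eC e x)) _) => [|y]; last by rewrite !lfunE.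
rewrite (dim_row_blk (peirce_conv (reversed_height_lt h) Hp)) => [|w].
  by apply: eq_bigr => w _; rewrite -(conv_blk e).
by rewrite -(@conv_limg _ _ (amull (e w))) // => y; rewrite !lfunE.
Qed.

Lemma filtered_iff (C C' : fmodule A -> Prop) M :
  (forall X, C X <-> C' X) -> filtered C M -> filtered C' M.
Proof.
move=> CC' [n [F [F0 Fn FS]]]; exists n, F; rewrite !size_nseq in Fn FS *.
split=> // i iin; have [le] := FS i iin; rewrite !nth_nseq iin.
by split=> //; apply/CC'.
Qed.

Variables (le : rel L) (key : L -> nat) (ik : injective key).
Hypothesis leE : forall i j, le i j = (key i <= key j)%N.

Let S i := above key (key i).+1.

Lemma idl_amull S' i : (amull (e i) @: idl e S' <= idl e S')%VS.
Proof. by apply/subvP => _ /memv_imgP[y yI ->]; rewrite lfunE /= idl_mull. Qed.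
Lemma idl_amulr S' i : (amulr (e i) @: idl e S' <= idl e S')%VS.
Proof. by apply/subvP => _ /memv_imgP[y yI ->]; rewrite lfunE /= idl_mulr. Qed.
Lemma prodf_amulr (X : {vspace A}) a : (amulr a @: (X * fullv) <= X * fullv)%VS.
Proof.
apply/subvP => _ /memv_imgP[y yI ->]; rewrite memv_preim; move: y yI; apply/subvP.
by apply/prodvP => x b xX _; rewrite -memv_preim lfunE /= -mulrA memv_mul ?memvf.
Qed.
Lemma prodf_amull (X : {vspace A}) a : (amull a @: (fullv * X) <= fullv * X)%VS.
Proof.
apply/subvP => _ /memv_imgP[y yI ->]; rewrite memv_preim; move: y yI; apply/subvP.
by apply/prodvP => b x _ xX; rewrite -memv_preim lfunE /= mulrA memv_mul ?memvf.
Qed.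

(** The quotient of [e_i A] by this space is the top of [e_i (A / idl (S i))] over [A_i], whose
    dimension counts copies of [Delta_i]. In a proper standard module the [e_i]-part is a line, so
    [prop_std_row] omits the radical. *)
Definition std_row i : {vspace A} := (amull (e i) @: (idl e (S i) + N i * fullv))%VS.
Definition prop_std_row i : {vspace A} := (amull (e i) @: idl e (S i))%VS.

Lemma row_dim_std x : row_dim e std_row x = (\sum_v rad_rank e N (S x) x v)%N.
Proof.
rewrite /row_dim /erow /std_row !(dim_row_blk Hp); last 2 first.
- move=> v; rewrite limgD addvS ?idl_amulr ?prodf_amulr //.
- by move=> v; apply: subvf.
by rewrite sumnB // => v _; apply/dimvS/limgS/subvf.
Qed.

Lemma col_dim_std x : col_dim e (std_ideal e key) x = (\sum_w quot_dim e (S x) w x)%N.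
Proof.
rewrite /col_dim /std_ideal -limg_amulr !dim_col_blk; last 2 first.
- by move=> w; apply: subvf.
- by move=> w; apply: idl_amull.
by rewrite sumnB // => w _; apply/dimvS/limgS/subvf.
Qed.

Lemma prop_std_idealE x :
  prop_std_ideal e N key x = (amulr (e x) @: (idl e (S x) + fullv * N x))%VS.
Proof.
rewrite limgD; congr (_ + _)%VS; rewrite limg_amulr -prodvA; congr (_ * _)%VS.
apply/esym/eqP; rewrite -limg_amulr eqEsubv; apply/andP; split; apply/subvP => n.
  move=> /memv_imgP[m mN ->]; rewrite lfunE /=.
  by rewrite (crnr Hp (subvP (radical_crn Hp x) _ mN)).
move=> nN; apply/memv_imgP; exists n => //.
by rewrite lfunE /= (crnr Hp (subvP (radical_crn Hp x) _ nN)).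
Qed.

Lemma row_dim_prop x : row_dim e prop_std_row x = (\sum_v quot_dim e (S x) x v)%N.
Proof.
rewrite /row_dim /erow /prop_std_row !(dim_row_blk Hp); last 2 first.
- by move=> v; apply: idl_amulr.
- by move=> v; apply: subvf.
by rewrite sumnB // => v _; apply/dimvS/limgS/subvf.
Qed.

(** Together with [row_dim_prop] this exchanges multiplicity and dimension: proper standard modules
    of [A] obey the inequality of standard modules of [A^c]. *)
Lemma col_dim_prop x : col_dim e (prop_std_ideal e N key) x =
  (\sum_w rad_rank (@eC _ _ _ e) (N : L -> {vspace A^c}) (S x) x w)%N.
Proof.
rewrite /col_dim prop_std_idealE -limg_amulr !dim_col_blk; last 2 first.
- by move=> w; apply: subvf.
- by move=> w; rewrite limgD addvS ?idl_amull ?prodf_amull.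
rewrite -sumnB; last by move=> w _; apply/dimvS/limgS/subvf.
apply: eq_bigr => w _; rewrite /rad_rank.
have E : (idl e (S x) + fullv * N x =
  idl (@eC _ _ _ e) (S x) + @prodv k A^c (N x : {vspace A^c}) fullv :> {vspace A})%VS.
  by rewrite conv_idl conv_prodv.
by rewrite E -/(crn e w x) conv_crn conv_blk.
Qed.

Lemma std_idl_row i x : x \in idl e (S i) -> e i * x \in std_row i.
Proof.
move=> xI; apply/memv_imgP; exists x; rewrite ?lfunE //.
exact: subvP (addvSl _ _) _ xI.
Qed.

Lemma row_nakayama i (F : submodule (regular_mod A)) : ~~ (erow e i <= F)%VS ->
  ~~ (erow e i <= F + N i * erow e i)%VS.
Proof.
apply: contra => sub; apply: (nakayama Hp sub).
by apply/prodvP => n x _ xF; apply: (sub_stable (M := regular_mod A)).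
Qed.

Lemma standardly_stratified_dims :
  standardly_stratified e le <-> stratified_dims e N key.
Proof.
have sumE : (\sum_i row_dim e std_row i * col_dim e (std_ideal e key) i =
    \sum_w \sum_v \sum_x rad_rank e N (S x) x v * quot_dim e (S x) w x)%N.
  under eq_bigr do rewrite row_dim_std col_dim_std big_distrlr.
  rewrite exchange_big /=.
  under eq_bigr do rewrite exchange_big /=.
  by rewrite exchange_big.
have cls X : is_standard e le X <-> cyclic_class e (std_ideal e key) X.
  exact: (is_standardP Hp leE X).
rewrite /stratified_dims -sumE; split.
  move=> /(filtered_iff cls); apply: (filtered_dims Hp ik) => //.
  - by move=> i; apply: (std_ideal_sub Hp).
  - by move=> i x; apply: std_idl_row.
  left=> i n a nN; apply/memv_imgP; exists (n * a).
    by rewrite (subvP (addvSr _ _)) // memv_mul ?memvf.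
  by rewrite lfunE /= mulrA (crnl Hp (subvP (radical_crn Hp i) _ nN)).
move=> sd; apply: (filtered_iff (fun X => iff_sym (cls X))).
apply: (dims_filtered (key := key) Hp _ _ _ sd).
- by move=> i; apply: (std_ideal_sub Hp).
- by move=> i; apply/limgS/subvf.
(* Greedy choice: Nakayama gives [y] in [e_i A] outside [F + N_i e_i A], and that space contains
   [F + std_row i] since [F] contains the ideal. *)
move=> F i IF rF; have /subvPn[y yr yFN] := row_nakayama rF.
exists y; split=> //.
  apply: contra yFN; apply/subvP; rewrite subv_add addvSl /=.
  apply/subvP => _ /memv_imgP[_ /memv_addP[z zI [t tN ->]] ->]; rewrite linearD /= !lfunE /=.
  apply: memv_add; first by apply: (subvP IF); apply: idl_mull.
  suff /subvP/(_ t tN) : (N i * fullv <= amull (e i) @^-1: (N i * erow e i))%VS.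
    by rewrite -memv_preim lfunE.
  apply/prodvP => n a nN _; rewrite -memv_preim lfunE /=.
  have nC := subvP (radical_crn Hp i) _ nN.
  rewrite mulrA (crnl Hp nC) -{1}(crnr Hp nC) -mulrA memv_mul //.
  by apply/memv_imgP; exists a; rewrite ?memvf // lfunE.
move=> a; rewrite (mem_std_ideal Hp) => /andP[aI _].
by apply: (subvP IF); apply: idl_mulr.
Qed.

Lemma properly_stratified_dims :
  filtered (is_proper_standard e le) (regular_mod A) <->
  stratified_dims (@eC _ _ _ e) (N : L -> {vspace A^c}) key.
Proof.
have sumE : (\sum_i row_dim e prop_std_row i * col_dim e (prop_std_ideal e N key) i =
    \sum_w \sum_v \sum_x rad_rank (@eC _ _ _ e) (N : L -> {vspace A^c}) (S x) x v *
      quot_dim (@eC _ _ _ e) (S x) w x)%N.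
  under eq_bigr do rewrite row_dim_prop col_dim_prop big_distrlr.
  rewrite exchange_big /=.
  under eq_bigr do rewrite exchange_big /=.
  apply: eq_bigr => w _; apply: eq_bigr => v _; apply: eq_bigr => x _.
  rewrite mulnC; congr (_ * _)%N; rewrite /quot_dim -/(crn e x w).
  by rewrite conv_crn conv_blk conv_idl.
have cls X : is_proper_standard e le X <-> cyclic_class e (prop_std_ideal e N key) X.
  exact: (is_proper_standardP Hp leE X).
rewrite /stratified_dims -sumE; split.
  move=> /(filtered_iff cls); apply: (filtered_dims Hp ik) => //.
  - by move=> i; apply: (prop_std_ideal_sub Hp).
  - by move=> i; apply: addvSl.
  - by move=> i x xI; apply/memv_imgP; exists x; rewrite ?lfunE.
  right=> i; apply: subv_trans (addvSr _ _).
  by apply/subvP => n nN; rewrite -[n]mul1r memv_mul ?memvf.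
move=> sd; apply: (filtered_iff (fun X => iff_sym (cls X))).
apply: (dims_filtered (key := key) Hp _ _ _ sd).
- by move=> i; apply: (prop_std_ideal_sub Hp).
- by move=> i; apply/limgS/subvf.
move=> F i IF rF.
(* Greedy choice: since [V_i] now contains [A N_i], the vector [y] must be sent into [F] by
   [N_i]. *)
have [|y [ey yF Ny]] := @socle_ext _ _ _ _ _ _ Hp (regular_mod A) F i.
  exact: rF.
exists y; split.
- by apply/(erowP Hp).
- apply: contra yF; apply/subvP; rewrite subv_add subvv /=.
  apply/subvP => _ /memv_imgP[z zI ->]; rewrite lfunE /=.
  by apply: (subvP IF); apply: idl_mull.
move=> a /memv_addP[b bI [c cN ->]]; rewrite mulrDl rpredD //.
  move: bI; rewrite (mem_std_ideal Hp) => /andP[bI _].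
  by apply: (subvP IF); apply: idl_mulr.
suff /subvP/(_ c cN) : (fullv * N i <= amulr y @^-1: F)%VS by rewrite -memv_preim lfunE.
apply/prodvP => d n _ nN; rewrite -memv_preim lfunE /= -mulrA.
apply: (sub_stable (M := regular_mod A)); exact: Ny.
Qed.

End StratifiedDims.

(** * Projective modules over connected algebras *)

Lemma linear_atB (k : fieldType) (U W : lmodType k) (f : U -> W) : linear f ->
  forall x y, f (x - y) = f x - f y.
Proof. by move=> fl x y; rewrite addrC -scaleN1r fl scaleN1r addrC. Qed.

Section FreeModules.
Variables (k : fieldType) (R : falgType k).
Implicit Types M : fmodule R.

Definition comb M n (m : 'I_n -> M) (c : 'I_n -> R) := \sum_j act (c j) (m j).

Lemma combD M n (m : 'I_n -> M) a c d :
  comb m (fun j => a *: c j + d j) = a *: comb m c + comb m d.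
Proof.
rewrite /comb scaler_sumr -big_split; apply: eq_bigr => j _.
by rewrite actDl actZl.
Qed.

Lemma comb_act M n (m : 'I_n -> M) a c :
  comb m (fun j => a * c j) = act a (comb m c).
Proof. by rewrite /comb linear_sum; apply: eq_bigr => j _; rewrite actM. Qed.

Lemma comb_delta M n (m : 'I_n -> M) j : comb m (fun i => (i == j)%:R) = m j.
Proof.
rewrite /comb (bigD1 j) //= eqxx act1 big1 ?addr0 // => i /negPf->.
exact: act0l.
Qed.

Definition generating M n (m : 'I_n -> M) := forall x, exists c, x = comb m c.
Definition mod_basis M n (m : 'I_n -> M) :=
  generating m /\ forall c, comb m c = 0 -> forall j, c j = 0.

Lemma mod_basis_coord M n (m : 'I_n -> M) : mod_basis m ->
  exists c : M -> 'I_n -> R,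
  [/\ forall x, x = comb m (c x),
      forall a x y j, c (a *: x + y) j = a *: c x j + c y j,
      forall a x j, c (act a x) j = a * c x j &
      forall i j, c (m i) j = (j == i)%:R].
Proof.
move=> [mg mi]; have [c cE] := choice mg; exists c.
have uniq x d : x = comb m d -> forall j, c x j = d j.
  move=> xd j; apply/eqP; rewrite -subr_eq0; apply/eqP.
  apply: (mi (fun j => c x j - d j)).
  transitivity (comb m (fun j => -1 *: d j + c x j)).
    by apply: eq_bigr => i _; rewrite scaleN1r addrC.
  by rewrite combD scaleN1r -xd -cE addNr.
split=> //.
- by move=> a x y; apply: uniq; rewrite combD -!cE.
- by move=> a x; apply: uniq; rewrite comb_act -cE.
by move=> i j; rewrite (@uniq _ (fun j => (j == i)%:R)) // comb_delta.
Qed.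

Lemma mod_basis_projective M n (m : 'I_n -> M) : mod_basis m -> projective M.
Proof.
move=> /mod_basis_coord[c [cE cl ca _]] M' N g f [gl ga] gs [fl fa].
have [y yE] := choice (fun j => gs (f (m j))).
have f_sum (U W : fmodule R) (u : U -> W) (ul : linear u) n' (F : 'I_n' -> U) :
    u (\sum_j F j) = \sum_j u (F j).
  elim/big_rec2: _ => [|j a b _ <-]; first exact: linear_at0.
  by rewrite (linear_atD ul).
exists (fun x => comb y (c x)); split; first split.
- by move=> a x z; rewrite -combD; apply: eq_bigr => j _; rewrite cl.
- by move=> a x; rewrite -comb_act; apply: eq_bigr => j _; rewrite ca.
move=> x; rewrite {2}(cE x) /comb !f_sum //.
by apply: eq_bigr => j _; rewrite ga yE fa.
Qed.

Section FreeModule.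
Variable n : nat.
Let V : vectType k := {ffun 'I_n -> R}.
Definition ffun_act (a : R) (c : V) : V := [ffun j => a * c j].
Fact ffun_act_linl (c : V) : linear (ffun_act^~ c).
Proof. by move=> t a b; apply/ffunP => j; rewrite !ffunE mulrDl scalerAl. Qed.
Fact ffun_act_linr a : linear (ffun_act a).
Proof. by move=> t c d; apply/ffunP => j; rewrite !ffunE mulrDr scalerAr. Qed.
Fact ffun_act1 c : ffun_act 1 c = c.
Proof. by apply/ffunP => j; rewrite !ffunE mul1r. Qed.
Fact ffun_actM a b c : ffun_act (a * b) c = ffun_act a (ffun_act b c).
Proof. by apply/ffunP => j; rewrite !ffunE mulrA. Qed.
Definition free_mod : fmodule R :=
  FModule ffun_act_linl ffun_act_linr ffun_act1 ffun_actM.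
End FreeModule.

End FreeModules.

(** For a minimal generating family all relations have coefficients in the nilradical [N], as an
    invertible one would make a generator redundant. Projectivity splits the map from the free
    module, so [p] is a projection onto the relations; from [p p = p] its values have entries in
    every power of [N], hence [p = 0]. *)
Lemma projective_basis (k : closedFieldType) (R : falgType k) (M : fmodule R) :
  (forall f : R, f * f = f -> f = 0 \/ f = 1) -> projective M ->
  exists n (m : 'I_n -> M), mod_basis m.
Proof.
move=> /nilradical_exists[N [N1 _ NI [l Nl] Nu]] projM.
have ex : exists n, `[< exists m : 'I_n -> M, generating m >].
  exists (\dim {:M}); apply/asboolP; exists (fun j => (vbasis {:M})`_j) => x.
  exists (fun j => coord (vbasis {:M}) j x *: 1); rewrite {1}(coord_vbasis (memvf x)).
  by apply: eq_bigr => j _; rewrite actZl act1.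
case: (ex_minnP ex) => n /asboolP[m mg] nmin; exists n, m; split=> //.
have kerN c : comb m c = 0 -> forall j, c j \in N.
  move=> c0 j; apply: contraT => /Nu[z zc]; case: n m mg nmin c c0 j zc => [|n] m mg nmin c c0 j zc.
    by case: j {zc}.
  suff /nmin : `[< exists m' : 'I_n -> M, generating m' >] by rewrite ltnn.
  apply/asboolP; exists (fun i => m (lift j i)) => x; have [d dE] := mg x.
  have mj : m j = - \sum_i act (z * c (lift j i)) (m (lift j i)).
    have := congr1 (act z) c0; rewrite -comb_act linear0 /comb (bigD1_ord j) //= zc act1.
    by move=> /eqP; rewrite addr_eq0 => /eqP.
  exists (fun i => d (lift j i) - d j * (z * c (lift j i))).
  rewrite dE /comb (bigD1_ord j) //= mj addrC linearN linear_sum -sumrB.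
  by apply: eq_bigr => i _; rewrite actBl [in RHS]actM.
pose B (c : free_mod R n) : M := comb m c.
have Bhom : is_hom B.
  split=> [a c d|a c]; rewrite /B.
    by rewrite -combD; apply: eq_bigr => j _; rewrite !ffunE.
  by rewrite -comb_act; apply: eq_bigr => j _; rewrite !ffunE.
have Bs x : exists c, B c = x.
  have [c cE] := mg x; exists [ffun j => c j]; rewrite cE.
  by apply: eq_bigr => j _; rewrite ffunE.
have idhom : is_hom (@id M) by [].
have [s [[sl sa] Bsx]] := projM _ _ B id Bhom Bs idhom.
pose p (c : free_mod R n) : free_mod R n := c - s (B c).
have pD c d : p (c + d) = p c + p d.
  by rewrite /p (linear_atD Bhom.1) (linear_atD sl) opprD addrACA.
have pa a c : p (act a c) = act a (p c) by rewrite /p Bhom.2 sa linearB.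
have B0 c : B (p c) = 0.
  by rewrite /p (linear_atB Bhom.1) Bsx subrr.
have pp c : p (p c) = p c by rewrite {1}/p B0 (linear_at0 sl) subr0.
have pN1 c j : p c j \in N by apply: (kerN (p c)); apply: B0.
have p0 : p 0 = 0 by rewrite /p (linear_at0 Bhom.1) (linear_at0 sl) subr0.
have pN i c j : p c j \in (N ^+ i.+1)%VS.
  elim: i c j => [|i IH] c j; first by rewrite expv1.
  pose d (i : 'I_n) : free_mod R n := [ffun j => (j == i)%:R].
  have pcE : p c = \sum_i act (p c i) (d i).
    apply/ffunP => t; rewrite sum_ffunE (bigD1 t) //= !ffunE eqxx mulr1 big1 ?addr0 //.
    by move=> u ut; rewrite !ffunE eq_sym (negPf ut) mulr0.
  rewrite -pp pcE.
  have -> : p (\sum_i act (p c i) (d i)) = \sum_i act (p c i) (p (d i)).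
    by elim/big_rec2: _ => [//|u x y _ <-]; rewrite pD pa.
  rewrite sum_ffunE; apply: rpred_sum => u _; rewrite -[X in X \in _]/(ffun_act (p c u) (p (d u)) j) ffunE expvSr.
  by apply: memv_mul; [apply: IH | apply: pN1].
move=> c c0 j.
have BC : B [ffun j => c j] = 0.
  by rewrite -[RHS]c0; apply: eq_bigr => i _; rewrite ffunE.
have := pN l [ffun j => c j] j; rewrite expvSr Nl prod0v memv0 /p BC (linear_at0 sl) subr0.
by rewrite ffunE => /eqP.
Qed.

(** * The Peirce decomposition of a directed algebra *)

Section CornerAlgebra.
Variables (k : fieldType) (A : falgType k) (L : finType) (e : L -> A).
Hypothesis ee : forall i, e i * e i = e i.
Hypothesis e0 : forall i, e i != 0.

Lemma mem_crn_idem i j x : (x \in crn e i j) = (e i * x * e j == x).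
Proof.
apply/idP/eqP => [/memv_imgP[y _ ->]|<-]; last exact: mem_crn.
by rewrite blkE !mulrA ee -!mulrA ee.
Qed.

Lemma crn_is_aspace i : is_aspace (crn e i i).
Proof.
apply/andP; split.
  apply/has_algidP; exists (e i); split; rewrite ?mem_crn_idem ?ee ?eqxx ?e0 //.
  move=> x; rewrite mem_crn_idem => /eqP <-.
  by rewrite !mulrA ee -!mulrA ee.
apply/prodvP => x y; rewrite !mem_crn_idem => /eqP xE /eqP yE.
by rewrite -{1}xE -{1}yE !mulrA ee -!mulrA ee !mulrA -{2}xE -{2}yE !mulrA.
Qed.

Definition crn_aspace i : {aspace A} := ASpace (crn_is_aspace i).
Definition crn_alg i : falgType k := subvs_of (crn_aspace i).

Lemma crn_alg1 i : vsval (1 : crn_alg i) = e i.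
Proof.
have eC : e i \in crn_aspace i by rewrite mem_crn_idem !ee.
have : algid (crn_aspace i) \in crn_aspace i by apply: memv_algid.
rewrite -[RHS](algidr eC) mem_crn_idem => /eqP aE.
by rewrite -[LHS]/(algid (crn_aspace i)) -aE !mulrA ee.
Qed.

Lemma crn_algM i (x y : crn_alg i) : vsval (x * y) = vsval x * vsval y.
Proof. by []. Qed.

Lemma crn_alg_mem i (x : crn_alg i) : e i * vsval x * e i = vsval x.
Proof. by have := subvsP x; rewrite mem_crn_idem => /eqP. Qed.

(** An idempotent [f] of the corner gives the orthogonal decomposition [e_i = f + (e_i - f)]. *)
Lemma crn_alg_connected i : primitive (e i) ->
  forall f : crn_alg i, f * f = f -> f = 0 \/ f = 1.
Proof.
move=> [_ _ prim] f ff; pose x := vsval f.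
have xx : x * x = x by rewrite /x -crn_algM ff.
have ex : e i * x = x by rewrite -crn_alg1 -crn_algM mul1r.
have xe : x * e i = x by rewrite -crn_alg1 -crn_algM mulr1.
have [||||//|x0|gx] := prim x (e i - x).
- exact: xx.
- by rewrite /idempotent_elt mulrBl !mulrBr ee ex xe xx subrr subr0.
- by rewrite mulrBr xe xx subrr.
- by rewrite mulrBl ex xx subrr.
- by rewrite addrC subrK.
- by left; apply/val_inj; rewrite /= -/x x0.
by right; apply/val_inj; rewrite [RHS]crn_alg1; apply/esym/subr0_eq.
Qed.

End CornerAlgebra.

Lemma peirce_exists (k : closedFieldType) (A : falgType k) (L : finType) (e : L -> A)
    (He : complete_primitive_orthogonal e) :
  directed (alg_cat He) -> exists (N : L -> {vspace A}) (h : L -> nat), peirce e N h.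
Proof.
move=> [le [le_refl le_anti le_trans leP]].
have ee := cpo_idem He; have e0 i : e i != 0 by have [] := cpo_primitive He i.
pose R := crn_alg ee e0.
have ex i : exists U : {vspace R i},
  [/\ 1 \notin U, forall x, exists c : k, x - c%:A \in U,
      forall a x, x \in U -> a * x \in U /\ x * a \in U,
      (exists n, (U ^+ n)%VS = 0%VS) & forall x, x \notin U -> exists z, z * x = 1].
  exact/nilradical_exists/crn_alg_connected/(cpo_primitive He).
pose U i := sval (cid (ex i)); have UP i := svalP (cid (ex i)); rewrite -/(U _) in UP.
pose v i := linfun (@vsval _ _ (crn_aspace ee e0 i)).
have vE i x : v i x = vsval x by rewrite lfunE.
have inv i a : exists x : R i, vsval x = e i * a * e i.
  have aC : e i * a * e i \in crn_aspace ee e0 i by apply: mem_crn.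
  by exists (Subvs aC).
have vinj i (x : R i) (W : {vspace R i}) : (v i x \in (v i @: W)%VS) = (x \in W).
  apply/idP/idP => [/memv_imgP[y yW]|]; last exact: memv_img.
  by rewrite !vE => /val_inj->.
(* The radicals are the nilradicals of the corner algebras seen in [A]; the height counts the
   objects below. *)
exists (fun i => v i @: U i)%VS, (fun i => #|[set j | le j i]|); split => //.
- exact: cpo_orthogonal.
- exact: cpo_complete.
- move=> w u x x0; have [->|wu] := eqVneq w u; [by left | right].
  have luw : le u w.
    apply: leP; have cx : e w * x * e u \in corner_pred e u w.
      by rewrite inE !mulrA ee -!mulrA ee.
    exists (Corner cx); apply: contraNneq x0 => f0; apply/eqP.
    exact: (congr1 (@cval _ _ _ _ _ _) f0).
  apply/proper_card/properP; split.
    by apply/subsetP => z; rewrite !inE => /le_trans; apply.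
  exists w; rewrite inE ?le_refl //; apply: contra wu => lwu.
  by apply/eqP/le_anti; rewrite lwu luw.
- move=> i; have [U1 _ _ _ _] := UP i.
  by rewrite -(crn_alg1 ee e0) -vE vinj.
- move=> i x /memv_imgP[y _ ->]; rewrite vE; exact: crn_alg_mem.
- move=> i x; have [_ Us _ _ _] := UP i; have [y yE] := inv i x.
  have [c cU] := Us y; exists c; rewrite -yE.
  have -> : vsval y - c *: e i = v i (y - c%:A).
    rewrite vE -[e i](crn_alg1 ee e0 i) -linearZ -linearB.
    by [].
  by rewrite vinj.
- move=> i a x /memv_imgP[y yU ->]; have [_ _ UI _ _] := UP i; have [b bE] := inv i a.
  have -> : e i * a * v i y = v i (b * y).
    by rewrite !vE crn_algM bE -[vsval y]crn_alg_mem !mulrA -[_ * e i * e i]mulrA ee.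
  by rewrite vinj; have [] := UI b y yU.
- move=> i a x /memv_imgP[y yU ->]; have [_ _ UI _ _] := UP i; have [b bE] := inv i a.
  have -> : v i y * a * e i = v i (y * b).
    by rewrite !vE crn_algM bE -[vsval y]crn_alg_mem -!mulrA (mulrA (e i) (e i)) ee.
  by rewrite vinj; have [] := UI b y yU.
(* The exponent is shifted by one because zeroth powers do not correspond: in [A] it is the line
   through 1, in the corner the line through [e_i]. *)
move=> i; have [_ _ _ [n Un] _] := UP i; exists n.+1; apply/eqP; rewrite -subv0.
have sub m : (((v i @: U i) ^+ m.+1) <= v i @: (U i ^+ m.+1))%VS.
  elim: m => [|m IH]; first by rewrite !expv1.
  rewrite !(expvSl _ m.+1); apply: subv_trans (prodvSr _ IH) _.
  apply/prodvP => _ _ /memv_imgP[x xU ->] /memv_imgP[y yU ->].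
  apply/memv_imgP; exists (x * y); first exact: memv_mul.
  by rewrite !vE.
by apply: subv_trans (sub n) _; rewrite expvSr Un prod0v limg0.
Qed.

(** * Bases in free directed categories *)

Lemma linear_at_sum (k : fieldType) (U W : lmodType k) (f : U -> W) : linear f ->
  forall (I : Type) (r : seq I) (F : I -> U), f (\sum_(i <- r) F i) = \sum_(i <- r) f (F i).
Proof.
move=> fl I r F; elim/big_rec2: _ => [|i x y _ <-]; first exact: linear_at0.
exact: linear_atD.
Qed.

Lemma sum_tagged (V : nmodType) (T : finType) (I : T -> finType) (F : {t : T & I t} -> V) :
  \sum_x F x = \sum_t \sum_(p : I t) F (Tagged I p).
Proof.
rewrite [RHS](sig_big_dep xpredT (fun _ => xpredT) (fun t (p : I t) => F (Tagged I p))) /=.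
by apply: eq_bigr => -[t p].
Qed.

Lemma sum_prod (V : nmodType) (I J : finType) (F : I * J -> V) :
  \sum_p F p = \sum_i \sum_j F (i, j).
Proof. by rewrite pair_big; apply: eq_bigr => -[i j]. Qed.

Section FreeCategory.
Variables (k : fieldType) (Q : bimod_quiver k).
Local Notation path := (qpath (@arrow k Q)).

Definition scal (v : vertex Q) (s : valg v) : fhom v v := @path_incl k Q v v (pnil _ v) s.
(** [Mpath] of a path of length one still carries the trailing factor [f(u)], hence the tensor with
    1. *)
Definition arr (u w : vertex Q) (a : arrow u w) (m : abim a) : fhom u w :=
  @path_incl k Q u w (pcons a (pnil _ u)) (@pure k _ _ _ (abim a) (Mpath (pnil _ u)) m (1 : valg u)).

Lemma scal_linear v : linear (@scal v).
Proof. exact: (@path_incl_linear k Q v v (pnil _ v)). Qed.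

Lemma arr_linear u w (a : arrow u w) : linear (@arr u w a).
Proof.
by move=> c m m'; rewrite /arr -path_incl_linear -pure_linl.
Qed.

Lemma prependE v u w (a : arrow u w) (m : abim a) (f : fhom v u) :
  prepend m f = fcomp (arr m) f.
Proof.
elim/fhom_ind: f => [|f g IH IH'|p x].
- rewrite (linear_at0 (fcomp_linr _)) /prepend; apply: linear_at0.
  by apply: dlift_linear => p c x y; rewrite pure_linr path_incl_linear.
- rewrite (linear_atD (fcomp_linr _)) -IH -IH' /prepend; apply: linear_atD.
  by apply: dlift_linear => p c x y; rewrite pure_linr path_incl_linear.
by rewrite prepend_incl /arr fcomp_incl mcat_pcons /= lact1.
Qed.

Lemma scal_arr u w (a : arrow u w) (s : valg w) (m : abim a) :
  fcomp (scal s) (arr m) = arr (lact s m).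
Proof. by rewrite /scal /arr fcomp_incl /= tens_lact_pure. Qed.

Lemma arr_scal u w (a : arrow u w) (s : valg u) (m : abim a) :
  fcomp (arr m) (scal s) = arr (ract m s).
Proof.
by rewrite -prependE /scal prepend_incl /arr pure_balanced /= mulr1.
Qed.

Lemma scal_mul v (s t : valg v) : fcomp (scal s) (scal t) = scal (s * t).
Proof. by rewrite /scal fcomp_incl. Qed.

Lemma scal1 v : scal (1 : valg v) = fid v.
Proof. by []. Qed.

Lemma scal_surj v (f : fhom v v) : f = scal (f (pnil _ v)).
Proof.
apply: dsumP => p; rewrite (quiver_acyclic p) /scal /path_incl.
by rewrite dinj_id.
Qed.

Lemma fhom_prepend_ind v w (P : fhom v w -> Prop) : w <> v ->
  P 0 -> (forall c f g, P f -> P g -> P (c *: f + g)) ->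
  (forall u (a : arrow u w) (m : abim a) (f : fhom v u), P (fcomp (arr m) f)) ->
  forall f, P f.
Proof.
move=> wv P0 PD Pa; apply: fhom_ind => // [f g Pf Pg|p].
  by rewrite -[f]scale1r; apply: PD.
case: p wv P P0 PD Pa => [//|u w' a p] _ P P0 PD Pa.
apply: tens_span => [|c x y Px Py|m x].
- by rewrite (linear_at0 (@path_incl_linear _ _ _ _ _)).
- by rewrite path_incl_linear; apply: PD.
by rewrite -prepend_incl prependE; apply: Pa.
Qed.

(* Universal property of the free category: maps out of its morphism spaces
   are determined by the last arrow of each path. *)
Section LastArrow.
Variables (v : vertex Q) (W : vertex Q -> lmodType k).
Variable beta : forall u w (a : arrow u w), abim a -> fhom v u -> W w.
Hypothesis beta_linl : forall u w (a : arrow u w) f, linear (fun m => @beta u w a m f).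
Hypothesis beta_linr : forall u w (a : arrow u w) m, linear (@beta u w a m).
Hypothesis beta_bal : forall u w (a : arrow u w) m (s : valg u) f,
  @beta u w a (ract m s) f = @beta u w a m (fcomp (scal s) f).

Definition last_arrow_path w (p : path v w) : Mpath p -> W w :=
  match p in qpath _ _ w0 return Mpath p -> W w0 with
  | pnil => fun _ => 0
  | pcons _ _ a p' => tlift (fun m x => beta m (path_incl x))
  end.

Definition last_arrow w (f : fhom v w) : W w := dlift (@last_arrow_path w) f.

Lemma last_arrow_path_linear w (p : path v w) : linear (@last_arrow_path w p).
Proof.
case: p => [c x y|u w' a p]; first by rewrite scaler0 addr0.
exact: tlift_linear.
Qed.

Lemma last_arrow_linear w : linear (@last_arrow w).
Proof. by apply: dlift_linear => p; apply: last_arrow_path_linear. Qed.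

Lemma last_arrow_comp u w (a : arrow u w) (m : abim a) (f : fhom v u) :
  last_arrow (fcomp (arr m) f) = beta m f.
Proof.
elim/fhom_ind: f => [|f g IH IH'|p x].
- rewrite (linear_at0 (fcomp_linr _)) (linear_at0 (@last_arrow_linear w)).
  by rewrite (linear_at0 (beta_linr m)).
- rewrite (linear_atD (fcomp_linr _)) (linear_atD (@last_arrow_linear w)) IH IH'.
  by rewrite (linear_atD (beta_linr m)).
rewrite -prependE prepend_incl /last_arrow /path_incl dlift_inj; last first.
  by move=> q; apply: (linear_at0 (@last_arrow_path_linear _ q)).
rewrite /= tlift_pure //; last by move=> m1 s n; rewrite beta_bal /scal fcomp_incl.
by move=> m1 c n1 n2; rewrite path_incl_linear beta_linr.
Qed.

End LastArrow.

(** Morphisms split according to their last arrow, so a relation between words holds for each arrow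
    separately, even after a balanced map [b]. In the proof [dj] places the values of [b] in a
    direct sum over the arrows into one vertex. *)
Lemma last_arrow_split v (V : forall u w, arrow u w -> lmodType k)
    (b : forall u w (a : arrow u w), abim a -> fhom v u -> V u w a) :
  (forall u w (a : arrow u w) f, linear (fun m => b u w a m f)) ->
  (forall u w (a : arrow u w) m, linear (b u w a m)) ->
  (forall u w (a : arrow u w) m (s : valg u) f,
     b u w a (ract m s) f = b u w a m (fcomp (scal s) f)) ->
  forall w (I : {u & arrow u w} -> finType) (m : forall t, I t -> abim (tagged t))
    (x : forall t, I t -> fhom v (tag t)),
  \sum_t \sum_(i : I t) (fcomp (arr (m t i)) (x t i) : fhom v w) = 0 ->
  forall t, \sum_(i : I t) b _ _ (tagged t) (m t i) (x t i) = 0.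
Proof.
move=> bl br bb w I m x s0 t0.
pose dj w' (t : {u & arrow u w'}) :=
  @dinj k {u & arrow u w'} (fun t => V (tag t) w' (tagged t)) t.
have djl w' t : linear (@dj w' t) by apply: dinj_linear.
pose beta u w' (a : arrow u w') n f := dj w' (existT _ u a) (b u w' a n f).
have betal u w' (a : arrow u w') f : linear (fun n => beta u w' a n f).
  by move=> c n n'; rewrite /beta bl djl.
have betar u w' (a : arrow u w') n : linear (beta u w' a n).
  by move=> c f f'; rewrite /beta br djl.
have betab u w' (a : arrow u w') n s f : beta u w' a (ract n s) f = beta u w' a n (fcomp (scal s) f).
  by rewrite /beta bb.
have Dl := @last_arrow_linear v _ beta w.
pose G t := \sum_(i : I t) b _ _ (tagged t) (m t i) (x t i).
have DG : \sum_t dj w t (G t) = 0.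
  have D0 := congr1 (last_arrow beta (w := w)) s0.
  rewrite (linear_at0 Dl) (linear_at_sum Dl) in D0; rewrite -[RHS]D0.
  apply: eq_bigr => -[u a] _; rewrite (linear_at_sum (djl _ _)) (linear_at_sum Dl).
  by apply: eq_bigr => i _; rewrite (last_arrow_comp betal betar betab).
have E1 : dsum_fun (dj w t0 (G t0)) t0 = G t0 by apply: dinj_id.
have E2 t : t != t0 -> dsum_fun (dj w t (G t)) t0 = 0 by apply: dinj_ne.
have := congr1 (fun y => dsum_fun y t0) DG; rewrite dsum_sumE (bigD1 t0) //.
by rewrite E1 big1 //= addr0.
Qed.

(** [fhom] is a direct sum over paths without [fmodule] structure, so spans over the algebras at its
    two ends are expressed by composition with [scal]. *)
Definition lspan v w (I : finType) (f : I -> fhom v w) x :=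
  exists c : I -> valg w, x = \sum_i (fcomp (scal (c i)) (f i) : fhom v w).
Definition lgenerating v w (I : finType) (f : I -> fhom v w) := forall x, lspan f x.
Definition lindependent v w (I : finType) (f : I -> fhom v w) :=
  forall c : I -> valg w, \sum_i (fcomp (scal (c i)) (f i) : fhom v w) = 0 -> forall i, c i = 0.
Definition rindependent v w (I : finType) (f : I -> fhom v w) :=
  forall c : I -> valg v, \sum_i (fcomp (f i) (scal (c i)) : fhom v w) = 0 -> forall i, c i = 0.

Section Spans.
Variables (v w : vertex Q) (I : finType) (f : I -> fhom v w).

Lemma lspan0 : lspan f 0.
Proof.
exists (fun=> 0); rewrite big1 // => i _.
by rewrite (linear_at0 (@scal_linear w)) (linear_at0 (fcomp_linl _)).
Qed.

Lemma lspanP a x y : lspan f x -> lspan f y -> lspan f (a *: x + y).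
Proof.
move=> [c ->] [d ->]; exists (fun i => a *: c i + d i).
rewrite scaler_sumr -big_split; apply: eq_bigr => i _.
by rewrite scal_linear fcomp_linl.
Qed.

Lemma lspan_sum (J : Type) (r : seq J) (g : J -> fhom v w) :
  (forall j, lspan f (g j)) -> lspan f (\sum_(j <- r) g j).
Proof.
move=> gs; elim/big_rec: _ => [|j x _ xs]; first exact: lspan0.
by rewrite -[g j]scale1r; apply: lspanP.
Qed.

Lemma lspan_elt s i : lspan f (fcomp (scal s) (f i)).
Proof.
exists (fun j => if j == i then s else 0); rewrite (bigD1 i) //= eqxx big1 ?addr0 // => j /negPf->.
by rewrite (linear_at0 (@scal_linear w)) (linear_at0 (fcomp_linl _)).
Qed.

End Spans.

Lemma id_basis v : let f := fun _ : 'I_1 => fid v in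
  [/\ lgenerating f, lindependent f & rindependent f].
Proof.
have sinj (s : valg v) : scal s = 0 -> s = 0.
  move=> /(congr1 (fun f : fhom v v => f (pnil _ v))).
  by rewrite /scal /path_incl dinj_id.
split=> [x|c|c].
- by exists (fun=> x (pnil _ v)); rewrite big_ord1 fcomp_idr -scal_surj.
- by rewrite big_ord1 fcomp_idr => /sinj c0 i; rewrite ord1.
by rewrite big_ord1 fcomp_idl => /sinj c0 i; rewrite ord1.
Qed.

Section Step.
Variables (v w : vertex Q) (wv : w <> v).
Variables (rk : forall u w' : vertex Q, arrow u w' -> nat) (n : vertex Q -> nat).
Variables (m : forall u w' (a : arrow u w'), 'I_(rk a) -> abim a).
Variable f : forall u, 'I_(n u) -> fhom v u.

Definition in_arrow : finType := {u : vertex Q & arrow u w}.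
Definition word_fam (a : in_arrow) : finType := ('I_(rk (tagged a)) * 'I_(n (tag a)))%type.
Definition word_index : finType := {a : in_arrow & word_fam a}.

Definition word_at (t : in_arrow) (p : word_fam t) : word_index := Tagged word_fam p.

Definition word_basis (i : word_index) : fhom v w :=
  fcomp (arr (m (tagged i).1)) (f (tagged i).2).

Lemma card_word_index : #|{: word_index}| = (\sum_u \sum_(a : arrow u w) rk a * n u)%N.
Proof.
rewrite card_tagged sumnE big_map big_enum /=.
under eq_bigr do rewrite card_prod !card_ord.
by rewrite (sig_big_dep (fun u => true) (fun u a => true) (fun u a => rk a * n u))%N.
Qed.

(** In [m0 x] the coefficients of [x] are moved across the tensor product and absorbed by [m0],
    which is then expanded in the generators [m]. *)
Lemma word_lgenerating :
  (forall u w' (a : arrow u w'), generating (M := left_mod (abim a)) (@m u w' a)) ->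
  (forall u, arrow u w -> lgenerating (@f u)) -> lgenerating word_basis.
Proof.
move=> mg fg; apply: fhom_prepend_ind => //; first exact: lspan0.
  exact: lspanP.
move=> u a m0 x; have [c ->] := fg u a x.
rewrite (linear_at_sum (fcomp_linr _)); apply: lspan_sum => j.
rewrite -fcomp_assoc arr_scal; have [d ->] := mg u w a (ract m0 (c j)).
rewrite (linear_at_sum (@arr_linear u w a)) (linear_at_sum (fcomp_linl _)).
apply: lspan_sum => i.
rewrite -scal_arr fcomp_assoc.
exact: (lspan_elt word_basis (d i) (@word_at (existT _ u a) (i, j))).
Qed.

(** Coordinates [co] with respect to [f] send [m0 x] to the family of the [m0 co_j(x)], a balanced
    map; the [j]-th entry of a relation is a relation between the [m i]. *)
Lemma word_lindependent :
  (forall u w' (a : arrow u w'), mod_basis (M := left_mod (abim a)) (@m u w' a)) ->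
  (forall u, arrow u w -> lgenerating (@f u) /\ lindependent (@f u)) ->
  lindependent word_basis.
Proof.
move=> mb fb.
have coE u : exists co : fhom v u -> 'I_(n u) -> valg u,
  [/\ forall a x y j, co (a *: x + y) j = a *: co x j + co y j,
      forall s x j, co (fcomp (scal s) x) j = s * co x j &
      inhabited (arrow u w) -> forall i j, co (f i) j = (j == i)%:R].
  (* Nothing is assumed about [f u] when no arrow leads from [u] to [w]; zero coordinates keep [co]
     total. *)
  have [[a]|na] := pselect (inhabited (arrow u w)); last first.
    exists (fun _ _ => 0); split=> // [*|*]; by rewrite ?scaler0 ?addr0 ?mulr0.
  have [fg fi] := fb u a; have [co cE] := choice fg; exists co.
  have uniq x d : x = \sum_i (fcomp (scal (d i)) (f i) : fhom v u) -> forall j, co x j = d j.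
    move=> xd j; apply/eqP; rewrite -subr_eq0; apply/eqP; apply: (fi (fun j => co x j - d j)).
    have E : \sum_i (fcomp (scal (co x i)) (f i) : fhom v u) -
        \sum_i (fcomp (scal (d i)) (f i) : fhom v u) = 0 by rewrite -cE -xd subrr.
    rewrite -[RHS]E -sumrB; apply: eq_bigr => i _.
    by rewrite -(linear_atB (fcomp_linl _)) -(linear_atB (@scal_linear u)).
  split.
  - move=> t x y; apply: uniq; rewrite {1}(cE x) {1}(cE y) scaler_sumr -big_split.
    by apply: eq_bigr => i _; rewrite scal_linear fcomp_linl.
  - move=> s x; apply: uniq; rewrite {1}(cE x) (linear_at_sum (fcomp_linr _)); apply: eq_bigr => i _.
    by rewrite -fcomp_assoc scal_mul.
  move=> _ i; apply: uniq; rewrite (bigD1 i) //= eqxx scal1 fcomp_idl big1 ?addr0 // => j /negPf->.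
  by rewrite (linear_at0 (@scal_linear u)) (linear_at0 (fcomp_linl _)).
pose co u := sval (cid (coE u)).
have coP u : [/\ forall a x y j, co u (a *: x + y) j = a *: co u x j + co u y j,
      forall s x j, co u (fcomp (scal s) x) j = s * co u x j &
      inhabited (arrow u w) -> forall i j, co u (f i) j = (j == i)%:R] by apply: (svalP (cid (coE u))).
pose b u w' (a : arrow u w') (m0 : abim a) (x : fhom v u) : {ffun 'I_(n u) -> abim a} :=
  [ffun j => ract m0 (co u x j)].
move=> c c0 [t0 [i0 j0]].
have G0 : \sum_(p : word_fam t0)
    b _ _ (tagged t0) (lact (c (word_at p)) (m p.1)) (f p.2) = 0.
  apply: (@last_arrow_split v _ b _ _ _ w word_fam
    (fun t p => lact (c (@word_at t p)) (m p.1)) (fun t p => f p.2)).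
  - by move=> u w' a x t m1 m2; apply/ffunP => j; rewrite !ffunE ract_linl.
  - move=> u w' a m0 t x y; apply/ffunP => j.
    by have [cl _ _] := coP u; rewrite !ffunE cl ract_linr.
  - move=> u w' a m0 s x; apply/ffunP => j.
    by have [_ cs _] := coP u; rewrite !ffunE cs ractM.
  rewrite -[RHS]c0 [RHS]sum_tagged; apply: eq_bigr => t _; apply: eq_bigr => p _.
  by rewrite /word_basis /= -fcomp_assoc scal_arr.
have [_ mi] := mb (tag t0) w (tagged t0).
apply: (mi (fun i => c (existT _ t0 (i, j0)))).
have Gj : \sum_(p : word_fam t0) ract (lact (c (word_at p)) (m p.1)) (co (tag t0) (f p.2) j0) = 0.
  transitivity ((0 : {ffun 'I_(n (tag t0)) -> abim (tagged t0)}) j0); last by rewrite ffunE.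
  by rewrite -G0 sum_ffunE; apply: eq_bigr => p _; rewrite ffunE.
have [_ _ cd] := coP (tag t0).
rewrite -[RHS]Gj; apply: etrans (esym (sum_prod _)) => /=.
apply: eq_bigr => i _; rewrite (bigD1 j0) //= cd ?eqxx ?ract1; last exact: inhabits (tagged t0).
rewrite big1 ?addr0 // => j jj0; rewrite cd; last exact: inhabits (tagged t0).
by rewrite eq_sym (negPf jj0) (linear_at0 (@ract_linr _ _ _ _ _)).
Qed.

(** Now the coordinates are taken in the bimodule: [m0 x] is sent to the family of the [co_j(m0) x],
    and each entry of a relation is a relation between right multiples of the [f j]. *)
Lemma word_rindependent :
  (forall u w' (a : arrow u w'), mod_basis (M := right_mod (abim a)) (@m u w' a)) ->
  (forall u, arrow u w -> rindependent (@f u)) ->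
  rindependent word_basis.
Proof.
move=> mb fi.
have coE u w' (a : arrow u w') : exists co : abim a -> 'I_(rk a) -> valg u,
  [/\ forall t x y j, co (t *: x + y) j = t *: co x j + co y j,
      forall s x j, co (ract x s) j = co x j * s &
      forall i j, co (m i) j = (j == i)%:R].
  have [co [cE cl ca cd]] := mod_basis_coord (mb u w' a); by exists co; split.
pose co u w' (a : arrow u w') := sval (cid (coE u w' a)).
have coP u w' (a : arrow u w') : [/\ forall t x y j, co u w' a (t *: x + y) j = t *: co u w' a x j + co u w' a y j,
      forall s x j, co u w' a (ract x s) j = co u w' a x j * s &
      forall i j, co u w' a (m i) j = (j == i)%:R] by apply: (svalP (cid (coE u w' a))).
pose b u w' (a : arrow u w') (m0 : abim a) (x : fhom v u) : {ffun 'I_(rk a) -> fhom v u} :=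
  [ffun j => fcomp (scal (co u w' a m0 j)) x].
move=> c c0 [t0 [i0 j0]].
pose y (t : in_arrow) (i : 'I_(rk (tagged t))) : fhom v (tag t) :=
  \sum_(j < n (tag t)) (fcomp (f j) (scal (c (@word_at t (i, j)))) : fhom v (tag t)).
have G0 : \sum_(i < rk (tagged t0)) b _ _ (tagged t0) (m i) (y t0 i) = 0.
  apply: (@last_arrow_split v _ b _ _ _ w (fun t : in_arrow => 'I_(rk (tagged t)))
    (fun t i => m i) y).
  - move=> u w' a x t m1 m2; apply/ffunP => j.
    by have [cl _ _] := coP u w' a; rewrite !ffunE cl scal_linear fcomp_linl.
  - by move=> u w' a m0 t x x'; apply/ffunP => j; rewrite !ffunE fcomp_linr.
  - move=> u w' a m0 s x; apply/ffunP => j.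
    by have [_ cs _] := coP u w' a; rewrite !ffunE cs -fcomp_assoc scal_mul.
  rewrite -[RHS]c0 [RHS]sum_tagged; apply: eq_bigr => t _.
  apply: etrans (esym (sum_prod _)) => /=; apply: eq_bigr => i _.
  by rewrite (linear_at_sum (fcomp_linr _)); apply: eq_bigr => j _; rewrite -fcomp_assoc.
have y0 : y t0 i0 = 0.
  transitivity ((0 : {ffun 'I_(rk (tagged t0)) -> fhom v (tag t0)}) i0); last by rewrite ffunE.
  rewrite -G0 sum_ffunE.
  have [_ _ cd] := coP _ _ (tagged t0).
  rewrite (bigD1 i0) //= ffunE cd eqxx scal1 fcomp_idl big1 ?addr0 // => i ii0.
  rewrite ffunE cd eq_sym (negPf ii0) (linear_at0 (@scal_linear _)).
  exact: (linear_at0 (fcomp_linl _)).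
exact: (fi (tag t0) (tagged t0) (fun j => c (@word_at t0 (i0, j))) y0 j0).
Qed.

End Step.

End FreeCategory.

(** One of [f] and [1 - f] is invertible, and an invertible idempotent is 1. *)
Lemma local_connected (k : fieldType) (R : falgType k) : local_algebra R ->
  forall f : R, f * f = f -> f = 0 \/ f = 1.
Proof.
move=> loc f ff.
have unit_idem (g : R) : g * g = g -> g \is a GRing.unit -> g = 1.
  by move=> gg gu; apply: (mulrI gu); rewrite gg mulr1.
have [fu|fu] := boolP (f \is a GRing.unit); first by right; apply: unit_idem.
have [gu|gu] := boolP (1 - f \is a GRing.unit).
  have E : 1 - f = 1.
    by apply: unit_idem => //; rewrite mulrBl mul1r mulrBr mulr1 ff subrr subr0.
  by left; apply: oppr_inj; rewrite oppr0; apply: (addrI 1); rewrite E addr0.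
by have := loc f (1 - f) fu gu; rewrite addrC subrK unitr1.
Qed.

(** * Bases of regular free categories, counted by paths *)

Section QuiverBases.
Variables (k : closedFieldType) (Q : bimod_quiver k).
Local Notation path := (qpath (@arrow k Q)).

Definition qheight (w : vertex Q) : nat := #|[set u : vertex Q | `[< inhabited (path u w) >]]|.

Lemma qheight_arrow u w : arrow u w -> (qheight u < qheight w)%N.
Proof.
move=> a; apply/proper_card/properP; split.
  by apply/subsetP => x; rewrite !inE => /asboolP[p]; apply/asboolP; exists; apply: pcons a p.
exists w; rewrite inE; first by apply/asboolP; exists; apply: pnil.
apply/asboolPn => -[p]; have := quiver_acyclic (pcons a p).
by [].
Qed.

Lemma qheight_path u w (p : path u w) : u = w \/ (qheight u < qheight w)%N.
Proof.
elim: p => [|x y a p [->|IH]]; [by left | right | right].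
  exact: qheight_arrow.
exact: ltn_trans IH (qheight_arrow a).
Qed.

Lemma qheight_fhom u w (f : fhom u w) : f != 0 -> u = w \/ (qheight u < qheight w)%N.
Proof.
move=> f0; have [[p]|np] := pselect (inhabited (path u w)); first exact: (qheight_path p).
by case/eqP: f0; apply: dsumP => p; case: np.
Qed.

Lemma arrow_bases (side : bool) : (if side then left_regular Q else right_regular Q) ->
  exists (rk : forall u w : vertex Q, arrow u w -> nat)
         (m : forall u w (a : arrow u w), 'I_(rk u w a) -> abim a),
  forall u w (a : arrow u w), if side then mod_basis (M := left_mod (abim a)) (m u w a)
    else mod_basis (M := right_mod (abim a)) (m u w a).
Proof.
move=> reg.
have ex (u w : vertex Q) (a : arrow u w) : exists x : {n : nat & 'I_n -> abim a},
    if side then mod_basis (M := left_mod (abim a)) (projT2 x)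
    else mod_basis (M := right_mod (abim a)) (projT2 x).
  case: side reg => reg.
    have [|n [m mb]] := projective_basis _ (reg u w a); last by exists (existT _ n m).
    exact/local_connected/valg_local.
  have [|n [m mb]] := projective_basis _ (reg u w a); last by exists (existT _ n m).
  exact/(@local_connected _ (valg u))/valg_local.
exists (fun u w a => projT1 (sval (cid (ex u w a)))).
exists (fun u w a => projT2 (sval (cid (ex u w a)))) => u w a.
exact: (svalP (cid (ex u w a))).
Qed.

Section Bases.
Variables (rk : forall u w : vertex Q, arrow u w -> nat).
Variable m : forall u w (a : arrow u w), 'I_(rk a) -> abim a.
Variable P : vertex Q -> vertex Q -> nat.
Hypothesis PE : path_count qheight (fun w u => \sum_(a : arrow u w) rk a)%N set0 P.

Lemma card_word_path_count v w : w <> v ->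
  #|{: word_index w rk (fun u => P u v)}| = P w v.
Proof.
move=> /eqP wv; rewrite card_word_index PE !inE /= (negPf wv).
rewrite [LHS](bigID (fun u => (qheight u < qheight w)%N)) /= [X in (_ + X)%N]big1 ?addn0.
  by apply: eq_bigr => u _; rewrite big_distrl.
by move=> u uw; rewrite big1 // => a; rewrite qheight_arrow in uw.
Qed.

Lemma left_bases :
  (forall u w (a : arrow u w), mod_basis (M := left_mod (abim a)) (@m u w a)) ->
  forall v w, exists f : 'I_(P w v) -> fhom v w, lgenerating f /\ lindependent f.
Proof.
move=> mb v w; have [n] := ubnP (qheight w); elim: n w => // n IH w wn.
have [->|wv] := pselect (w = v).
  rewrite PE !inE eqxx /=; exists (fun=> fid v).
  by have [] := @id_basis _ _ v.
(* Conditional on an arrow, because only then is [u] known to be lower than [w]. *)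
have ex u : exists f : 'I_(P u v) -> fhom v u, arrow u w -> lgenerating f /\ lindependent f.
  have [[a]|na] := pselect (inhabited (arrow u w)); last first.
    by exists (fun=> 0) => a; case: na.
  have [|f fb] := IH u; last by exists f.
  by apply: leq_trans (qheight_arrow a) _.
pose f u := sval (cid (ex u)).
have fb u : arrow u w -> lgenerating (f u) /\ lindependent (f u) by apply: (svalP (cid (ex u))).
have gW := word_lgenerating wv (fun u w a => (mb u w a).1) (fun u a => (fb u a).1).
have iW := word_lindependent mb fb.
rewrite -(card_word_path_count wv).
exists (fun i => word_basis m f (enum_val i)); split.
  move=> x; have [c ->] := gW x; exists (fun i => c (enum_val i)).
  by rewrite (reindex _ (onW_bij _ (@enum_val_bij (word_index w rk (fun u => P u v))))).
move=> c c0 i; have := iW (fun x => c (enum_rank x)) _ (enum_val i).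
rewrite enum_valK; apply; rewrite -[RHS]c0.
rewrite (reindex _ (onW_bij _ (@enum_val_bij (word_index w rk (fun u => P u v))))).
by apply: eq_bigr => j _; rewrite enum_valK.
Qed.

Lemma right_bases :
  (forall u w (a : arrow u w), mod_basis (M := right_mod (abim a)) (@m u w a)) ->
  forall v w, exists f : 'I_(P w v) -> fhom v w, rindependent f.
Proof.
move=> mb v w; have [n] := ubnP (qheight w); elim: n w => // n IH w wn.
have [->|wv] := pselect (w = v).
  rewrite PE !inE eqxx /=; exists (fun=> fid v).
  by have [] := @id_basis _ _ v.
have ex u : exists f : 'I_(P u v) -> fhom v u, arrow u w -> rindependent f.
  have [[a]|na] := pselect (inhabited (arrow u w)); last first.
    by exists (fun=> 0) => a; case: na.
  have [|f fb] := IH u; last by exists f.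
  by apply: leq_trans (qheight_arrow a) _.
pose f u := sval (cid (ex u)).
have fb u : arrow u w -> rindependent (f u) by apply: (svalP (cid (ex u))).
have iW := word_rindependent mb fb.
rewrite -(card_word_path_count wv).
exists (fun i => word_basis m f (enum_val i)) => c c0 i; have := iW (fun x => c (enum_rank x)) _ (enum_val i).
rewrite enum_valK; apply; rewrite -[RHS]c0.
rewrite (reindex _ (onW_bij _ (@enum_val_bij (word_index w rk (fun u => P u v))))).
by apply: eq_bigr => j _; rewrite enum_valK.
Qed.

End Bases.
End QuiverBases.

(** * The graded category *)

Section GradedCorners.
Variables (k : fieldType) (A : falgType k) (L : finType) (e : L -> A).
Variables (He : complete_primitive_orthogonal e) (Hd : directed (alg_cat He)).
Variables (N : L -> {vspace A}) (h : L -> nat) (Hp : peirce e N h).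

Local Notation J := (off_diag e).
Local Notation HJ := (directed_off_diag Hd).
Local Notation pow := (ideal_pow J).

Lemma gr_homogE i j a : dsum_fun (homog HJ i a) j =
  if i == j then qpi (pow j) (pow j.+1) a else 0.
Proof.
have [<-|ij] := eqVneq i j; first exact: dinj_id.
exact: dinj_ne.
Qed.

Lemma pow_bimul c d y j : y \in pow j -> c * y * d \in pow j.
Proof.
move=> yJ; have cy : c * y \in pow j by have := ideal_pow_mul HJ (i := 0) (memvf c) yJ.
by have := ideal_pow_mul HJ (j := 0) cy (memvf d); rewrite addn0.
Qed.

Lemma gr_bimul a b (x : gr HJ) i :
  dsum_fun (homog HJ 0 a * x * homog HJ 0 b) i =
  qpi (pow i) (pow i.+1) (a * part_repr (dsum_fun x i) * b).
Proof.
elim/gr_ind: x => [|x y IHx IHy|j c Jc].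
- by rewrite mulr0 mul0r dsum0E linear0 mulr0 mul0r linear0.
- rewrite mulrDr mulrDl !dsumDE IHx IHy -linearD; congr qpi.
  by rewrite [in RHS]linearD mulrDr mulrDl.
have E1 : homog HJ 0 a * homog HJ j c = homog HJ j (a * c).
  exact: (@gr_mul_homog k A J HJ 0 j a c (memvf a) Jc).
have acJ : a * c \in pow j by have := ideal_pow_mul HJ (i := 0) (memvf a) Jc.
have E2 : homog HJ j (a * c) * homog HJ 0 b = homog HJ j (a * c * b).
  by rewrite -[in RHS](addn0 j); apply: (@gr_mul_homog k A J HJ j 0 _ b acJ (memvf b)).
rewrite E1 E2 !gr_homogE; case: eqVneq => [<-|ji]; last first.
  by rewrite linear0 mulr0 mul0r linear0.
apply: qpi_eq; rewrite ?pow_bimul ?part_repr_in //.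
rewrite -mulrBl -mulrBr pow_bimul //.
by have := repr_qpi (pow j.+1) Jc; rewrite memv_cap => /andP[].
Qed.

Lemma mem_off_diag_crn w v a : w != v -> a \in crn e w v -> a \in J.
Proof. by move=> wv /(crnP Hp) <-; apply: mem_off_diag. Qed.

Lemma ideal_powS_prod m : (pow m.+1 <= J * pow m)%VS.
Proof.
case: m => [|m]; last by rewrite /ideal_pow expvSl.
by rewrite /= expv1; apply/subvP => x xJ; rewrite -[x]mulr1 memv_mul ?memvf.
Qed.

(** Every factor from [J] raises the height by at least one. *)
Lemma blk_pow m w v x : x \in pow m -> (h w < h v + m)%N -> e w * x * e v = 0.
Proof.
elim: m w x => [|m IH] w x xJ hwv.
  apply/eqP; apply: contraLR hwv => /(pe_height Hp)[->|]; rewrite addn0 ?ltnn //.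
  by rewrite -leqNgt => /ltnW.
suff /subvP/(_ x) : (pow m.+1 <= lker (blk e w v))%VS by rewrite memv_ker blkE => /(_ xJ)/eqP.
apply: subv_trans (ideal_powS_prod m) _; apply/prodvP => a b aJ bJ.
rewrite memv_ker blkE -[a]mulr1 -(pe_sum Hp) mulr_sumr mulr_suml mulr_sumr mulr_suml big1 //.
move=> u _; rewrite -(pe_idem Hp u).
have -> : e w * (a * (e u * e u) * b) * e v = (e w * a * e u) * (e u * b * e v) by rewrite !mulrA.
have [->|aU] := eqVneq (e w * a * e u) 0; first by rewrite mul0r.
have wu : (h u < h w)%N.
  case: (pe_height Hp aU) => // wu; case/eqP: aU; rewrite -wu.
  exact: (off_diagP He a).1.
rewrite (IH u b) ?mulr0 //; move: hwv; rewrite addnS ltnS.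
exact: leq_trans.
Qed.

Lemma pow_nilpotent : exists n, forall w v, (h w < h v + n)%N.
Proof.
exists (\max_w h w).+1 => w v; rewrite addnS ltnS; apply: leq_trans (leq_addl _ _).
exact: leq_bigmax.
Qed.

(* Not multiplicative, but it identifies the morphism spaces of the graded category
   with those of A as vector spaces. *)
Definition gr_lift (x : gr HJ) : A := dlift (fun i => @part_repr _ _ J i) x.

Fact gr_lift_linear : linear gr_lift.
Proof. by apply: dlift_linear => i a x y; rewrite part_reprP. Qed.

Lemma gr_lift_homog i a : gr_lift (homog HJ i a) = part_repr (qpi (pow i) (pow i.+1) a : gr_part J i).
Proof. by rewrite /gr_lift /homog dlift_inj // => j; rewrite linear0. Qed.

Lemma powS_le i j : (i <= j)%N -> (pow j <= pow i)%VS.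
Proof.
move=> /subnK <-; elim: (j - i)%N => [|m IH]; first by rewrite add0n.
by rewrite addSn; apply: subv_trans IH; apply: ideal_powS HJ _.
Qed.

Lemma gr_lift_pow i (x : gr HJ) : (forall j, (j < i)%N -> dsum_fun x j = 0) ->
  gr_lift x \in pow i.
Proof.
move=> x0; have [s0 xs0] := dsum_support x; pose s := undup s0.
have us : uniq s by apply: undup_uniq.
have xs j : x j != 0 -> j \in s by move=> /xs0; rewrite mem_undup.
rewrite /gr_lift (dliftE _ us xs); last by move=> j; rewrite linear0.
apply: rpred_sum => j _; have [ji|ij] := ltnP j i; first by rewrite x0 // linear0 mem0v.
exact: (subvP (powS_le ij)) (part_repr_in _).
Qed.

Definition gcorner w v (x : gr HJ) := gr_idem Hd w * x * gr_idem Hd v = x.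

Lemma gcorner_comp w v x i : gcorner w v x ->
  dsum_fun x i = qpi (pow i) (pow i.+1) (e w * part_repr (dsum_fun x i) * e v).
Proof. by move=> xc; rewrite -{1}xc gr_bimul. Qed.

(** Degree by degree: if the components below [i] vanish, [gr_lift x] agrees modulo [J^(i+1)] with a
    representative of the component of degree [i], whose class then vanishes. *)
Lemma gr_lift_inj w v x : gcorner w v x -> e w * gr_lift x * e v = 0 -> x = 0.
Proof.
move=> xc x0; apply: dsumP => i; rewrite dsum0E.
have [n] := ubnP i; elim: n i => // n IH i; rewrite ltnS => ilen.
have {}IH j : (j < i)%N -> dsum_fun x j = 0 by move=> ji; apply: IH; apply: leq_trans ji _.
rewrite (gcorner_comp _ xc); set r := part_repr _.
pose y := x - homog HJ i r.
have rE : gr_lift (homog HJ i r) = r by rewrite gr_lift_homog /r /part_repr qpi_repr.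
have yP : gr_lift y \in pow i.+1.
  apply: gr_lift_pow => j; rewrite ltnS => ji; rewrite /y dsumDE.
  have -> : dsum_fun (- homog HJ i r) j = - dsum_fun (homog HJ i r) j by [].
  rewrite gr_homogE; have [ij|ij] := eqVneq i j; last first.
    by rewrite IH ?subr0 // ltn_neqAle eq_sym ij.
  by rewrite -ij /r /part_repr qpi_repr subrr.
have yE : gr_lift y = gr_lift x - r.
  by rewrite /y -scaleN1r addrC gr_lift_linear scaleN1r rE addrC.
have eyP : e w * gr_lift y * e v \in pow i.+1.
  exact: pow_bimul.
have rP : e w * r * e v \in pow i.
  exact/pow_bimul/part_repr_in.
apply/eqP; rewrite qpi_eq0 //.
by move: eyP; rewrite yE mulrBr mulrBl x0 sub0r rpredN.
Qed.

Lemma gcorner_homog w v i b : b \in pow i -> b \in crn e w v -> gcorner w v (homog HJ i b).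
Proof.
move=> bJ bC; apply: dsumP => j; rewrite gr_bimul gr_homogE.
case: eqVneq => [<-|ij]; last by rewrite linear0 mulr0 mul0r linear0.
rewrite -[in RHS](crnP Hp _ _ _ bC); apply: qpi_eq; rewrite ?pow_bimul ?part_repr_in //.
rewrite -mulrBl -mulrBr pow_bimul // -rpredN opprB.
by have := repr_qpi (pow i.+1) bJ; rewrite memv_cap => /andP[].
Qed.

(** Successive approximation: the class of [b] in degree [i] lifts to [b] up to an error in
    [J^(i+1)], and high powers of [J] have zero corners. *)
Lemma gr_lift_surj w v a : a \in crn e w v ->
  exists2 x, gcorner w v x & e w * gr_lift x * e v = a.
Proof.
move=> aC; have [n hn] := pow_nilpotent.
have claim m i b : (i + m = n)%N -> b \in pow i -> b \in crn e w v ->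
    exists2 x, gcorner w v x & e w * gr_lift x * e v = b.
  elim: m i b => [|m IH] i b im bJ bC.
    exists 0; first by rewrite /gcorner mulr0 mul0r.
    rewrite (linear_at0 gr_lift_linear) mulr0 mul0r -(crnP Hp _ _ _ bC).
    by rewrite addn0 in im; rewrite (blk_pow bJ) // im.
  pose x := homog HJ i b.
  have xc : gcorner w v x by apply: gcorner_homog.
  pose c := b - e w * gr_lift x * e v.
  have cC : c \in crn e w v by rewrite rpredB // mem_crn.
  have cJ : c \in pow i.+1.
    rewrite /c -{1}(crnP Hp _ _ _ bC) -mulrBl -mulrBr pow_bimul // gr_lift_homog.
    by have := repr_qpi (pow i.+1) bJ; rewrite memv_cap => /andP[].
  have [|y yc yE] := IH i.+1 c _ cJ cC; first by rewrite addSnnS.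
  exists (x + y); first by rewrite /gcorner mulrDr mulrDl xc yc.
  by rewrite (linear_atD gr_lift_linear) mulrDr mulrDl yE /c addrC subrK.
exact: (claim n 0 a (add0n n) (memvf a) aC).
Qed.

(** In a product of two elements of [J], the terms whose middle vertex is [w] or [u] vanish, because
    [J] has no diagonal part. *)
Lemma decomposable_pow w u x : w != u -> x \in pow 2 -> e w * x * e u \in decomposable e w u.
Proof.
move=> wu x2; rewrite -blkE memv_preim; move: x x2; apply/subvP.
rewrite /ideal_pow expv2; apply/prodvP => a b /(off_diagP He) aJ /(off_diagP He) bJ.
rewrite -memv_preim blkE -[a]mulr1 -(pe_sum Hp) mulr_sumr mulr_suml mulr_sumr mulr_suml.
apply: rpred_sum => z _; rewrite -(pe_idem Hp z).
have -> : e w * (a * (e z * e z) * b) * e u = (e w * a * e z) * (e z * b * e u) by rewrite !mulrA.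
have [->|zw] := eqVneq z w; first by rewrite aJ mul0r mem0v.
have [->|zu] := eqVneq z u; first by rewrite bJ mulr0 mem0v.
rewrite (mem_blk_idl Hp) (crn_mul Hp (mem_crn _ _ _ _) (mem_crn _ _ _ _)) andbT.
rewrite -[e z * b * e u]mulrA mulrA; have -> : e w * a * e z * e z = e w * a * e z.
  by rewrite -mulrA (pe_idem Hp).
by apply: mem_idl; rewrite !inE negb_or zw.
Qed.

Lemma decomposable_sub w u : (decomposable e w u <= pow 2)%VS.
Proof.
apply: (blk_idl_ind Hp) => x a b; rewrite !inE negb_or => /andP[xw xu] aC bC.
rewrite /ideal_pow expv2 memv_mul //; first by apply: mem_off_diag_crn aC; rewrite eq_sym.
exact: mem_off_diag_crn bC.
Qed.

(** The degree-one component lifted to [A]; it respects the actions of [A_w] and [A_u] only modulo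
    [decomposable]. *)
Definition first_part w u (x : gr HJ) : A := e w * part_repr (dsum_fun x 1%N) * e u.

Fact first_part_linear w u : linear (first_part w u).
Proof.
move=> a x y; rewrite /first_part dsumDE dsumZE part_reprP mulrDr mulrDl.
by rewrite -scalerAr -scalerAl.
Qed.

Lemma part_repr_qpi w u a i : w != u -> a \in pow 1 -> i = 1%N ->
  e w * part_repr (qpi (pow i) (pow i.+1) a : gr_part J i) * e u - e w * a * e u
    \in decomposable e w u.
Proof.
move=> wu aJ ->; rewrite -mulrBl -mulrBr decomposable_pow // -rpredN opprB.
by have := repr_qpi (pow 2) aJ; rewrite memv_cap => /andP[].
Qed.

Lemma first_part_homog w u b : w != u -> b \in J ->
  first_part w u (homog HJ 1 b) - e w * b * e u \in decomposable e w u.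
Proof.
by move=> wu bJ; rewrite /first_part gr_homogE eqxx part_repr_qpi //= expv1.
Qed.

(** Positive powers of [J] have no diagonal part, so endomorphisms in the graded category live in
    degree zero. *)
Lemma gcorner_diag w x : gcorner w w x ->
  x = homog HJ 0 (e w * part_repr (dsum_fun x 0%N) * e w).
Proof.
move=> xc; apply: dsumP => i; rewrite gr_homogE (gcorner_comp _ xc).
case: eqVneq => [<-//|]; case: i => // i _.
rewrite (blk_pow (part_repr_in _)) ?linear0 // addnS ltnS; exact: leq_addr.
Qed.

Lemma gcorner_off w v x : w != v -> gcorner w v x -> dsum_fun x 0%N = 0.
Proof.
move=> wv xc; rewrite (gcorner_comp _ xc); apply/eqP; rewrite qpi_eq0 ?memvf //=.
by rewrite expv1; apply: mem_off_diag.
Qed.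

Lemma first_part_homogl w u c x : w != u -> c \in crn e w w ->
  first_part w u (homog HJ 0 c * x) - c * first_part w u x \in decomposable e w u.
Proof.
move=> wu cC; rewrite /first_part.
have -> : homog HJ 0 c * x = homog HJ 0 c * x * homog HJ 0 1 by rewrite -[LHS]mulr1.
rewrite gr_bimul; set r := part_repr (dsum_fun x 1).
have rJ : c * r * 1 \in pow 1.
  by rewrite mulr1; have := ideal_pow_mul HJ (i := 0) (memvf c) (part_repr_in (dsum_fun x 1)).
have <- : e w * (c * r * 1) * e u = c * (e w * r * e u).
  by rewrite mulr1 !mulrA (crnl Hp cC) (crnr Hp cC).
exact: part_repr_qpi.
Qed.

Lemma first_part_homogr w u c x : w != u -> c \in crn e u u ->
  first_part w u (x * homog HJ 0 c) - first_part w u x * c \in decomposable e w u.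
Proof.
move=> wu cC; rewrite /first_part.
have -> : x * homog HJ 0 c = homog HJ 0 1 * x * homog HJ 0 c by rewrite -[x in LHS]mul1r.
rewrite gr_bimul; set r := part_repr (dsum_fun x 1).
have rJ : 1 * r * c \in pow 1.
  rewrite mul1r; have := ideal_pow_mul HJ (j := 0) (part_repr_in (dsum_fun x 1)) (memvf c).
  by rewrite addn0.
have <- : e w * (1 * r * c) * e u = e w * r * e u * c.
  by rewrite mul1r -!mulrA (crnr Hp cC) (crnl Hp cC).
exact: part_repr_qpi.
Qed.

Lemma first_part_mul w u (x y : gr HJ) :
  dsum_fun x 0%N = 0 -> dsum_fun y 0%N = 0 -> first_part w u (x * y) = 0.
Proof.
move=> x0 y0; rewrite /first_part.
suff -> : dsum_fun (x * y) 1%N = 0 by rewrite linear0 mulr0 mul0r.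
have [s0 xs0] := dsum_support x; pose s := undup s0.
have us : uniq s by apply: undup_uniq.
have xs j : x j != 0 -> j \in s by move=> /xs0; rewrite mem_undup.
have [t0 yt0] := dsum_support y; pose t := undup t0.
have ut : uniq t by apply: undup_uniq.
have yt j : y j != 0 -> j \in t by move=> /yt0; rewrite mem_undup.
rewrite -[x * y]/(gr_mul x y) /gr_mul (dliftE _ us xs); last first.
  by move=> i; rewrite /dlift fsbigop.fsbig1 // => j _; rewrite linear0 mul0r linear0.
rewrite dsum_sumE big1 // => i _; rewrite (dliftE _ ut yt); last first.
  by move=> j; rewrite linear0 mulr0 linear0.
rewrite dsum_sumE big1 // => j _; rewrite gr_homogE; case: eqP => // ij.
case: i ij => [|i] ij; first by rewrite x0 linear0 mul0r linear0.
case: j ij => [|j] ij; first by rewrite y0 linear0 mulr0 linear0.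
by rewrite addnS in ij.
Qed.

End GradedCorners.

(** * From regular quivers of bimodules to stratifications *)

Section FreeGraded.
Variables (k : closedFieldType) (A : falgType k) (L : finType) (e : L -> A).
Variables (He : complete_primitive_orthogonal e) (Hd : directed (alg_cat He)).
Variables (N : L -> {vspace A}) (h0 : L -> nat) (Hp0 : peirce e N h0).
Local Notation J := (off_diag e).
Local Notation HJ := (directed_off_diag Hd).
Variable (Q : bimod_quiver k).

(** [T] is the inverse isomorphism on morphism spaces, with values in [gr] instead of corner types,
    so that composites become products. *)
Lemma cat_iso_graded : cat_iso (graded_cat Hd) (free_cat Q) ->
  exists F : L -> vertex Q, bijective F /\
  exists T : forall u w, fhom (F u) (F w) -> gr HJ,
  [/\ forall u w, linear (@T u w), forall u w f, gcorner w u (T u w f),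
      forall u w f, T u w f = 0 -> f = 0,
      forall u w x, gcorner w u x -> exists f, T u w f = x &
      forall u v w (g : fhom (F v) (F w)) (f : fhom (F u) (F v)),
        T u w (fcomp g f) = T v w g * T u v f].
Proof.
move=> [F [G [Fb Gb Gid Gc]]]; exists F; split=> //.
have ex u w : exists T : fhom (F u) (F w) -> corner (gr_idem Hd) u w,
    cancel (G u w) T /\ cancel T (G u w) by have [T T1 T2] := Gb u w; exists T.
pose T u w := sval (cid (ex u w)).
have TP u w : cancel (G u w) (T u w) /\ cancel (T u w) (G u w) := svalP (cid (ex u w)).
have Tl u w : linear (T u w).
  by move=> a x y; apply: (can_inj (TP u w).1); rewrite linearP !(TP u w).2.
exists (fun u w f => cval (T u w f)); split.
- by move=> u w a x y; rewrite Tl.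
- by move=> u w f; apply: cornerE.
- move=> u w f f0; rewrite -[f](TP u w).2 -(linear0 (G u w)); congr (G u w _).
  exact: val_inj.
- move=> u w x xc; have xC : x \in corner_pred (gr_idem Hd) u w by apply/eqP.
  by exists (G u w (Corner xC)); rewrite (TP u w).1.
move=> u v w g f.
have -> : fcomp g f = G u w (@Defs.comp _ (graded_cat Hd) u v w (T v w g) (T u v f)).
  by rewrite Gc !(TP _ _).2.
by rewrite (TP u w).1.
Qed.

Section Iso.
Variables (F : L -> vertex Q) (Fb : bijective F).
Variable T : forall u w, fhom (F u) (F w) -> gr HJ.
Hypothesis Tl : forall u w, linear (@T u w).
Hypothesis Tc : forall u w f, gcorner w u (@T u w f).
Hypothesis T_inj : forall u w f, @T u w f = 0 -> f = 0.
Hypothesis T_surj : forall u w x, gcorner w u x -> exists f, @T u w f = x.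
Hypothesis TM : forall u v w (g : fhom (F v) (F w)) (f : fhom (F u) (F v)),
  @T u w (fcomp g f) = T g * T f.

Definition iheight (x : L) := qheight (F x).

(** The height of the quiver also directs [A], whose corners match those of the graded algebra; path
    counts in the quiver and in [A] then obey one recursion. *)
Lemma iso_height w u x : e w * x * e u != 0 -> w = u \/ (iheight u < iheight w)%N.
Proof.
move=> x0; have [y yc yE] := gr_lift_surj Hd Hp0 (mem_crn e w u x).
have [f fE] := T_surj yc.
have f0 : f != 0.
  apply: contraNneq x0 => f0; rewrite -yE -fE f0.
  by rewrite (linear_at0 (@Tl _ _)) (linear_at0 (@gr_lift_linear _ _ _ _ _ _)) mulr0 mul0r.
by case: (qheight_fhom f0) => [/(bij_inj Fb)|]; [left | right].
Qed.

Lemma peirce_iso : peirce e N iheight.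
Proof. by case: Hp0 => *; split=> //; apply: iso_height. Qed.

(** Transports the local algebra at [F w] to [A_w] through degree zero of the graded algebra. *)
Definition hat w (s : valg (F w)) : A := e w * part_repr (dsum_fun (T (scal s)) 0%N) * e w.

Arguments hat w s : clear implicits.

Lemma hat_crn w s : hat w s \in crn e w w.
Proof. exact: mem_crn. Qed.

Lemma T_scal w (s : valg (F w)) : T (scal s) = homog HJ 0 (hat w s).
Proof. exact: (gcorner_diag Hp0 (Tc _)). Qed.

(* The image of the arrow bimodule in e_w (J / J^2) e_u, lifted to A. *)
Definition kappa u w (a : arrow (F u) (F w)) (m : abim a) : A := first_part w u (T (arr m)).

Lemma kappa_linear u w (a : arrow (F u) (F w)) : linear (@kappa u w a).
Proof. by move=> c x y; rewrite /kappa arr_linear Tl first_part_linear. Qed.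

Lemma kappa_crn u w (a : arrow (F u) (F w)) m : @kappa u w a m \in crn e w u.
Proof. exact: mem_crn. Qed.

Lemma kappa_lact u w (a : arrow (F u) (F w)) s m : w != u ->
  @kappa u w a (lact s m) - hat w s * kappa m \in decomposable e w u.
Proof.
move=> wu; rewrite /kappa -scal_arr TM T_scal.
exact: (first_part_homogl Hp0 _ wu (hat_crn s)).
Qed.

Lemma kappa_ract u w (a : arrow (F u) (F w)) s m : w != u ->
  @kappa u w a (ract m s) - kappa m * hat u s \in decomposable e w u.
Proof.
move=> wu; rewrite /kappa -arr_scal TM T_scal.
exact: (first_part_homogr Hp0 _ wu (hat_crn s)).
Qed.

(** A preimage of the degree-one class of [b] is a combination of composites of some [arr m] with
    some [f]. Unless [f] is an endomorphism, both factors have positive degree and [first_part]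
    vanishes; an endomorphism is a scalar, absorbed into [m]. *)
Lemma crn_generated u w (U : {vspace A}) : w != u -> (decomposable e w u <= U)%VS ->
  (forall (a : arrow (F u) (F w)) m, @kappa u w a m \in U) -> (crn e w u <= U)%VS.
Proof.
move=> wu dU kU; apply/subvP => b bC.
have bJ := mem_off_diag_crn Hp0 wu bC.
have xc : gcorner w u (homog HJ 1 b).
  by apply: (gcorner_homog Hd Hp0) => //; rewrite /= expv1.
have [f fE] := T_surj xc.
suff fU (f' : fhom (F u) (F w)) : first_part w u (T f') \in U.
  have := first_part_homog Hd Hp0 wu bJ; rewrite -fE (crnP Hp0 _ _ _ bC) => dE.
  by rewrite -[b](subKr (first_part w u (T f))) rpredB // (subvP dU).
have FuFw : F w <> F u by move=> /(bij_inj Fb)/eqP; rewrite (negPf wu).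
move: f' {f fE}; refine (@fhom_prepend_ind _ _ _ _ (fun f => first_part w u (T f) \in U) FuFw _ _ _) => [|c f g fU gU|x a m f].
- rewrite (linear_at0 (@Tl _ _)) (linear_at0 (@first_part_linear _ _ _ _ _ _ _ _)).
  exact: mem0v.
- by rewrite Tl first_part_linear memvD ?memvZ.
(* The middle vertex is renamed [F x], so that [T] applies to both factors. *)
have [Fi _ FK] := Fb; have xE := FK x; move: a m f; rewrite -{}xE; move: (Fi x) => {}x a m f.
have zw : w != x by apply: contraTneq (qheight_arrow a) => ->; rewrite ltnn.
have [zu|zu] := eqVneq x u; last first.
  rewrite TM first_part_mul ?mem0v //; [exact: gcorner_off zw _ | exact: gcorner_off zu _].
move: f a m; rewrite zu => f a m; rewrite (scal_surj f) arr_scal.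
exact: kU.
Qed.

Lemma dim_valg w : (\dim (crn e w w) <= \dim {: valg (F w)})%N.
Proof.
have ex c : exists s : valg (F w), c \in crn e w w -> T (scal s) = homog HJ 0 c.
  have [cC|cC] := boolP (c \in crn e w w); last by exists 0.
  have [|f fE] := @T_surj w w (homog HJ 0 c); last by exists (f (pnil _ _)); rewrite -scal_surj.
  by apply: (gcorner_homog Hd Hp0) => //; apply: memvf.
have [g gE] := choice ex.
have hatg c : c \in crn e w w -> hat w (g c) = c.
  move=> cC; rewrite /hat gE // gr_homogE eqxx.
  apply/eqP; rewrite -subr_eq0 -[X in _ - X](crnP Hp0 _ _ _ cC) -mulrBl -mulrBr.
  have := repr_qpi (ideal_pow J 1) (memvf c : c \in ideal_pow J 0); rewrite memv_cap => /andP[_].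
  rewrite -rpredN opprB; move: (_ - c) => z; rewrite /= expv1.
  by move=> /(off_diagP He)/(_ w) ->.
have hatl : linear (hat w).
  move=> c s t; rewrite /hat scal_linear Tl dsumDE dsumZE part_reprP mulrDr mulrDl.
  by rewrite -scalerAr -scalerAl.
by apply: (linear_onto_dim hatl _).1 => c cC; exists (g c); apply: hatg.
Qed.

(** Injections into the free category become bounds in [A], since [T] and, on corners, [gr_lift] are
    injective. *)
Lemma dim_crn_injection v w (V : vectType k) (b : V -> fhom (F v) (F w)) :
  linear b -> (forall x, b x = 0 -> x = 0) -> (\dim {: V} <= \dim (crn e w v))%N.
Proof.
move=> bl b0; pose b' x : A := blk e w v (gr_lift (T (b x))).
have bl' : linear b'.
  by move=> c x y; rewrite /b' bl Tl gr_lift_linear linearP.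
apply: (linear_inj_dim bl') => x; first by rewrite /b' blkE mem_crn.
by rewrite /b' blkE => /(gr_lift_inj (Tc _))/T_inj/b0.
Qed.

Section Bases.
Variables (rk : forall u w : vertex Q, arrow u w -> nat).
Variable m : forall u w (a : arrow u w), 'I_(rk a) -> abim a.

Definition kappas w u : seq A :=
  flatten [seq [seq kappa (m i) | i <- enum 'I_(rk a)] | a <- enum (arrow (F u) (F w))].

Lemma size_kappas w u : size (kappas w u) = (\sum_(a : arrow (F u) (F w)) rk a)%N.
Proof.
rewrite size_flatten sumnE big_map big_map big_enum; apply: eq_bigr => a _.
by rewrite /= size_map size_enum_ord.
Qed.

Lemma mem_kappas u w (a : arrow (F u) (F w)) i : kappa (@m _ _ a i) \in kappas w u.
Proof.
by apply/flatten_mapP; exists a; rewrite ?mem_enum //; apply: map_f; rewrite mem_enum.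
Qed.

Lemma kappas_crn w u : {subset kappas w u <= crn e w u}.
Proof. by move=> x /flatten_mapP[a _ /mapP[i _ ->]]; apply: kappa_crn. Qed.

Lemma path_count_vertex P (Fi : vertex Q -> L) : cancel F Fi -> cancel Fi F ->
  path_count iheight (fun w u => \sum_(a : arrow (F u) (F w)) rk a)%N set0 P ->
  path_count (@qheight k Q) (fun w u => \sum_(a : arrow u w) rk a)%N set0
    (fun w v => P (Fi w) (Fi v)).
Proof.
move=> FK FiK PE w v; rewrite PE !inE /= (can_eq FiK); case: ifP => // _.
rewrite (reindex F) /=; last by exists Fi => x _.
by apply: eq_big => [u|u _]; rewrite /iheight ?FK ?FiK.
Qed.

Lemma kappas_lgenerating w u : (iheight u < iheight w)%N ->
  (forall (a : arrow (F u) (F w)), generating (M := left_mod (abim a)) (@m _ _ a)) ->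
  (crn e w u <= decomposable e w u + \sum_(x <- kappas w u) crn e w w * <[x]>)%VS.
Proof.
move=> uw mg; have wu : w != u by apply: contraTneq uw => ->; rewrite ltnn.
apply: (crn_generated wu) => [|a x]; first exact: addvSl.
have [c ->] := mg a x; rewrite /comb (linear_at_sum (@kappa_linear _ _ _)).
apply: memv_suml => i _; have := kappa_lact (c i) (m i) wu.
set y := kappa _; set z := _ * _ => yz; rewrite -[y](subrK z); apply: memv_add => //.
by apply: sum_line_mem (hat_crn _); apply: mem_kappas.
Qed.

Lemma left_counts P :
  (forall u w (a : arrow u w), mod_basis (M := left_mod (abim a)) (@m u w a)) ->
  path_count iheight (fun w u => size (kappas w u)) set0 P ->
  forall w v, (P w v * \dim (crn e w w) <= \dim (crn e w v))%N.
Proof.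
move=> mb PE w v; have [Fi FK FiK] := Fb.
have PE' : path_count iheight (fun w u => \sum_(a : arrow (F u) (F w)) rk a)%N set0 P.
  move=> x y; rewrite PE; case: ifP => // _; case: ifP => // _.
  by apply: eq_bigr => z _; rewrite size_kappas.
have [f [_]] := left_bases (path_count_vertex FK FiK PE') mb (F v) (F w).
move: f; rewrite !FK => f fi; apply: leq_trans (leq_mul (leqnn _) (dim_valg w)) _.
rewrite -dim_ffun.
apply: (dim_crn_injection (b := fun c : {ffun 'I_(P w v) -> valg (F w)} =>
  \sum_i (fcomp (scal (c i)) (f i) : fhom (F v) (F w)))) => [c x y|x x0].
  rewrite scaler_sumr -big_split; apply: eq_bigr => i _.
  by rewrite !ffunE scal_linear fcomp_linl.
by apply/ffunP => i; rewrite ffunE; apply: fi x0 i.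
Qed.

Lemma left_stratified key :
  (forall u w (a : arrow u w), mod_basis (M := left_mod (abim a)) (@m u w a)) ->
  injective key -> stratified_dims e N key.
Proof.
move=> mb; apply: (free_stratified peirce_iso (X := kappas)) => [w u _|w u uw|P PE].
- exact: kappas_crn.
- by apply: kappas_lgenerating => // a; apply: (mb _ _ a).1.
exact: left_counts.
Qed.

Local Notation coheight := (reversed_height iheight).

Lemma kappas_rgenerating w u : (iheight w < iheight u)%N ->
  (forall (a : arrow (F w) (F u)), generating (M := right_mod (abim a)) (@m _ _ a)) ->
  (crn (eC e) w u <= decomposable (eC e) w u +
     \sum_(x <- kappas u w) crn (eC e) w w * <[x : A^c]>)%VS.
Proof.
move=> wu mg; have uw : u != w by apply: contraTneq wu => ->; rewrite ltnn.
have dE : decomposable e u w = decomposable (eC e) w u :> {vspace A}.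
  by rewrite /decomposable (conv_idl e) conv_blk setUC.
rewrite -conv_crn -[decomposable (eC e) w u]dE.
apply: (crn_generated uw) => [|a x]; first exact: addvSl.
have [c ->] := mg a x; rewrite /comb (linear_at_sum (@kappa_linear _ _ _)).
apply: memv_suml => i _; have := kappa_ract (c i) (m i) uw.
set y := kappa _; set z := _ * _ => yz; rewrite -[y](subrK z); apply: memv_add => //.
apply: (@sum_line_mem _ A^c _ _ (kappa (m i)) (hat w (c i))); first exact: mem_kappas.
by rewrite -[crn (eC e) w w]conv_crn hat_crn.
Qed.

(** The recursion for [A^c] extends paths at the source, whereas [right_bases] counts them by their
    last arrow; [path_count_transpose] reconciles the two. *)
Lemma right_counts P :
  (forall u w (a : arrow u w), mod_basis (M := right_mod (abim a)) (@m u w a)) ->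
  path_count coheight (fun w u => size (kappas u w)) set0 P ->
  forall w v, (P w v * \dim (crn (eC e) w w) <= \dim (crn (eC e) w v))%N.
Proof.
move=> mb PE w v; have [Fi FK FiK] := Fb.
have [P' PE'] := path_count_exists iheight (fun w u => \sum_(a : arrow (F u) (F w)) rk a)%N.
rewrite (path_count_transpose (reversed_height_lt iheight) _ (PE' set0) PE); last first.
  by move=> x y; rewrite size_kappas.
have [f] := right_bases (path_count_vertex FK FiK (PE' set0)) mb (F w) (F v).
move: f; rewrite !FK => f fi; rewrite -!(conv_crn e).
apply: leq_trans (leq_mul (leqnn _) (dim_valg w)) _.
rewrite -dim_ffun.
apply: (dim_crn_injection (b := fun c : {ffun 'I_(P' set0 v w) -> valg (F w)} =>
  \sum_i (fcomp (f i) (scal (c i)) : fhom (F w) (F v)))) => [c x y|x x0].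
  rewrite scaler_sumr -big_split; apply: eq_bigr => i _.
  by rewrite !ffunE scal_linear fcomp_linr.
by apply/ffunP => i; rewrite ffunE; apply: fi x0 i.
Qed.

Lemma right_stratified key :
  (forall u w (a : arrow u w), mod_basis (M := right_mod (abim a)) (@m u w a)) ->
  injective key -> stratified_dims (eC e) (N : L -> {vspace A^c}) key.
Proof.
move=> mb; apply: (free_stratified (peirce_conv (reversed_height_lt iheight) peirce_iso)
  (X := fun w u => kappas u w)) => [w u _|w u uw|P PE].
- by move=> x /kappas_crn; rewrite conv_crn.
- by apply: kappas_rgenerating => [|a]; [rewrite -(reversed_height_lt iheight)|apply: (mb _ _ a).1].
exact: right_counts.
Qed.

End Bases.
End Iso.

Lemma free_standardly_dims key :
  left_regular Q -> cat_iso (graded_cat Hd) (free_cat Q) ->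
  injective key -> stratified_dims e N key.
Proof.
move=> /(@arrow_bases _ _ true)[rk [m mb]] /cat_iso_graded[F [Fb [T [Tl Tc Ti Ts TM]]]].
exact: (left_stratified Fb Tl Tc Ti Ts TM mb).
Qed.

Lemma free_properly_dims key :
  right_regular Q -> cat_iso (graded_cat Hd) (free_cat Q) ->
  injective key -> stratified_dims (eC e) (N : L -> {vspace A^c}) key.
Proof.
move=> /(@arrow_bases _ _ false)[rk [m mb]] /cat_iso_graded[F [Fb [T [Tl Tc Ti Ts TM]]]].
exact: (right_stratified Fb Tl Tc Ti Ts TM mb).
Qed.
End FreeGraded.

(** * The quiver of bimodules of an algebra *)

Lemma acyclic_height (V : Type) (E : V -> V -> Type) (h : V -> nat) :
  (forall u w, E u w -> (h u < h w)%N) -> acyclic E.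
Proof.
move=> Eh v p.
have path_height u (q : qpath E v u) : v = u \/ (h v < h u)%N.
  elim: q => [|x y a q [->|IH]]; [by left | by right; apply: Eh | right].
  exact: ltn_trans IH (Eh _ _ a).
(* The end vertex is freed and tied to [v] by an equation, so that the path can be destructed. *)
suff /(_ v p erefl) : forall u (q : qpath E v u) (uv : u = v),
    ecast u (qpath E v u) uv q = pnil E v by [].
move=> u {}p; case: p => [uv|x y a q yv]; first by rewrite (Prop_irrelevance uv erefl).
exfalso; have := Eh _ _ a; rewrite yv => xv; case: (path_height x q) => [vx|vx].
  by rewrite vx ltnn in xv.
by have := ltn_trans vx xv; rewrite ltnn.
Qed.

(** A surjection from the free module of rank [n] onto a space at least as large is injective. *)
Lemma generating_mod_basis (k : fieldType) (R : falgType k) (M : fmodule R) n (m : 'I_n -> M) :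
  generating m -> (n * \dim {: R} <= \dim {: M})%N -> mod_basis m.
Proof.
move=> mg dM; split=> //.
pose f (c : {ffun 'I_n -> R}) : M := comb m c.
have fl : linear f.
  by move=> a c d; rewrite /f -combD; apply: eq_bigr => i _; rewrite !ffunE.
have [x _|_ inj c c0 j] := @linear_onto_dim _ _ _ f fullv fl.
  have [c ->] := mg x; exists [ffun i => c i]; apply: eq_bigr => i _.
  by rewrite ffunE.
have fc : f [ffun i => c i] = 0 by rewrite -c0; apply: eq_bigr => i _; rewrite ffunE.
rewrite dim_ffun in inj; have /ffunP/(_ j) := inj dM _ fc.
by rewrite !ffunE.
Qed.

Lemma sum_line_coef (k : fieldType) (A : falgType k) (C : {vspace A}) (ys : seq A) z :
  z \in (\sum_(y <- ys) C * <[y]>)%VS ->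
  exists2 c : 'I_(size ys) -> A, forall i, c i \in C & z = \sum_i c i * ys`_i.
Proof.
elim: ys z => [|y ys IH] z.
  rewrite big_nil memv0 => /eqP->; exists (fun=> 0) => [i|]; first exact: mem0v.
  by rewrite big_ord0.
rewrite big_cons => /memv_addP[u + [x /IH[c cC ->] ->]].
rewrite -limg_amulr => /memv_imgP[b bC ->]; rewrite lfunE /=.
exists (fun i => if unlift ord0 i is Some j then c j else b) => [i|].
  by case: unliftP => [j _|_].
rewrite big_ord_recl unlift_none /=; congr (_ + _).
by apply: eq_bigr => i _; rewrite liftK.
Qed.

Section AlgebraQuiver.
Variables (k : closedFieldType) (A : falgType k) (L : finType) (e : L -> A).
Variables (N : L -> {vspace A}) (h : L -> nat) (Hp : peirce e N h).

Lemma idem_neq0 i : e i != 0.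
Proof. by apply: contraNneq (pe_notin Hp i) => ->; apply: mem0v. Qed.

Definition valg_at (i : L) : falgType k := crn_alg (pe_idem Hp) idem_neq0 i.

Lemma valg_at_mem i (x : valg_at i) : vsval x \in crn e i i.
Proof. exact: subvsP. Qed.

Lemma valg_at1 i : vsval (1 : valg_at i) = e i.
Proof. exact: crn_alg1. Qed.

Lemma valg_at_local i : local_algebra (valg_at i).
Proof.
have linv (x : valg_at i) : vsval x \notin N i -> exists z, z * x = 1.
  move=> xN; have [z zx] := peirce_unit Hp (valg_at_mem x) xN.
  exists (Subvs (mem_crn e i i z) : valg_at i); apply: val_inj; rewrite [RHS]valg_at1 /=.
  by rewrite -mulrA (crnl Hp (valg_at_mem x)) -mulrA zx (pe_idem Hp).
have nonunit (x : valg_at i) : vsval x \in N i -> forall z, z * x <> 1.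
  move=> xN z zx; case/negP: (pe_notin Hp i); rewrite -(valg_at1 i) -zx.
  rewrite -(crnl Hp (valg_at_mem (z * x))) /= mulrA.
  exact: (pe_mull Hp).
have unitN (x : valg_at i) : (x \is a GRing.unit) = (vsval x \notin N i).
  apply/idP/idP => [xu|/linv[z zx]].
    by apply/negP => xN; apply: (nonunit x xN x^-1); rewrite mulVr.
  have zN : vsval z \notin N i.
    apply/negP => zN; apply: (nonunit 1); last exact: (mulr1 1).
    rewrite -zx /= -(crnr Hp (valg_at_mem x)) mulrA.
    exact: (pe_mulr Hp).
  have [t tz] := linv z zN; apply/unitrP; exists z; split=> //.
  by rewrite -[RHS]tz -[t]mulr1 -zx mulrA tz mul1r.
by move=> x y; rewrite !unitN !negbK => xN yN; rewrite /= rpredD.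
Qed.

Section IrreducibleBimodule.
Variables v w : L.

(** For [w != v] the bimodule [e_w (J / J^2) e_v], formed inside [A] rather than in the graded
    algebra. *)
Definition irr : vectType k := subquot (crn e w v) (decomposable e w v).
Definition irr_pi (x : A) : irr := qpi (crn e w v) (decomposable e w v) x.
Definition irr_lact (r : valg_at w) (x : irr) : irr := irr_pi (vsval r * qrepr x).
Definition irr_ract (x : irr) (s : valg_at v) : irr := irr_pi (qrepr x * vsval s).

Lemma decomposable_crn : (decomposable e w v <= crn e w v)%VS.
Proof. exact: blk_idl_sub. Qed.

Lemma decomposable_mull c d : c \in crn e w w -> d \in decomposable e w v ->
  c * d \in decomposable e w v.
Proof.
rewrite /decomposable !(mem_blk_idl Hp) => cC /andP[dI dC].
by rewrite idl_mull // (crn_mul Hp cC dC).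
Qed.

Lemma decomposable_mulr c d : c \in crn e v v -> d \in decomposable e w v ->
  d * c \in decomposable e w v.
Proof.
rewrite /decomposable !(mem_blk_idl Hp) => cC /andP[dI dC].
by rewrite idl_mulr // (crn_mul Hp dC cC).
Qed.

Lemma irr_repr_pi x : x \in crn e w v -> qrepr (irr_pi x) - x \in decomposable e w v.
Proof.
move=> xC; have := repr_qpi (decomposable e w v) xC.
by rewrite memv_cap => /andP[_]; rewrite -rpredN opprB.
Qed.

Lemma irr_pi_eq x y : x \in crn e w v -> x - y \in decomposable e w v -> irr_pi x = irr_pi y.
Proof.
move=> xC xyD; apply: qpi_eq => //; rewrite -[y](subKr x) rpredB //.
exact: (subvP decomposable_crn).
Qed.

Lemma irr_lact_pi r x : x \in crn e w v -> irr_lact r (irr_pi x) = irr_pi (vsval r * x).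
Proof.
move=> xC; apply: irr_pi_eq; first exact: (crn_mul Hp) (valg_at_mem r) (qrepr_in _).
by rewrite -mulrBr decomposable_mull ?valg_at_mem ?irr_repr_pi.
Qed.

Lemma irr_ract_pi s x : x \in crn e w v -> irr_ract (irr_pi x) s = irr_pi (x * vsval s).
Proof.
move=> xC; apply: irr_pi_eq; first exact: (crn_mul Hp) (qrepr_in _) (valg_at_mem s).
by rewrite -mulrBl decomposable_mulr ?valg_at_mem ?irr_repr_pi.
Qed.

Lemma irr_piP (x : irr) : exists2 y, y \in crn e w v & x = irr_pi y.
Proof. by exists (qrepr x); [apply: qrepr_in | rewrite /irr_pi qpi_repr]. Qed.

Fact irr_lact_linl x : linear (irr_lact^~ x).
Proof. by move=> a r s; rewrite /irr_lact linearP mulrDl -scalerAl /irr_pi linearP. Qed.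
Fact irr_lact_linr r : linear (irr_lact r).
Proof. by move=> a x y; rewrite /irr_lact linearP mulrDr -scalerAr /irr_pi linearP. Qed.
Fact irr_ract_linl s : linear (irr_ract^~ s).
Proof. by move=> a x y; rewrite /irr_ract linearP mulrDl -scalerAl /irr_pi linearP. Qed.
Fact irr_ract_linr x : linear (irr_ract x).
Proof. by move=> a r s; rewrite /irr_ract linearP mulrDr -scalerAr /irr_pi linearP. Qed.
Fact irr_lact1 x : irr_lact 1 x = x.
Proof. by have [y yC ->] := irr_piP x; rewrite irr_lact_pi // valg_at1 (crnl Hp yC). Qed.
Fact irr_ract1 x : irr_ract x 1 = x.
Proof. by have [y yC ->] := irr_piP x; rewrite irr_ract_pi // valg_at1 (crnr Hp yC). Qed.
Fact irr_lactM r r' x : irr_lact (r * r') x = irr_lact r (irr_lact r' x).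
Proof.
have [y yC ->] := irr_piP x; rewrite !irr_lact_pi ?(crn_mul Hp (valg_at_mem _) yC) //.
by rewrite crn_algM mulrA.
Qed.
Fact irr_ractM s s' x : irr_ract x (s * s') = irr_ract (irr_ract x s) s'.
Proof.
have [y yC ->] := irr_piP x; rewrite !irr_ract_pi ?(crn_mul Hp yC (valg_at_mem _)) //.
by rewrite crn_algM mulrA.
Qed.
Fact irr_lractA r x s : irr_ract (irr_lact r x) s = irr_lact r (irr_ract x s).
Proof.
have [y yC ->] := irr_piP x; have ry := crn_mul Hp (valg_at_mem r) yC.
have ys := crn_mul Hp yC (valg_at_mem s).
by rewrite irr_lact_pi // !irr_ract_pi // irr_lact_pi // mulrA.
Qed.

Definition irr_bimod : bimod (valg_at w) (valg_at v) :=
  Bimod irr_lact_linl irr_lact_linr irr_ract_linl irr_ract_linr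
        irr_lact1 irr_ract1 irr_lactM irr_ractM irr_lractA.

Lemma dim_irr : \dim {: irr} = irr_dim e w v.
Proof.
rewrite dimvf /dim /=; have := dimv_cap_compl (crn e w v) (decomposable e w v).
by rewrite (capv_idPr decomposable_crn) /irr_dim => <-; rewrite addKn.
Qed.

End IrreducibleBimodule.

(* 'I_b has one element if b holds and none otherwise. *)
Definition irr_arrow (v w : L) : finType := 'I_((v != w) && (crn e w v != 0%VS)).

Lemma irr_arrow_height u w : irr_arrow u w -> (h u < h w)%N.
Proof.
rewrite /irr_arrow; case: andP => [[uw C0] _|_ []//].
by rewrite ltnNge; apply: contra C0 => wu; rewrite (crn_eq0 Hp) // eq_sym.
Qed.

Lemma irr_arrow_neq u w : irr_arrow u w -> w != u.
Proof. by move=> /irr_arrow_height; apply: contraTneq => ->; rewrite ltnn. Qed.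

(** A single arrow carries the whole bimodule [e_w (J / J^2) e_v], which may be zero. *)
Definition algebra_quiver : bimod_quiver k :=
  @BimodQuiver k L irr_arrow (acyclic_height irr_arrow_height)
    valg_at valg_at_local (fun v w _ => irr_bimod v w).

End AlgebraQuiver.

(** * Freeness of the irreducible bimodules *)

Section IrreducibleBases.
Variables (k : closedFieldType) (A : falgType k) (L : finType) (e : L -> A).
Variables (N : L -> {vspace A}) (h : L -> nat) (Hp : peirce e N h).

Lemma irr_left_generators v w :
  exists m : 'I_(irr_rank e N w v) -> irr e v w, generating (M := left_mod (irr_bimod Hp v w)) m.
Proof.
have [ys [szE ysC gen]] := top_generators Hp (~: [set w; v]) w v.
have rE : irr_rank e N w v = size ys by rewrite szE (rad_rankE Hp).
rewrite rE; exists (fun i => irr_pi e v w ys`_i) => x.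
have [y yC ->] := irr_piP x; have /memv_addP[z + [d dD yE]] := subvP gen y yC.
move=> /sum_line_coef[c cC zE].
have ysC' i : (i < size ys)%N -> ys`_i \in crn e w v by move=> ?; apply/ysC/mem_nth.
exists (fun i => Subvs (cC i) : valg_at Hp w).
transitivity (irr_pi e v w z).
  by apply: irr_pi_eq => //; rewrite yE addrC addKr.
rewrite zE /comb /irr_pi linear_sum; apply: eq_bigr => i _.
by rewrite /act /= irr_lact_pi ?ysC'.
Qed.

Lemma irr_right_generators v w :
  exists m : 'I_(irr_rank (eC e) (N : L -> {vspace A^c}) v w) -> irr e v w,
    generating (M := right_mod (irr_bimod Hp v w)) m.
Proof.
have Hc := peirce_conv (reversed_height_lt h) Hp.
have [ys [szE ysC gen]] := top_generators Hc (~: [set v; w]) v w.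
have rE : irr_rank (eC e) (N : L -> {vspace A^c}) v w = size ys.
  by rewrite szE (rad_rankE Hc).
have dE : decomposable e w v = decomposable (eC e) v w :> {vspace A}.
  by rewrite /decomposable (conv_idl e) conv_blk setUC.
rewrite rE; exists (fun i => irr_pi e v w ys`_i) => x.
have [y yC ->] := irr_piP x; have yC' := yC; rewrite [crn e w v]conv_crn in yC'.
have /memv_addP[z + [d dD yE]] := subvP gen y yC'.
move=> /sum_line_coef[c cC zE].
have ysC' i : (i < size ys)%N -> ys`_i \in crn e w v.
  by move=> ?; rewrite [crn e w v]conv_crn; apply/ysC/mem_nth.
have cC' i : (c i : A) \in crn e v v by rewrite [crn e v v]conv_crn.
exists (fun i => Subvs (cC' i) : valg_at Hp v).
transitivity (irr_pi e v w z).
  apply: irr_pi_eq => //; rewrite [decomposable e w v]dE.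
  by rewrite yE addrC addKr.
rewrite zE /comb /irr_pi linear_sum; apply: eq_bigr => i _.
by rewrite /act /= irr_ract_pi ?ysC'.
Qed.

Hypothesis sdA : forall key : L -> nat, injective key -> stratified_dims e N key.

Lemma irr_left_basis v w : w != v ->
  exists m : 'I_(irr_rank e N w v) -> irr e v w, mod_basis (M := left_mod (irr_bimod Hp v w)) m.
Proof.
move=> wv; have [m mg] := irr_left_generators v w; exists m.
apply: generating_mod_basis => //; rewrite [\dim {: left_mod _}]dim_irr.
have -> : \dim {: valg_at Hp w} = \dim (crn e w w) by rewrite dimvf.
exact: (irr_dim_rank Hp sdA wv).
Qed.

Lemma algebra_quiver_left_regular : left_regular (algebra_quiver Hp).
Proof.
move=> v w a; have [m mb] := irr_left_basis (irr_arrow_neq Hp a).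
exact: mod_basis_projective mb.
Qed.

Lemma algebra_quiver_right_regular :
  (forall key : L -> nat, injective key ->
     stratified_dims (eC e) (N : L -> {vspace A^c}) key) ->
  right_regular (algebra_quiver Hp).
Proof.
move=> sdC v w a; have wv := irr_arrow_neq Hp a.
have Hc := peirce_conv (reversed_height_lt h) Hp.
have [m mg] := irr_right_generators v w; 
suff mb : mod_basis (M := right_mod (irr_bimod Hp v w)) m by exact: mod_basis_projective mb.
apply: generating_mod_basis => //; rewrite [\dim {: right_mod _}]dim_irr.
have -> : \dim {: (valg_at Hp v)^c} = \dim (crn (eC e) v v).
  by rewrite -(conv_crn e) [LHS]dimvf.
have -> : irr_dim e w v = irr_dim (eC e) v w.
  rewrite /irr_dim -(conv_crn e); congr (_ - \dim _)%N.
  by rewrite /decomposable (conv_idl e) conv_blk setUC.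
by apply: (irr_dim_rank Hc sdC); rewrite eq_sym.
Qed.

End IrreducibleBases.

(** * The functor from the free category on the irreducible bimodules to the graded category *)

Section Realization.
Variables (k : closedFieldType) (A : falgType k) (L : finType) (e : L -> A).
Variables (He : complete_primitive_orthogonal e) (Hd : directed (alg_cat He)).
Variables (N : L -> {vspace A}) (h : L -> nat) (Hp : peirce e N h).
Local Notation J := (off_diag e).
Local Notation HJ := (directed_off_diag Hd).
Local Notation pow := (ideal_pow J).
Local Notation Q := (algebra_quiver Hp).
Local Notation path := (qpath (@arrow k Q)).

Lemma homogM i j a b : a \in pow i -> b \in pow j ->
  homog HJ i a * homog HJ j b = homog HJ (i + j) (a * b).
Proof. exact: gr_mul_homog. Qed.

Lemma crn_pow1 w v x : w != v -> x \in crn e w v -> x \in pow 1.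
Proof. by move=> wv xC; rewrite /= expv1; apply: (mem_off_diag_crn Hp wv). Qed.

(** Two representatives differ by decomposables, which lie in [J^2] and vanish in degree one. *)
Lemma homog_irr_pi v w x : w != v -> x \in crn e w v ->
  homog HJ 1 (qrepr (irr_pi e v w x)) = homog HJ 1 x.
Proof.
move=> wv xC; apply: homog_eq; try exact: (crn_pow1 wv); first exact/(crn_pow1 wv)/qrepr_in.
exact: (subvP (decomposable_sub Hp w v)) (irr_repr_pi xC).
Qed.

Lemma homog_repr_linear v w : linear (fun m : irr e v w => homog HJ 1 (qrepr m)).
Proof. by move=> c x y; rewrite !linearP. Qed.

Lemma homog_lact v w (r : valg_at Hp w) (m : irr e v w) : w != v ->
  homog HJ 1 (qrepr (irr_lact r m)) = homog HJ 0 (vsval r) * homog HJ 1 (qrepr m).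
Proof.
move=> wv; have mC : qrepr m \in crn e w v by apply: qrepr_in.
rewrite homogM ?memvf ?(crn_pow1 wv) // homog_irr_pi //.
exact: (crn_mul Hp) (valg_at_mem r) mC.
Qed.

Lemma homog_ract v w (s : valg_at Hp v) (m : irr e v w) : w != v ->
  homog HJ 1 (qrepr (irr_ract m s)) = homog HJ 1 (qrepr m) * homog HJ 0 (vsval s).
Proof.
move=> wv; have mC : qrepr m \in crn e w v by apply: qrepr_in.
rewrite homogM ?memvf ?(crn_pow1 wv) // homog_irr_pi //.
exact: (crn_mul Hp) mC (valg_at_mem s).
Qed.

Fixpoint realize_path v w (p : path v w) : Mpath p -> gr HJ :=
  match p in qpath _ _ w0 return Mpath p -> gr HJ with
  | pnil => fun x => homog HJ 0 (vsval (x : valg_at Hp v))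
  | pcons u w' a p' => fun x =>
      @tlift k _ _ _ (irr_bimod Hp u w') (Mpath p') (gr HJ)
        (fun (m : irr e u w') y => homog HJ 1 (qrepr m) * realize_path y) x
  end.

Lemma realize_path_linear v w (p : path v w) : linear (@realize_path v w p).
Proof.
case: p => [|u w' a p]; last exact: tlift_linear.
by move=> a x y; rewrite /= !linearP.
Qed.

(** Evaluating on a pure tensor requires balance, that is, left linearity on the shorter path. As
    this linearity is itself proved by such evaluations, it enters as a hypothesis, and
    [realize_path_lact] closes the induction. *)
Lemma realize_pure_lact v u w (a : arrow (b := Q) u w) (p : path v u) (m : irr e u w) (y : Mpath p) :
  (forall (s : valg_at Hp u) (z : Mpath p),
     realize_path (lact s z) = homog HJ 0 (vsval s) * realize_path z) ->
  @realize_path v w (pcons a p) (@pure k _ _ _ (abim a) (Mpath p) m y) =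
    homog HJ 1 (qrepr m) * realize_path y.
Proof.
move=> lp; rewrite /= tlift_pure // => [z c x x'|x c z z'|x s z].
- by rewrite [X in X * _](homog_repr_linear c x x') mulrDl -scalerAl.
- by rewrite realize_path_linear mulrDr -scalerAr.
have E := homog_ract s x (irr_arrow_neq Hp a).
rewrite lp mulrA -E.
by [].
Qed.

Lemma realize_path_lact v w (p : path v w) (s : valg_at Hp w) (x : Mpath p) :
  realize_path (lact s x) = homog HJ 0 (vsval s) * realize_path x.
Proof.
elim: p s x => [|u w' a p IH] s x; first by rewrite /= homogM ?memvf.
move: x; apply: tens_ext => [c x x'|c x x'|m y].
- by rewrite (@lact_linr _ _ _ (Mpath (pcons a p))) realize_path_linear.
- by rewrite realize_path_linear mulrDr -scalerAr.
pose M := irr_bimod Hp u w'.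
have El : lact s (@pure k _ _ _ M (Mpath p) m y : Mpath (pcons a p)) =
    @pure k _ _ _ M (Mpath p) (irr_lact s m) y.
  exact: (@tens_lact_pure k _ _ _ M (Mpath p) s m y).
have E n := realize_pure_lact a n y IH.
have E1 := E m; have E2 := E (irr_lact s m).
rewrite (homog_lact s m (irr_arrow_neq Hp a)) in E2.
apply: etrans (congr1 (@realize_path v w' (pcons a p)) El) _.
apply: etrans E2 _; rewrite -mulrA; congr (_ * _); exact: esym E1.
Qed.

Lemma realize_pure v u w (a : arrow (b := Q) u w) (p : path v u) (m : irr e u w) (y : Mpath p) :
  @realize_path v w (pcons a p) (@pure k _ _ _ (abim a) (Mpath p) m y) =
    homog HJ 1 (qrepr m) * realize_path y.
Proof. by apply: realize_pure_lact => s z; apply: realize_path_lact. Qed.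

Lemma realize_mcat v w u (q : path w u) (p : path v w) (x : Mpath q) (y : Mpath p) :
  realize_path (mcat x y) = realize_path x * realize_path y.
Proof.
elim: q x => [|w' u' a q IH] x; first exact: realize_path_lact.
move: x; apply: tens_ext => [c x x'|c x x'|m x].
- by rewrite (mcat_linl (q := pcons a q)) realize_path_linear.
- by rewrite realize_path_linear mulrDl -scalerAl.
have E1 := realize_pure a m x; have E2 := realize_pure (p := pcat q p) a m (mcat x y).
have E3 := mcat_pcons (a := a) m x y.
rewrite IH mulrA -E1 in E2.
exact (etrans (congr1 (@realize_path v u' (pcons a (pcat q p))) E3) E2).
Qed.

Definition realize v w (f : fhom (Q := Q) v w) : gr HJ := dlift (@realize_path v w) f.

Lemma realize_linear v w : linear (@realize v w).
Proof. by apply: dlift_linear => p; apply: realize_path_linear. Qed.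

Lemma realize_incl v w (p : path v w) (x : Mpath p) :
  realize (path_incl x) = realize_path x.
Proof.
by rewrite /realize dlift_inj // => q; rewrite (linear_at0 (@realize_path_linear _ _ _)).
Qed.

Lemma realize_comp v w u (g : fhom (Q := Q) w u) (f : fhom (Q := Q) v w) :
  realize (fcomp g f) = realize g * realize f.
Proof.
elim/fhom_ind: g => [|g g' IH IH'|q x].
- by rewrite (linear_at0 (fcomp_linl _)) !(linear_at0 (@realize_linear _ _)) mul0r.
- by rewrite (linear_atD (fcomp_linl _)) !(linear_atD (@realize_linear _ _)) IH IH' mulrDl.
elim/fhom_ind: f => [|f f' IH IH'|p y].
- by rewrite (linear_at0 (fcomp_linr _)) !(linear_at0 (@realize_linear _ _)) mulr0.
- by rewrite (linear_atD (fcomp_linr _)) !(linear_atD (@realize_linear _ _)) IH IH' mulrDr.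
by rewrite fcomp_incl !realize_incl realize_mcat.
Qed.

Lemma realize_scal v (s : valg_at Hp v) : realize (scal (Q := Q) s) = homog HJ 0 (vsval s).
Proof. by rewrite /scal realize_incl. Qed.

Lemma realize_id v : realize (fid (Q := Q) v) = gr_idem Hd v.
Proof. by rewrite -[fid v]/(scal (Q := Q) (1 : valg_at Hp v)) realize_scal valg_at1. Qed.

Lemma realize_gcorner v w (f : fhom (Q := Q) v w) : gcorner w v (realize f).
Proof. by rewrite /gcorner -!realize_id -!realize_comp fcomp_idl fcomp_idr. Qed.

Lemma realize_arr v w (a : arrow (b := Q) v w) (m : irr e v w) :
  realize (arr (Q := Q) (a := a) m) = homog HJ 1 (qrepr m).
Proof.
have E1 : @realize_path v v (pnil _ v) (1 : valg_at Hp v) = homog HJ 0 (e v).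
  by rewrite -(valg_at1 Hp v).
have mC : qrepr m \in crn e w v by apply: qrepr_in.
rewrite /arr realize_incl (realize_pure a) E1.
by rewrite homogM ?memvf ?(crn_pow1 (irr_arrow_neq Hp a)) // addn0 (crnr Hp mC).
Qed.

(** The graded algebra is generated in degrees 0 and 1: [J^(i+1)] is spanned by products from [J]
    and [J^i], and the [e_u] summing to 1, inserted between the factors, turn the first one into
    elements of arrow bimodules. *)
Lemma realize_surj_homog i v w b : b \in pow i -> b \in crn e w v ->
  exists f, @realize v w f = homog HJ i b.
Proof.
elim: i v w b => [|i IH] v w b bJ bC.
  have [wv|wv] := eqVneq w v; last first.
    exists 0; rewrite (linear_at0 (@realize_linear _ _)); apply/esym/eqP.
    rewrite -(linear0 (homog HJ 0)); apply/eqP/homog_eq; rewrite ?memvf ?subr0 //.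
    exact: (crn_pow1 wv).
  by case: v / wv bC => bC; exists (scal (Q := Q) (Subvs bC : valg_at Hp w)); rewrite realize_scal.
(* The elements whose class is in the image form a subspace, so it is enough to treat products. *)
have [U UP] : exists U : {vspace A}, forall x,
    x \in U <-> exists f, @realize v w f = homog HJ i.+1 (e w * x * e v).
  apply: vspace_of_predP => [|c x y [f fE] [g gE]].
    by exists 0; rewrite mulr0 mul0r linear0 (linear_at0 (@realize_linear _ _)).
  exists (c *: f + g); rewrite realize_linear fE gE mulrDr mulrDl -scalerAr -scalerAl.
  by rewrite linearP.
rewrite -(crnP Hp _ _ _ bC); apply/UP; move: b bJ {bC}; apply/subvP.
apply: subv_trans (ideal_powS_prod e i) _; apply/prodvP => a c aJ cJ; apply/UP.
have exu u : exists f, @realize v w f = homog HJ i.+1 ((e w * a * e u) * (e u * c * e v)).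
  have [->|a0] := eqVneq (e w * a * e u) 0.
    by exists 0; rewrite mul0r linear0 (linear_at0 (@realize_linear _ _)).
  have wu : w != u.
    by apply: contraNneq a0 => ->; rewrite ((off_diagP He a).1 aJ).
  have [g gE] := IH v u _ (pow_bimul Hd (e u) (e v) cJ) (mem_crn e u v c).
  have aC := mem_crn e w u a.
  have C0 : crn e w u != 0%VS.
    by apply: contraNneq a0 => C0; move: aC; rewrite C0 memv0.
  have [ar] : inhabited (irr_arrow e u w).
    by split; rewrite /irr_arrow eq_sym wu C0; apply: ord0.
  exists (fcomp (arr (Q := Q) (a := ar) (irr_pi e u w (e w * a * e u))) g).
  rewrite realize_comp realize_arr homog_irr_pi // gE homogM //; first exact: (crn_pow1 wu).
  exact: (pow_bimul Hd).
have [f fE] := choice exu; exists (\sum_u f u).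
rewrite (linear_at_sum (@realize_linear _ _)); under eq_bigr do rewrite fE.
rewrite -linear_sum; congr (homog _ _ _).
rewrite -[a in RHS]mulr1 -(pe_sum Hp) mulr_sumr mulr_suml mulr_sumr mulr_suml.
by apply: eq_bigr => u _; rewrite !mulrA -[_ * e u * e u]mulrA (pe_idem Hp).
Qed.

Lemma realize_surj v w x : gcorner w v x -> exists f, @realize v w f = x.
Proof.
move=> xc; have ex i : exists f, @realize v w f = dinj (dsum_fun x i).
  have [||f fE] := @realize_surj_homog i v w (e w * part_repr (dsum_fun x i) * e v).
  - exact/pow_bimul/part_repr_in.
  - exact: mem_crn.
  by exists f; rewrite fE /homog -(gcorner_comp _ xc).
have [f fE] := choice ex; have [s0 xs0] := dsum_support x; pose s := undup s0.
have us : uniq s by apply: undup_uniq.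
have xs j : x j != 0 -> j \in s by move=> /xs0; rewrite mem_undup.
exists (\sum_(i <- s) f i); rewrite (linear_at_sum (@realize_linear _ _)).
rewrite [RHS]dsum_decomp (dliftE _ us xs); first by apply: eq_bigr => i _; rewrite fE.
by move=> i; apply: linear0.
Qed.

Section Counting.
Hypothesis sdA : forall key : L -> nat, injective key -> stratified_dims e N key.

Lemma dim_crn_diag_gt0 w : (0 < \dim (crn e w w))%N.
Proof.
rewrite lt0n dimv_eq0; apply: contraNneq (idem_neq0 Hp w) => C0.
by have := crn_id Hp w; rewrite C0 memv0.
Qed.

(** After multiplication by [dim A_w] the right side is the sum in [dim_crn_irr], which dominates
    the left side termwise by [irr_dim_rank]. *)
Lemma rank_word w v : w != v ->
  (\sum_(u | u != w) irr_rank e N w u * rank e N u v <= rank e N w v)%N.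
Proof.
move=> wv; rewrite -(leq_pmul2r (dim_crn_diag_gt0 w)) -(dim_crn_rank Hp sdA).
rewrite -(dim_crn_irr Hp sdA wv) big_distrl /=; apply: leq_sum => u uw.
by rewrite mulnAC [leqRHS]mulnC leq_mul2r (irr_dim_rank Hp sdA) ?orbT // eq_sym.
Qed.

(** The number of words given by [word_lgenerating] is at most the left side of [rank_word]. *)
Lemma fhom_generators v w : exists n (f : 'I_n -> fhom (Q := Q) v w),
  (n <= rank e N w v)%N /\ lgenerating f.
Proof.
have [n] := ubnP (h w); elim: n w => // n IH w; rewrite ltnS => wn.
have [wv|wv] := eqVneq w v.
  rewrite {}wv; exists 1%N, (fun=> fid (Q := Q) v).
  split; last by have [] := @id_basis _ Q v.
  by have := dim_crn_diag_gt0 v; rewrite (dim_crn_rank Hp sdA); case: (rank e N v v).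
have exb (u w' : vertex Q) (a : arrow u w') : exists m : 'I_(irr_rank e N w' u) -> abim a,
    generating (M := left_mod (abim a)) m.
  exact: irr_left_generators.
pose m u w' a := sval (cid (exb u w' a)).
have mg u w' a : generating (M := left_mod (abim a)) (m u w' a) := svalP (cid (exb u w' a)).
have exf u : exists x : {n : nat & 'I_n -> fhom (Q := Q) v u},
    (projT1 x <= rank e N u v)%N /\ (arrow u w -> lgenerating (projT2 x)).
  (* Without an arrow to [w], the vertex [u] need not be lower than [w], and the empty family
     serves. *)
  have [[a]|na] := pselect (inhabited (arrow u w)); last first.
    by exists (existT _ 0%N (fun=> 0)); split=> // a; case: na.
  have [|n' [f [fn fg]]] := IH u; last by exists (existT _ n' f).
  exact: leq_trans (irr_arrow_height Hp a) wn.
pose x u := sval (cid (exf u)); have xP u := svalP (cid (exf u)).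
have wv' : (w : vertex Q) <> v by apply/eqP.
have gW := @word_lgenerating _ Q v w wv' (fun u w' _ => irr_rank e N w' u) _ m
  (fun u => projT2 (x u)) mg (fun u => (xP u).2).
pose W := word_index (Q := Q) w (fun u w' _ => irr_rank e N w' u) (fun u => projT1 (x u)).
exists #|{: W}|, (fun i => word_basis m (fun u => projT2 (x u)) (enum_val i)).
split; last first.
  move=> y; have [c ->] := gW y; exists (fun i => c (enum_val i)).
  by rewrite (reindex _ (onW_bij _ (@enum_val_bij W))).
rewrite card_word_index; apply: leq_trans (rank_word wv).
rewrite [leqRHS]big_mkcond /=; apply: leq_sum => u _.
(* There is at most one arrow from [u] to [w]. *)
rewrite sum_nat_const card_ord eq_sym.
case: ifP => uw; last by rewrite mul0n.
by case: (_ != _); rewrite ?mul0n // mul1n leq_mul2l (xP u).1 orbT.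
Qed.

(** Coordinate vectors with respect to [g] map onto [e_w A e_v] and form a space that is not larger,
    so this map is injective; going through coordinates avoids speaking of the dimension of
    [fhom]. *)
Lemma realize_inj v w f : @realize v w f = 0 -> f = 0.
Proof.
have [n [g [nr gg]]] := fhom_generators v w.
pose V : vectType k := {ffun 'I_n -> valg_at Hp w}.
pose b (c : V) : fhom v w := \sum_i (fcomp (scal (Q := Q) (c i)) (g i) : fhom v w).
have bl : linear b.
  move=> a x y; rewrite /b scaler_sumr -big_split; apply: eq_bigr => i _.
  by rewrite !ffunE scal_linear fcomp_linl.
have bs y : exists c, b c = y.
  have [c ->] := gg y; exists [ffun i => c i]; apply: eq_bigr => i _.
  by rewrite ffunE.
pose t (c : V) : A := blk e w v (gr_lift (realize (b c))).
have tl : linear t.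
  by move=> a x y; rewrite /t bl realize_linear gr_lift_linear linearP.
have [x xC|_ inj] := @linear_onto_dim _ _ _ t (crn e w v) tl.
  have [y yc yE] := gr_lift_surj Hd Hp xC; have [g' gE] := realize_surj yc.
  by have [c cE] := bs g'; exists c; rewrite /t blkE cE gE yE.
have [c <-] := bs f => rc0; rewrite (inj _ c) ?(linear_at0 bl) //.
  rewrite dim_ffun (dim_crn_rank Hp sdA) [\dim {: valg_at Hp w}]dimvf leq_mul2r.
  by rewrite nr orbT.
by rewrite /t rc0 (linear_at0 (@gr_lift_linear _ _ _ _ _ _)) linear0.
Qed.

Lemma graded_cat_free : cat_iso (graded_cat Hd) (free_cat Q).
Proof.
have ex v w (x : corner (gr_idem Hd) v w) : exists f, @realize v w f = cval x.
  exact/realize_surj/cornerE.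
pose G v w x := sval (cid (ex v w x)).
have GP v w x : realize (G v w x) = cval x := svalP (cid (ex v w x)).
have r_inj v w (f g : fhom (Q := Q) v w) : realize f = realize g -> f = g.
  move=> fg; apply: subr0_eq; apply: realize_inj.
  by rewrite (linear_atB (@realize_linear _ _)) fg subrr.
have Gl v w : linear (G v w).
  by move=> a x y; apply: r_inj; rewrite realize_linear !GP.
pose G' v w : {linear corner (gr_idem Hd) v w -> fhom (Q := Q) v w} :=
  HB.pack (G v w) (GRing.isLinear.Build _ _ _ _ (G v w) (Gl v w)).
exists id, G'; split.
- by exists id.
- move=> v w; have fC (f : fhom (Q := Q) v w) : realize f \in corner_pred (gr_idem Hd) v w.
    exact/eqP/realize_gcorner.
  exists (fun f => Corner (fC f)) => [x|f]; first by apply: val_inj; rewrite /= GP.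
  by apply: r_inj; rewrite /= GP.
- by move=> v; apply: r_inj; rewrite /= GP realize_id.
by move=> v u w g f; apply: r_inj; rewrite /= realize_comp !GP.
Qed.

End Counting.
End Realization.

(** * The equivalences *)

Lemma linear_order_key (L : finType) (le : rel L) : linear_order le ->
  exists key : L -> nat, injective key /\ forall i j, le i j = (key i <= key j)%N.
Proof.
move=> [le_refl le_anti le_trans le_total].
pose key i := #|[set j | le j i]|.
have leE i j : le i j = (key i <= key j)%N.
  apply/idP/idP => [ij|]; first by apply/subset_leq_card/subsetP => x; rewrite !inE => /le_trans; apply.
  apply: contraTT => ij; rewrite -ltnNge; apply/proper_card/properP.
  have ji : le j i by case/orP: (le_total i j) => // ij'; rewrite ij' in ij.
  split; first by apply/subsetP => x; rewrite !inE => /le_trans; apply.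
  by exists i; rewrite !inE.
exists key; split=> // i j ij; apply: le_anti.
by rewrite !leE ij leqnn.
Qed.

Lemma key_linear_order (L : finType) (key : L -> nat) : injective key ->
  linear_order (fun i j => key i <= key j)%N.
Proof.
move=> ik; split=> [i|i j|j i l|i j]; first exact: leqnn.
- by move=> /anti_leq/ik.
- exact: leq_trans.
exact: leq_total.
Qed.

Theorem theorem2p5 (k : closedFieldType) (A : falgType k) (L : finType)
    (e : L -> A) (He : complete_primitive_orthogonal e) (HA : basic e)
    (Hd : directed (alg_cat He)) :
  ((forall le : rel L, linear_order le -> standardly_stratified e le) <->
   (exists Q : bimod_quiver k,
      left_regular Q /\ cat_iso (graded_cat Hd) (free_cat Q)))
  /\
  ((forall le : rel L, linear_order le -> properly_stratified e le) <->
   (exists Q : bimod_quiver k,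
      regular Q /\ cat_iso (graded_cat Hd) (free_cat Q))).
Proof.
have [N [h Hp]] := peirce_exists Hd.
have dims_of : (forall le : rel L, linear_order le -> standardly_stratified e le) ->
    forall key : L -> nat, injective key -> stratified_dims e N key.
  move=> sA key ik; apply/(standardly_stratified_dims Hp ik (fun i j => erefl)).
  exact/sA/key_linear_order.
split; split.
- move=> /dims_of sd; exists (algebra_quiver Hp); split.
    exact: algebra_quiver_left_regular.
  exact: graded_cat_free.
- move=> [Q [lQ iso]] le /linear_order_key[key [ik leE]].
  apply/(standardly_stratified_dims Hp ik leE); exact: (free_standardly_dims Hp lQ iso ik).
- move=> pA; have sd := dims_of (fun le lin => (pA le lin).1).
  exists (algebra_quiver Hp); split; last exact: graded_cat_free.
  split; first exact: algebra_quiver_left_regular.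
  apply: algebra_quiver_right_regular => // key ik.
  apply/(properly_stratified_dims Hp ik (fun i j => erefl)).
  exact: (pA _ (key_linear_order ik)).2.
move=> [Q [[lQ rQ] iso]] le /linear_order_key[key [ik leE]]; split.
  apply/(standardly_stratified_dims Hp ik leE); exact: (free_standardly_dims Hp lQ iso ik).
apply/(properly_stratified_dims Hp ik leE); exact: (free_properly_dims Hp rQ iso ik).
Qed.
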